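(* Let $\mathbb K$ be a field of characteristic $0$ and let $x\in\mathbb K$. Let $D,D_1,D_2,G_1,G_2$ be five nonempty dissection diagrams. Then: 1. $L(D)\neq L(G_1G_2)$; 2. $L(D_1D_2)=L(G_1G_2)$ if and only if $(D_1,D_2)=(G_1,G_2)$ or $(D_1,D_2)=(G_2,G_1)$.
   Context: Dissection diagrams. For $n\ge 0$ let $\Pi_n$ be the regular $(n+1)$-gon with vertices $0,1,\dots,n$ numbered clockwise; vertex $0$ is the root. For $0\le i\le n$, side $i$ goes from vertex $i$ to vertex $i+1$ (with $n+1$ read as $0$). A chord is a segment joining two distinct vertices (adjacent vertices are allowed; such a chord is distinct from the side). A dissection diagram of degree $n$ is a set of $n$ pairwise non-crossing chords (they may share endpoints) of $\Pi_n$ forming an acyclic graph, hence a spanning tree on $\{0,\dots,n\}$. It is nonempty if $n\ge1$. All chords are oriented towards the root. $\mathrm{Ch}(D)$ is the set of chords of $D$. The diagram of degree $0$ is identified with $1$; $a$ denotes the diagram of degree $1$. Coproduct. $\mathcal H_D$ is the commutative polynomial algebra on dissection diagrams of positive degree, with $\Delta(D)=\sum_{C\subset \mathrm{Ch}(D)}x^{k_C(D)}q_C(D)\otimes r_C(D)$ (with $x^0=1$). Here the $p=|C|$ chords of $C$ cut the polygon into $p+1$ faces; for a face $\alpha$ let $S_C(\alpha)$ be the (nonempty) set of sides of the polygon bordering $\alpha$. $q_C(D)$ is obtained by contracting every chord of $C$ to a point: each face $\alpha$ becomes a polygon with set of sides $S_C(\alpha)$, rooted at the starting vertex of its side of minimal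 label, carrying the chords of $D$ not in $C$ that lie in $\alpha$; this is a dissection diagram, and $q_C(D)$ is the product of these over all faces. $r_C(D)$ is the dissection diagram of degree $p$ obtained by keeping the chords of $C$ and contracting all sides which are not the minimal side of their face, the root being the image of $0$. $k_C(D)$ is the number of chords of $C$ whose orientation in $D$ is opposite to their orientation (towards the root) in $r_C(D)$. The map $L$. On the vector space $\mathfrak g_{\mathcal D}$ with basis the nonempty dissection diagrams, let $D_1\circ D_2=\sum_D c(D_1,D_2;D)\,D$, where $c(D_1,D_2;D)$ is the coefficient of $D_1\otimes D_2$ in $\Delta(D)$ (a left pre-Lie product). Then $L(D)=D\circ a$ and $L(D_1D_2)=D_1\circ(D_2\circ a)-(D_1\circ D_2)\circ a$, which is the Oudom–Guin extension $(D_1D_2)\circ a$ of the pre-Lie product. *)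

(* Defs.v *)
From HB Require Import structures.
From mathcomp Require Import all_boot all_order all_algebra.
From mathcomp Require Import finmap zify.
From mathcomp.multinomials Require Import monalg.

Set Implicit Arguments.
Unset Strict Implicit.
Unset Printing Implicit Defensive.

Import GRing.Theory.

(* A chord of the (n+1)-gon is the pair (i, j), i < j, of its end points; a   *)
(* side is denoted by its label i, and goes from vertex i to vertex i + 1.    *)
Definition chord n := ('I_n.+1 * 'I_n.+1)%type.

Section Polygon.
Variable n : nat.
Implicit Types (c d : chord n) (C E : {set chord n}) (u v s t : 'I_n.+1).

Definition mkchord u v : chord n := if u < v then (u, v) else (v, u).

Definition crossing c d : bool :=
  [&& c.1 < d.1, d.1 < c.2 & c.2 < d.2] || [&& d.1 < c.1, c.1 < d.2 & d.2 < c.2].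

Definition adj E : rel 'I_n.+1 :=
  fun u v => ((u, v) \in E) || ((v, u) \in E).

(* A simple graph is acyclic when its only ucycles are the degenerate ones,   *)
(* which have at most two vertices.                                           *)
Definition acyclic E : bool :=
  [forall p : {bseq n.+1 of 'I_n.+1}, ucycleb (adj E) p ==> (size p <= 2)].

Definition is_dissection E : bool :=
  [&& [forall c in E, c.1 < c.2],
      [forall c in E, forall d in E, ~~ crossing c d],
      acyclic E & #|E| == n].

(* In a spanning tree E, the chord {u, v} is oriented from u to v iff v       *)
(* remains joined to the root once this chord is removed.                     *)
Definition points_to E u v : bool :=
  connect (adj (E :\ mkchord u v)) v ord0.

(* Going from vertex c.1 to vertex c.2 clockwise one meets the sides i with   *)
(* c.1 <= i < c.2; the other sides lie across c.                              *)
Definition beyond c s : bool := c.1 <= s < c.2.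
Definition separates c s t : bool := beyond c s (+) beyond c t.

(* The sides bordering the same face of the polygon cut along C. Each face    *)
(* has a side, so it is represented by its side of minimal label.             *)
Definition same_face C s t : bool := [forall c in C, ~~ separates c s t].
Definition face_sides C s : {set 'I_n.+1} := [set t | same_face C s t].
Definition min_sides C : {set 'I_n.+1} :=
  [set s | [forall t, same_face C s t ==> (s <= t)]].

(* For a set S of sides bordering a face, a chord which does not cross the    *)
(* boundary of that face lies in it iff it separates two of its sides.        *)
Definition lies_in (S : {set 'I_n.+1}) c : bool :=
  [exists s in S, exists t in S, separates c s t].

(* Keeping only the sides of S, in the same cyclic order, gives a polygon     *)
(* with #|S| sides rooted at the start of the side of minimal label; a vertex *)
(* v is sent to the start of the first side of S met clockwise from v.        *)
Definition collapse (S : {set 'I_n.+1}) v : 'I_(#|S|.-1).+1 :=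
  inZp #|[set s in S | s < v]|.

End Polygon.

Definition contract n (S : {set 'I_n.+1}) (E : {set chord n}) :
    {set chord #|S|.-1} :=
  [set mkchord (collapse S c.1) (collapse S c.2) | c in E].

Record dissection n := Dissection {
  chords :> {set chord n};
  chordsP : is_dissection chords
}.

HB.instance Definition _ n := [isSub for @chords n].
HB.instance Definition _ n := [Finite of dissection n by <:].

Section Separation.
Variable n : nat.
Implicit Types (c d e : chord n) (C E X Y : {set chord n}) (u v s t : 'I_n.+1).

Definition ordered E := forall c, c \in E -> c.1 < c.2.
Definition noncrossing E := forall c d, c \in E -> d \in E -> ~~ crossing c d.
Definition separated E (S : {set 'I_n.+1}) :=
  forall s t, s \in S -> t \in S -> s != t -> ~~ same_face E s t.
Definition essential E (S : {set 'I_n.+1}) := forall e, e \in E ->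
  exists s t, [/\ s \in S, t \in S, separates e s t & same_face (E :\ e) s t].

Lemma same_faceP C s t :
  reflect {in C, forall c, beyond c s = beyond c t} (same_face C s t).
Proof.
apply: (iffP forall_inP) => H c cC; move: (H c cC); rewrite /separates.
  by case: (beyond c s) (beyond c t) => [] [].
by move=> ->; rewrite addbb.
Qed.

Lemma same_faceNP C s t :
  reflect (exists2 c, c \in C & beyond c s != beyond c t) (~~ same_face C s t).
Proof.
rewrite negb_forall_in; apply: (iffP exists_inP) => -[c cC h]; exists c => //;
  by move: h; rewrite /separates; case: (beyond c s) (beyond c t) => [] [].
Qed.

Lemma same_face_refl C s : same_face C s s.
Proof. exact/same_faceP. Qed.

Lemma same_face_sym C s t : same_face C s t = same_face C t s.
Proof. by apply/same_faceP/same_faceP => h c cC; rewrite h. Qed.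

Lemma same_face_trans C s t u :
  same_face C s t -> same_face C t u -> same_face C s u.
Proof.
move=> /same_faceP h1 /same_faceP h2; apply/same_faceP=> c cC.
by rewrite h1 // h2.
Qed.

Lemma separatesE c s t : separates c s t = (beyond c s != beyond c t).
Proof. by rewrite /separates; case: (beyond c s) (beyond c t) => [] []. Qed.

Lemma noncrossing_nested c d : c.1 < c.2 -> d.1 < d.2 -> ~~ crossing c d ->
  [\/ forall u, beyond d u -> beyond c u, forall u, beyond d u -> ~~ beyond c u
    | forall u, beyond c u -> beyond d u].
Proof.
case: c d => [i j] [k l]; rewrite /crossing /beyond /= => ij kl nc.
have [jk|kj] := leqP j k; first by apply: Or32 => u; lia.
have [li|il] := leqP l i; first by apply: Or32 => u; lia.
have [ik|ki] := leqP i k.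
  have [lj|jl] := leqP l j; first by apply: Or31 => u; lia.
  by apply: Or33 => u; lia.
have [jl|lj] := leqP j l; first by apply: Or33 => u; lia.
by exfalso; lia.
Qed.

Lemma noncrossing_split c d s s' t t' : c.1 < c.2 -> d.1 < d.2 ->
  ~~ crossing c d -> beyond c s = beyond c s' -> beyond c t = beyond c t' ->
  beyond d s != beyond d s' -> beyond d t != beyond d t' ->
  beyond c s = beyond c t.
Proof.
move=> oc od nc es et.
case: (noncrossing_nested oc od nc) => h; move: (h s) (h s') (h t) (h t');
  rewrite -{}es -{}et;
  move: (beyond c s) (beyond c t) (beyond d s) (beyond d s') (beyond d t)
    (beyond d t') => [] [] [] [] [] [] //= h1 h2 h3 h4;
  by [move: (h1 isT) | move: (h2 isT) | move: (h3 isT) | move: (h4 isT)].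
Qed.

Definition rep C s : 'I_n.+1 := [arg min_(t < s | same_face C s t) t].

Lemma repP C s : same_face C s (rep C s) /\ rep C s \in min_sides C.
Proof.
rewrite /rep; case: arg_minnP => [|t st tmin]; first exact: same_face_refl.
split=> //; rewrite inE; apply/forallP=> u; apply/implyP=> tu.
exact/tmin/(same_face_trans st).
Qed.

Lemma min_sides_inj C s t :
  s \in min_sides C -> t \in min_sides C -> same_face C s t -> s = t.
Proof.
rewrite !inE => /forallP hs /forallP ht st; apply/val_inj/eqP => /=.
rewrite eqn_leq (implyP (hs t)) // (implyP (ht s)) //.
by rewrite same_face_sym.
Qed.

Lemma rep_eq C s m : m \in min_sides C -> (rep C s == m) = same_face C m s.
Proof.
move=> mM; have [sr rM] := repP C s.
apply/eqP/idP => [<-|ms]; first by rewrite same_face_sym.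
by apply: (@min_sides_inj C) => //; rewrite same_face_sym (same_face_trans ms).
Qed.

Lemma same_faceU1 d Y s t :
  same_face (d |: Y) s t = (beyond d s == beyond d t) && same_face Y s t.
Proof.
apply/same_faceP/andP => [h|[/eqP h1 /same_faceP h2] c].
  split; first by rewrite h ?setU11.
  by apply/same_faceP=> c cY; rewrite h // setU1r.
by rewrite !inE => /predU1P[->|/h2].
Qed.

Lemma card_min_sidesU1 d Y : ordered (d |: Y) -> noncrossing (d |: Y) ->
  #|min_sides (d |: Y)| <= #|min_sides Y|.+1.
Proof.
move=> od nc; rewrite -(cardsID (min_sides Y)) -[leqRHS]addn1 leq_add //.
  by apply: subset_leq_card; apply: subsetIr.
apply/card_le1_eqP => t s /setDP[tD tY] /setDP[sD sY].
have new u : u \in min_sides (d |: Y) -> u \notin min_sides Y ->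
    beyond d u != beyond d (rep Y u).
  move=> uD uY; have [ur rM] := repP Y u; apply: contraNneq uY => h.
  suff -> : u = rep Y u by [].
  apply/val_inj/eqP; rewrite /= eqn_leq.
  move: uD; rewrite inE => /forallP/(_ (rep Y u)).
  rewrite same_faceU1 h eqxx ur /= => ->.
  move: rM; rewrite inE => /forallP/(_ u); rewrite same_face_sym ur /= => ->.
  by [].
have [hs ht] := (new s sD sY, new t tD tY).
have [sr _] := repP Y s; have [tr _] := repP Y t.
have st : same_face Y s t.
  apply/same_faceP => c cY.
  apply: (@noncrossing_split c d s (rep Y s) t (rep Y t)) => //.
  - by apply: od; rewrite setU1r.
  - by apply: od; rewrite setU11.
  - by apply: nc; rewrite ?setU11 ?setU1r.
  - by move/same_faceP: sr; apply.
  - by move/same_faceP: tr; apply.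
apply: (min_sides_inj sD tD); rewrite same_faceU1 st andbT.
have : rep Y s = rep Y t.
  have [_ rM] := repP Y t; apply/eqP; rewrite rep_eq //.
  by rewrite same_face_sym (same_face_trans st).
by move=> e; move: hs ht; rewrite e; do 3!case: (beyond d _).
Qed.

Lemma ordered_sub Y X : Y \subset X -> ordered X -> ordered Y.
Proof. by move=> /subsetP YX oX c /YX /oX. Qed.

Lemma noncrossing_sub Y X : Y \subset X -> noncrossing X -> noncrossing Y.
Proof. by move=> /subsetP YX nX c d /YX cX /YX dX; apply: nX. Qed.

Lemma card_min_sides X : ordered X -> noncrossing X ->
  #|min_sides X| <= #|X|.+1.
Proof.
have [m] := ubnP #|X|; elim: m X => // m IH X; rewrite ltnS => Xm oX nX.
have [->|[d dX]] := set_0Vmem X.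
  rewrite cards0; apply/card_le1_eqP => t s tM sM.
  by apply: (min_sides_inj sM tM); apply/same_faceP => c; rewrite inE.
have DX := subD1set X d; have E := cardsD1 d X; rewrite dX add1n in E.
have := @card_min_sidesU1 d (X :\ d); rewrite setD1K // => /(_ oX nX) le.
rewrite E; apply: leq_trans le _; rewrite ltnS; apply: IH.
- by rewrite -E.
- exact: ordered_sub oX.
- exact: noncrossing_sub nX.
Qed.

Lemma separated_card X : ordered X -> noncrossing X -> separated X setT ->
  n <= #|X|.
Proof.
move=> oX nX sX; have := card_min_sides oX nX.
suff -> : min_sides X = setT by rewrite cardsT card_ord.
apply/setP=> s; rewrite !inE; apply/forallP=> t; apply/implyP => st.
have [->//|nst] := eqVneq s t.
by move: (sX s t (in_setT _) (in_setT _) nst); rewrite st.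
Qed.

Lemma adj_sym E : symmetric (adj E).
Proof. by move=> u v; rewrite /adj orbC. Qed.

Lemma conn_sym E : connect_sym (adj E).
Proof. by apply: sym_connect_sym; apply: adj_sym. Qed.

Lemma adj_subE Y X : Y \subset X -> subrel (adj Y) (adj X).
Proof. by move=> /subsetP YX u v /orP[]/YX h; rewrite /adj h ?orbT. Qed.

Lemma conn_sub Y X u v : Y \subset X ->
  connect (adj Y) u v -> connect (adj X) u v.
Proof.
move=> YX; apply: connect_sub => a b /(adj_subE YX); exact: connect1.
Qed.

Lemma separates_cut e s t : e.1 < e.2 -> s < t ->
  separates e s t = ((s < e.1 <= t) != (s < e.2 <= t)).
Proof. by case: e => i j /= ij st; rewrite separatesE /beyond /=; lia. Qed.

Lemma same_face_closed E s t : ordered E -> s < t -> same_face E s t ->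
  closed (adj E) [pred v : 'I_n.+1 | s < v <= t].
Proof.
move=> oE st /forall_inP sf u v /orP[] uE; apply/eqP; rewrite !inE;
  have := sf _ uE; rewrite separates_cut ?(oE _ uE) //= negbK //.
by rewrite eq_sym.
Qed.

Lemma conn_separated E s t : ordered E -> s < t -> connect (adj E) s t ->
  ~~ same_face E s t.
Proof.
move=> oE st; apply: contraTN => /(same_face_closed oE st) cV.
by apply/negP => /(closed_connect cV); rewrite !inE ltnn leqnn st.
Qed.

Lemma acyclic_bridge E e : ordered E -> acyclic E -> e \in E ->
  ~~ connect (adj (E :\ e)) e.1 e.2.
Proof.
move=> oE aE eE; apply/negP; case/connectP=> p0 p0P lp.
case: (shortenP p0P) lp => p pP pu _ lp {p0 p0P}.
have sz : size (e.1 :: p) <= n.+1.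
  by rewrite -{1}(card_uniqP pu) -[leqRHS]card_ord max_card.
move/forallP: aE => /(_ (Bseq sz)) /=; rewrite /ucycleb [_ && _]andbC.
move: (oE e eE) => lt_e.
rewrite pu /= rcons_path -lp (sub_path (adj_subE (subD1set E e)) pP) /=.
rewrite {1}/adj -surjective_pairing eE orbT /=.
case: p pP pu lp sz => [|a [|b p]] //= pP _ lp _ _.
  by rewrite lp ltnn in lt_e.
move: pP; rewrite andbT -lp /adj !inE -surjective_pairing eqxx /=.
by case/andP=> _ /oE /=; rewrite ltnNge ltnW.
Qed.

Lemma acyclic_sub Y X : Y \subset X -> acyclic X -> acyclic Y.
Proof.
move=> YX /forallP aX; apply/forallP => p; apply/implyP => /andP[cp up].
move: (aX p); rewrite /ucycleb up andbT.
suff -> : cycle (adj X) p by [].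
by apply: sub_cycle cp; apply: adj_subE.
Qed.

Definition comp_min E : {set 'I_n.+1} :=
  [set v | [forall u, connect (adj E) v u ==> (v <= u)]].

Definition crep E s : 'I_n.+1 := [arg min_(t < s | connect (adj E) s t) t].

Lemma crepP E s : connect (adj E) s (crep E s) /\ crep E s \in comp_min E.
Proof.
rewrite /crep; case: arg_minnP => [|t st tmin]; first exact: connect0.
split=> //; rewrite inE; apply/forallP=> u; apply/implyP=> tu.
exact/tmin/(connect_trans st).
Qed.

Lemma comp_min_inj E s t :
  s \in comp_min E -> t \in comp_min E -> connect (adj E) s t -> s = t.
Proof.
rewrite !inE => /forallP hs /forallP ht st; apply/val_inj/eqP => /=.
rewrite eqn_leq (implyP (hs t)) // (implyP (ht s)) //.
by rewrite conn_sym.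
Qed.

Lemma acyclic_card E : ordered E -> acyclic E ->
  #|comp_min E| + #|E| <= n.+1.
Proof.
have [m] := ubnP #|E|; elim: m E => // m IH E; rewrite ltnS => Em oE aE.
have [->|[e eE]] := set_0Vmem E.
  by rewrite cards0 addn0 -[leqRHS]card_ord max_card.
have DE := subD1set E e; have ce := cardsD1 e E; rewrite eE add1n in ce.
have br := acyclic_bridge oE aE eE.
have {IH} := IH (E :\ e); rewrite -ce.
move=> /(_ Em (ordered_sub DE oE) (acyclic_sub DE aE)).
apply: leq_trans; rewrite ce addnS -addSn leq_add2r.
apply/proper_card/properP; split.
  apply/subsetP => v; rewrite !inE => /forallP h; apply/forallP=> u.
  by apply/implyP => /(conn_sub DE) vu; apply: (implyP (h u)).
have [c1 m1] := crepP (E :\ e) e.1; have [c2 m2] := crepP (E :\ e) e.2.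
set r1 := crep _ e.1 in c1 m1; set r2 := crep _ e.2 in c2 m2.
have c12 : connect (adj E) r1 r2.
  rewrite (connect_trans _ (conn_sub DE c2)) //.
  rewrite conn_sym (connect_trans _ (conn_sub DE c1)) // conn_sym connect1 //.
  by rewrite /adj -surjective_pairing eE.
have n12 : r1 != r2.
  apply: contraNneq br => e12; apply: connect_trans c1 _.
  by rewrite e12 conn_sym.
case: (ltngtP r1 r2) => [lt|lt|/val_inj e12]; last by rewrite e12 eqxx in n12.
  exists r2 => //; rewrite inE; apply/forallPn; exists r1.
  by rewrite conn_sym c12 /= -ltnNge.
exists r1 => //; rewrite inE; apply/forallPn; exists r2.
by rewrite c12 /= -ltnNge.
Qed.

Lemma dissection_separated E : ordered E -> acyclic E -> #|E| = n ->
  separated E setT.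
Proof.
move=> oE aE cE s t _ _ nst.
have c1 : #|comp_min E| <= 1.
  by have := acyclic_card oE aE; rewrite cE; lia.
have conn u v : connect (adj E) u v.
  have [cu mu] := crepP E u; have [cv mv] := crepP E v.
  apply: connect_trans cu _; rewrite conn_sym.
  by rewrite (card_le1_eqP c1 _ _ mv mu).
case: (ltngtP s t) => [lt|lt|/val_inj e]; last by rewrite e eqxx in nst.
  exact: conn_separated.
by rewrite same_face_sym; apply: conn_separated.
Qed.

Lemma separated_essential E : ordered E -> noncrossing E -> #|E| = n ->
  separated E setT -> essential E setT.
Proof.
move=> oE nE cE sE e eE.
have [/existsP[s /existsP[t /andP[nst h]]]|h] :=
  boolP [exists s, exists t, (s != t) && same_face (E :\ e) s t].
  exists s, t; split; rewrite ?inE // separatesE.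
  have := sE s t (in_setT _) (in_setT _) nst; apply: contraNneq => est.
  by rewrite -(setD1K eE) same_faceU1 est eqxx.
have DE := subD1set E e; have ce := cardsD1 e E; rewrite eE add1n in ce.
have := separated_card (ordered_sub DE oE) (noncrossing_sub DE nE).
suff sep : separated (E :\ e) setT by move=> /(_ sep); rewrite -ltnS -ce cE ltnn.
move=> s t _ _ nst; apply: contraNN h => st.
by apply/existsP; exists s; apply/existsP; exists t; rewrite nst.
Qed.

Lemma path_avoid E e z q x : ordered E ->
  {in z :: q, forall w, (w != e.1) && (w != e.2)} ->
  path (adj E) z (rcons q x) -> path (adj (E :\ e)) z (rcons q x).
Proof.
move=> oE; elim: q z => [|w q IH] z h /=.
  have /andP[n1 n2] := h z (mem_head _ _).
  rewrite !andbT /adj !inE; case: (e) n1 n2 => i j /= n1 n2.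
  by rewrite !xpair_eqE (negbTE n1) (negbTE n2) /= andbF.
have /andP[n1 n2] := h z (mem_head _ _).
case/andP=> zw pw; apply/andP; split.
  move: zw; rewrite /adj !inE; case: (e) n1 n2 => i j /= n1 n2.
  by rewrite !xpair_eqE (negbTE n1) (negbTE n2) /= andbF.
by apply: IH => // a aq; apply: h; rewrite inE aq orbT.
Qed.

Lemma essential_acyclic E : ordered E -> essential E setT -> acyclic E.
Proof.
move=> oE esE; apply/forallP => p; apply/implyP; case: p => p /= _.
case: p => [|x [|y [|z q]]] // /andP[/and3P[xy yz pz]].
change (is_true (path (adj E) z (rcons q x))) in pz.
rewrite !cons_uniq !inE !negb_or => /and4P[/and3P[nxy nxz xq] /andP[nyz yq] zq _].
exfalso; pose e := mkchord x y.
have e12 : (e = (x, y)) \/ (e = (y, x)).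
  by rewrite /e /mkchord; case: ifP => _; [left|right].
have eE : e \in E.
  by rewrite /e /mkchord; case/orP: xy => h; have := oE _ h => /= lt;
    rewrite ?lt // ltnNge ltnW.
have h : {in z :: q, forall w, (w != e.1) && (w != e.2)}.
  move=> w; rewrite inE => wq; have [nwx nwy] : w != x /\ w != y.
    split; apply: contraTneq wq => ->; rewrite negb_or ?nxz //.
    by rewrite nyz.
  by case: e12 => -> /=; rewrite nwx nwy.
have pz' := path_avoid oE h pz.
have yz' : adj (E :\ e) y z.
  move: yz; rewrite /adj !inE; case: e12 => -> /=; rewrite !xpair_eqE;
    by rewrite ?(eq_sym z) ?(negbTE nxz) ?(negbTE nyz) ?andbF /=.
have cyx : connect (adj (E :\ e)) y x.
  apply: connect_trans (connect1 yz') _; apply/connectP.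
  by exists (rcons q x) => //; rewrite last_rcons.
have ce : connect (adj (E :\ e)) e.1 e.2.
  have [[-> ->]|[-> ->]] : e.1 = x /\ e.2 = y \/ e.1 = y /\ e.2 = x => //.
    by case: (e12) => ->; [left|right].
  by rewrite conn_sym.
have [s [t [_ _ se sf]]] := esE _ eE.
have oE' := ordered_sub (subD1set E e) oE.
wlog st : s t se sf / s < t.
  case: (ltngtP s t) => [lt|lt|/val_inj est] W; first exact: (W s t).
    by apply: (W t s); rewrite // 1?same_face_sym // separatesE eq_sym -separatesE.
  by move: se; rewrite est separatesE eqxx.
have /(_ _ _ ce) := closed_connect (same_face_closed oE' st sf).
by move: se; rewrite separates_cut ?(oE _ eE) // !inE => /eqP.
Qed.

End Separation.

Lemma beyond_modn N r1 r2 r : r1 <= r2 -> r2 <= N -> r < N ->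
  (if r1 %% N < r2 %% N then r1 %% N <= r < r2 %% N
   else r2 %% N <= r < r1 %% N)
  = ((r2 == N) && (r1 < N)) (+) (r1 <= r < r2).
Proof.
move=> r12; rewrite leq_eqVlt => /predU1P[r2N|r2N] rN; last first.
  have r1N := leq_ltn_trans r12 r2N; rewrite !modn_small //.
  have /negbTE -> /= : r2 != N by lia.
  by case: ifP => // /negbT; rewrite -leqNgt; lia.
rewrite r2N modnn eqxx ltn0 leq0n /= rN !andbT.
move: r12; rewrite r2N leq_eqVlt => /predU1P[->|r1N].
  by rewrite modnn ltn0 ltnn leqNgt rN.
by rewrite modn_small // r1N; case: leqP.
Qed.

Lemma crossing_quad n (c d : chord n) : crossing c d ->
  forall b1 b2, exists s, beyond c s = b1 /\ beyond d s = b2.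
Proof.
case: c d => [i j] [k l]; rewrite /crossing /beyond /=.
case/orP=> /and3P[h1 h2 h3] [] [].
- by exists k; lia.
- by exists i; lia.
- by exists j; lia.
- by exists l; lia.
- by exists i; lia.
- by exists l; lia.
- by exists k; lia.
- by exists j; lia.
Qed.

Lemma is_dissectionP n (E : {set chord n}) :
  is_dissection E <-> [/\ ordered E, noncrossing E, acyclic E & #|E| = n].
Proof.
split=> [/and4P[/forall_inP oE /forall_inP nE aE /eqP cE]|[oE nE aE cE]].
  by split=> // c d cE' dE; have /forall_inP := nE c cE'; apply.
apply/and4P; split=> //; last exact/eqP.
  exact/forall_inP.
by apply/forall_inP => c cE'; apply/forall_inP => d; apply: nE.
Qed.

Section Contract.
Variables (n : nat) (S : {set 'I_n.+1}) (E : {set chord n}).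
Hypotheses (S0 : 0 < #|S|) (oE : ordered E) (nE : noncrossing E).
Hypotheses (sE : separated E S) (eE : essential E S).

Let rank (v : 'I_n.+1) := #|[set s in S | s < v]|.

Let rank_le_card v : rank v <= #|S|.
Proof. by apply/subset_leq_card/subsetP => s; rewrite inE => /andP[]. Qed.

Let rank_mono (u v : 'I_n.+1) : u <= v -> rank u <= rank v.
Proof.
move=> uv; apply/subset_leq_card/subsetP => s; rewrite !inE => /andP[-> /=].
by move=> su; apply: leq_trans uv.
Qed.

Let rank_le (u s : 'I_n.+1) : s \in S -> (rank u <= rank s) = (u <= s).
Proof.
move=> sS; have [us|su] := leqP u s; first exact: rank_mono.
apply/negbTE; rewrite -ltnNge; apply/proper_card/properP; split.
  apply/subsetP => t; rewrite !inE => /andP[-> /= ts]; exact: ltn_trans su.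
by exists s; rewrite !inE sS ?ltnn.
Qed.

Let rank_lt s : s \in S -> rank s < #|S|.
Proof.
move=> sS; apply/proper_card/properP; split.
  by apply/subsetP => t; rewrite inE => /andP[].
by exists s; rewrite // !inE ltnn andbF.
Qed.

Let collapseE v : collapse S v = rank v %% #|S| :> nat.
Proof. by rewrite /collapse /= prednK. Qed.

Let collapseS s : s \in S -> collapse S s = rank s :> nat.
Proof. by move=> sS; rewrite collapseE modn_small // rank_lt. Qed.

Lemma collapse_inj : {in S &, injective (collapse S)}.
Proof.
move=> s t sS tS /(congr1 (@nat_of_ord _)); rewrite !collapseS // => e.
by apply/val_inj/eqP; rewrite /= eqn_leq -!rank_le // e leqnn.
Qed.

Lemma collapse_onto k : exists2 s, s \in S & k = collapse S s.
Proof.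
suff /setP/(_ k) : collapse S @: S = [set: 'I_(#|S|.-1).+1].
  by rewrite inE => /imsetP.
apply/eqP; rewrite eqEcard subsetT card_in_imset; last exact: collapse_inj.
by rewrite cardsT card_ord (ltn_predK S0) leqnn.
Qed.

Let contract1 (c : chord n) := mkchord (collapse S c.1) (collapse S c.2).

Lemma beyond_collapse (c : chord n) : c.1 < c.2 -> exists b, {in S, forall s,
  beyond (contract1 c) (collapse S s) = b (+) beyond c s}.
Proof.
move=> ij; rewrite /contract1.
have := collapseE c.2; have := collapseE c.1.
move: (collapse S c.1) (collapse S c.2) => a b ea eb.
have rij := rank_mono (ltnW ij); have rj := rank_le_card c.2.
exists ((rank c.2 == #|S|) && (rank c.1 < #|S|)) => s sS.
have := rank_lt sS; have := collapseS sS; move: (collapse S s) => k ek rs.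
have -> : beyond c s = (rank c.1 <= rank s < rank c.2).
  by rewrite /beyond !ltnNge !rank_le.
rewrite -beyond_modn // -ea -eb -ek /mkchord /beyond.
by case: ifP.
Qed.

Lemma separates_collapse (c : chord n) s t : c.1 < c.2 -> s \in S -> t \in S ->
  separates (contract1 c) (collapse S s) (collapse S t) = separates c s t.
Proof.
move=> /beyond_collapse[b h] sS tS; rewrite /separates !h //.
by move: b (beyond c s) (beyond c t) {h} => [] [] [].
Qed.

Lemma same_face_collapse (C : {set chord n}) s t : C \subset E ->
  s \in S -> t \in S ->
  same_face (contract S C) (collapse S s) (collapse S t) = same_face C s t.
Proof.
move=> /subsetP CE sS tS; apply/forall_inP/forall_inP => h c.
  by move=> cC; rewrite -separates_collapse ?oE ?CE // h // imset_f.
by case/imsetP => d dC ->; rewrite separates_collapse ?oE ?CE // h.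
Qed.

Lemma is_dissection_contract : is_dissection (contract S E).
Proof.
have oX : ordered (contract S E).
  move=> x /imsetP[c cE ->].
  have [s [t [sS tS]]] := eE cE.
  rewrite -separates_collapse ?oE // => se _.
  move: se; rewrite separatesE /contract1 /beyond /mkchord.
  case: ltngtP => //= e.
  by rewrite e !(leqNgt (collapse S c.2)) !andNb.
have nX : noncrossing (contract S E).
  move=> x y /imsetP[c cE ->] /imsetP[d dE ->]; apply/negP => /crossing_quad q.
  have [bc hc] := beyond_collapse (oE cE).
  have [bd hd] := beyond_collapse (oE dE).
  have {}q b1 b2 : exists s, beyond c s = b1 /\ beyond d s = b2.
    have [k [k1 k2]] := q (bc (+) b1) (bd (+) b2).
    have [s sS ks] := collapse_onto k; exists s.
    by move: k1 k2; rewrite ks hc // hd // => /addbI -> /addbI ->.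
  case: (noncrossing_nested (oE cE) (oE dE) (nE cE dE)) => h.
  - by have [s [cs ds]] := q false true; have := h s; rewrite cs ds => /(_ isT).
  - by have [s [cs ds]] := q true true; have := h s; rewrite cs ds => /(_ isT).
  - by have [s [cs ds]] := q true false; have := h s; rewrite cs ds => /(_ isT).
have sX : separated (contract S E) setT.
  move=> k l _ _; have [s sS ->] := collapse_onto k.
  have [t tS ->] := collapse_onto l => st.
  by rewrite same_face_collapse // sE //; apply: contraNneq st => ->.
have eX : essential (contract S E) setT.
  move=> x /imsetP[c cE ->]; have [s [t [sS tS se sf]]] := eE cE.
  exists (collapse S s), (collapse S t); split; rewrite ?inE //.
    by rewrite separates_collapse ?oE.
  apply/forall_inP => y; rewrite !inE => /andP[nyc /imsetP[d dE yd]].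
  rewrite yd separates_collapse ?oE //; move/forall_inP: sf; apply.
  by rewrite !inE dE andbT; apply: contraNneq nyc => <-; rewrite yd.
have aX := essential_acyclic oX eX.
apply/is_dissectionP; split=> //; apply/eqP; rewrite eqn_leq separated_card //.
rewrite andbT -ltnS; apply: leq_trans (acyclic_card oX aX).
rewrite -add1n leq_add2r card_gt0; apply/set0Pn.
by exists (crep (contract S E) ord0); case: (crepP (contract S E) ord0).
Qed.

End Contract.

Section Cut.
Variables (n : nat) (D : dissection n).
Implicit Types (C E : {set chord n}) (s t : 'I_n.+1).

Lemma dissectionP : [/\ ordered D, noncrossing D, separated D setT
  & essential D setT].
Proof.
have [oD nD aD cD] := (is_dissectionP D).1 (chordsP D).
have sD := dissection_separated oD aD cD.
by split=> //; apply: separated_essential.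
Qed.

Lemma face_sides_gt0 C s : 0 < #|face_sides C s|.
Proof.
by rewrite card_gt0; apply/set0Pn; exists s; rewrite inE same_face_refl.
Qed.

Lemma min_sides_gt0 C : 0 < #|min_sides C|.
Proof.
by rewrite card_gt0; apply/set0Pn; exists (rep C ord0); case: (repP C ord0).
Qed.

Lemma same_face_sub C E s t : C \subset E -> same_face E s t -> same_face C s t.
Proof.
move=> /subsetP CE /forall_inP h; apply/forall_inP => c /CE; exact: h.
Qed.

Lemma is_dissection_face C s : C \subset D ->
  is_dissection (contract (face_sides C s)
                   [set c in D :\: C | lies_in (face_sides C s) c]).
Proof.
move=> CD; have [oD nD sD eD] := dissectionP.
set S := face_sides C s; set E := [set c in _ | _].
have ED : E \subset D by apply/subsetP => c; rewrite !inE => /andP[/andP[]].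
have SC t u : t \in S -> u \in S -> same_face C t u.
  by rewrite !inE => st su; rewrite (same_face_trans _ su) // same_face_sym.
apply: is_dissection_contract.
- exact: face_sides_gt0.
- exact: ordered_sub oD.
- exact: noncrossing_sub nD.
- move=> t u tS uS tu.
  have /same_faceNP[c cD htu] := sD t u (in_setT _) (in_setT _) tu.
  apply/same_faceNP; exists c => //; rewrite !inE cD andbT.
  apply/andP; split.
    by apply: contraNN htu => cC; move/same_faceP: (SC t u tS uS) => ->.
  apply/exists_inP; exists t => //; apply/exists_inP; exists u => //.
  by rewrite separatesE.
move=> e; rewrite !inE => /andP[/andP[eC eD'] /exists_inP[t tS]].
case/exists_inP=> u uS; rewrite separatesE => etu.
have [t' [u' [_ _ e' sf]]] := eD _ eD'.
have Ce : C \subset D :\ e.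
  apply/subsetP => c cC; rewrite !inE (subsetP CD) // andbT.
  by apply: contraNneq eC => <-.
have tt' : same_face C t t'.
  apply/same_faceP => c cC; have cD := subsetP CD c cC.
  apply: (@noncrossing_split _ c e t u t' u') => //;
    [exact: oD|exact: oD|exact: nD| | | by rewrite -separatesE].
    by move/same_faceP: (SC t u tS uS); apply.
  by move/same_faceP: (same_face_sub Ce sf); apply.
have st' : same_face C s t' by apply: same_face_trans tt'; rewrite inE in tS.
exists t', u'; split=> //.
- by rewrite inE.
- by rewrite inE (same_face_trans st') // (same_face_sub Ce).
- by apply: same_face_sub sf; rewrite setSD.
Qed.

Lemma is_dissection_cut C : C \subset D ->
  is_dissection (contract (min_sides C) C).
Proof.
move=> CD; have [oD nD sD eD] := dissectionP.
apply: is_dissection_contract.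
- exact: min_sides_gt0.
- exact: ordered_sub oD.
- exact: noncrossing_sub nD.
- by move=> s t sM tM; apply: contraNN => /(min_sides_inj sM tM) ->.
move=> e eC; have eD' := subsetP CD e eC.
have [s [t [_ _ se sf]]] := eD _ eD'.
have [sr rs] := repP C s; have [tr rt] := repP C t.
exists (rep C s), (rep C t); split=> //.
  move: se; rewrite !separatesE.
  by rewrite (same_faceP _ _ _ sr) // (same_faceP _ _ _ tr).
have CeC := subD1set C e.
apply: same_face_trans (same_face_sub CeC tr).
rewrite same_face_sym in sr; apply: same_face_trans (same_face_sub CeC sr) _.
by apply: same_face_sub sf; rewrite setSD.
Qed.

Lemma card_faces C :
  #|min_sides C| + \sum_(s in min_sides C) #|face_sides C s|.-1 = n.+1.
Proof.
rewrite -sum1_card -big_split /= -[RHS]card_ord -sum1_card; symmetry.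
rewrite (partition_big (rep C) (mem (min_sides C))) => [|s _]; last first.
  by case: (repP C s).
apply: eq_bigr => m mM; rewrite add1n prednK ?face_sides_gt0 // -sum1_card.
apply: eq_bigl => s.
by rewrite rep_eq // [RHS]inE.
Qed.

End Cut.

Section Factors.
Variables (n : nat) (D : dissection n).

Definition subchords := {C : {set chord n} | C \subset chords D}.

Definition face_diagram (C : subchords) (s : 'I_n.+1) :
    dissection #|face_sides (val C) s|.-1 :=
  Dissection (is_dissection_face s (valP C)).

Definition cut_diagram (C : subchords) : dissection #|min_sides (val C)|.-1 :=
  Dissection (is_dissection_cut (valP C)).

Definition reversed (C : subchords) : nat :=
  let M := min_sides (val C) in
  #|[set c in val C | points_to D c.1 c.2 !=
       points_to (cut_diagram C) (collapse M c.1) (collapse M c.2)]|.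

End Factors.

Local Open Scope ring_scope.

Definition ndiagram := {n : nat & dissection n.+1}.

(* The diagram of degree 0 is identified with the unit monomial. *)
Definition mon n : dissection n -> {cmonom ndiagram} :=
  match n with
  | 0 => fun _ => mone
  | n'.+1 => fun D => ucm (Tagged (fun k => dissection k.+1) D)
  end.

Section Coproduct.
Variables (n : nat) (D : dissection n) (C : subchords D).

Definition q_mon : {cmonom ndiagram} :=
  \big[mmul/mone]_(s in min_sides (val C)) mon (face_diagram C s).

Definition r_mon : {cmonom ndiagram} := mon (cut_diagram C).

End Coproduct.

Lemma is_dissection1 : is_dissection [set ((ord0, ord_max) : chord 1)].
Proof.
apply/and4P; split; rewrite ?cards1 //.
- by apply/forall_inP => c /set1P ->.
- apply/forall_inP => c /set1P ->; apply/forall_inP => d /set1P ->.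
  by rewrite /crossing.
- by apply/forallP => p; rewrite (size_bseq p) implybT.
Qed.

Definition diagram_a : ndiagram :=
  Tagged (fun k => dissection k.+1) (Dissection is_dissection1).

Section PreLie.
Variables (K : fieldType) (x : K).
Implicit Types D G : ndiagram.

(* H_D is the monoid algebra {malg K[{cmonom ndiagram}]} of polynomials in    *)
(* the nonempty diagrams; its tensor square has the pairs of monomials as a   *)
(* basis.                                                                     *)
Definition coproduct n (D : dissection n) :
    {malg K[({cmonom ndiagram} * {cmonom ndiagram})%type]} :=
  \sum_(C : subchords D) << x ^+ reversed C *g (q_mon C, r_mon C) >>.

Definition coef D1 D2 D : K :=
  (coproduct (tagged D))@_(ucm D1, ucm D2).

(* The coproduct is homogeneous for the degree, tag D + 1 for D in ndiagram,  *)
(* hence the range of the sum (see mcoeff_prelie_basis).                      *)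
Definition prelie_basis D1 D2 : {malg K[ndiagram]} :=
  \sum_(D : dissection (tag D1 + tag D2).+2)
    << coef D1 D2 (Tagged (fun k => dissection k.+1) D)
       *g Tagged (fun k => dissection k.+1) D >>.

Definition prelie (u v : {malg K[ndiagram]}) : {malg K[ndiagram]} :=
  \sum_(D1 <- msupp u) \sum_(D2 <- msupp v)
    (u@_D1 * v@_D2) *: prelie_basis D1 D2.

(* L on a single diagram, and L on a product of two diagrams. *)
Definition L_diag D : {malg K[ndiagram]} := prelie << D >> << diagram_a >>.

Definition L_prod D1 D2 : {malg K[ndiagram]} :=
  prelie << D1 >> (prelie << D2 >> << diagram_a >>)
  - prelie (prelie << D1 >> << D2 >>) << diagram_a >>.

Definition wdeg (m : {cmonom ndiagram}) : nat :=
  (\sum_(D <- finsupp m) m D * (tag D).+1)%N.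

Lemma wdegEw (m : {cmonom ndiagram}) (d : {fset ndiagram}) :
  (finsupp m `<=` d)%fset -> wdeg m = (\sum_(D <- d) m D * (tag D).+1)%N.
Proof.
move=> le; rewrite /wdeg (big_fset_incl _ le) // => D _.
by rewrite -cmE_eq0 => /eqP ->.
Qed.

Lemma wdeg1 : wdeg mone = 0%N.
Proof. by rewrite /wdeg mdom1 big_nil. Qed.

Lemma wdegU D : wdeg (ucm D) = (tag D).+1.
Proof. by rewrite /wdeg mdomU big_seq_fset1 cmUU mul1n. Qed.

Lemma wdegM (m1 m2 : {cmonom ndiagram}) :
  wdeg (mmul m1 m2) = (wdeg m1 + wdeg m2)%N.
Proof.
have le1 : (finsupp m1 `<=` finsupp (mmul m1 m2))%fset.
  by rewrite mdomD fsubsetUl.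
have le2 : (finsupp m2 `<=` finsupp (mmul m1 m2))%fset.
  by rewrite mdomD fsubsetUr.
rewrite (wdegEw le1) (wdegEw le2) -big_split /=.
by apply: eq_bigr => D _; rewrite cmM mulnDl.
Qed.

Lemma wdeg_mon n (D : dissection n) : wdeg (mon D) = n.
Proof. by case: n D => [|n] D /=; rewrite ?wdeg1 ?wdegU. Qed.

Lemma wdeg_qr n (D : dissection n) (C : subchords D) :
  (wdeg (q_mon C) + wdeg (r_mon C))%N = n.
Proof.
rewrite /r_mon wdeg_mon /q_mon.
have -> : wdeg (\big[mmul/mone]_(s in min_sides (val C)) mon (face_diagram C s))
    = (\sum_(s in min_sides (val C)) #|face_sides (val C) s|.-1)%N.
  rewrite (big_morph _ wdegM wdeg1); apply: eq_bigr => s _.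
  exact: wdeg_mon.
have := card_faces (val C); rewrite -{1}(prednK (min_sides_gt0 (val C))).
by rewrite addSn addnC => -[].
Qed.

Lemma coef_homogeneous D1 D2 D : coef D1 D2 D != 0 ->
  tag D = (tag D1 + tag D2).+1.
Proof.
apply: contra_neq_eq => neq; rewrite /coef /coproduct raddf_sum /= big1 // => C _.
rewrite mcoeffU; case: eqP => // -[eq er].
by have := wdeg_qr C; rewrite eq er !wdegU; move: neq; lia.
Qed.

Lemma mcoeff_prelie_basis D1 D2 D :
  mcoeff D (prelie_basis D1 D2) = coef D1 D2 D.
Proof.
rewrite /prelie_basis raddf_sum /=.
have [eqD|neqD] := eqVneq (tag D) (tag D1 + tag D2).+1%N; last first.
  rewrite big1 => [|E _].
    by apply/esym/eqP; apply: contraNT neqD => /coef_homogeneous ->.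
  rewrite mcoeffU; case: eqP => // e.
  by move: neqD; rewrite -e eqxx.
case: D eqD => n D /= eqD; rewrite {n}eqD in D *.
rewrite (bigD1 D) //= mcoeffUU big1 ?addr0 // => E nED.
by rewrite mcoeffU eq_Tagged (negbTE nED).
Qed.

End PreLie.

(* Main.v *)
(* A chord e of E cuts the polygon into an inner polygon and an outer one,    *)
(* which contains the last side. Expanding both terms of L(D1 D2) over the    *)
(* pairs e \in C \subset E and splitting C along e, only the terms where e is *)
(* cut alone survive, so that the coefficient of E in L(D1 D2) is the sum     *)
(* over e of x^(k_e(E)) ([in = D1, out = D2] + [in = D2, out = D1]); L(D) is  *)
(* the case where D2 has degree 0. The orientation of a chord is read off     *)
(* from the labels of two sides which it alone separates, hence the number of *)
(* reversed chords is additive when C is split along e.                       *)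
(* Now consider the degree of the root. A chord at the root is never          *)
(* reversed, and any other chord leaves in its outer polygon a root of at     *)
(* least the same degree. So the diagrams of maximal root degree in L(XY) are *)
(* X.a.Y and Y.a.X, the concatenations at the root with a leaf v between the  *)
(* two factors. Moving onto this leaf the root neighbour next to it gives the *)
(* diagrams of submaximal root degree, which determine v, hence X and Y.      *)
(* If L(D) = L(ZW), the same diagrams force D, Z and W to be stars; then the  *)
(* star whose chord {0, N-1} is replaced by {N-1, N} occurs in L(D), without  *)
(* reversals, hence with nonzero coefficient in characteristic 0, but it does *)
(* not occur in L(ZW).                                                        *)
Require Import Defs.
From mathcomp Require Import all_boot all_order all_algebra.
From mathcomp Require Import finmap zify ring.
From mathcomp.multinomials Require Import monalg.

Set Implicit Arguments.
Unset Strict Implicit.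
Unset Printing Implicit Defensive.

Import GRing.Theory.

(** * Collapsing a polygon onto a set of its sides *)

(** The map [L] is computed in closed form and then read through the degree of the root.

    Closed form. A chord [e] of E cuts the polygon into an inner and an outer piece. The coefficient
    of E in D1 o (D2 o a) is a sum over a cut C of E and one chord of r_C, that is, over pairs e in
    C. For fixed [e], such a C is a pair of cuts of the two pieces ([reindex_piece]): q_C is the
    product of the two quotients ([qmon_cut]), the quotient of r_C by the image of [e] is the
    product of the two remainders ([qmon_cut_diss]), and the exponents of x add up ([krev_cut]).
    Since D1 and D2 are generators, each comes from exactly one piece. When both come from the same
    piece, the other piece has degree 0 and the term cancels against (D1 o D2) o a; when they come
    from different pieces, these pieces are D1 and D2. This gives [L_prodE], and L(D) has the same
    form with a second factor of degree 0 ([L_diagE], [chord_coefE]).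

    Root degree. A chord away from the root leaves an outer piece whose root degree is at least that
    of E ([nonroot_rdeg]), and a chord at the root is never reversed ([krev1_eq0]). So if E has
    larger root degree than both X and Y, its coefficient in L(XY) is nonzero exactly when E splits
    at a root chord into X and Y in some order ([root_split_neq0], [split_root_ex]). The root degree
    is at most rdeg X + rdeg Y + 1, attained only by the concatenations X.a.Y and Y.a.X; hence L(XY)
    determines this set of diagrams ([same_leaf_splits]). One diagram might still be read with its
    leaf at two places; the diagrams of root degree one less, obtained by moving a root neighbour
    adjacent to the leaf onto it, exclude this up to the order of the factors ([same_nonempty]).

    Single diagram. If L(D) = L(ZW), then D.a and a.D are the two concatenations of Z and W. One
    diagram of submaximal root degree shows that D has a long run of root neighbours ([root_run]);
    comparing the two concatenations then makes D, Z and W stars. A star with its chord {0, d}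
    replaced by {d, d+1} occurs in L(D) but not in L(ZW) ([not_same_single]). *)

Section Collapse.
Variable n : nat.
Implicit Types (S T : {set 'I_n.+1}) (X : {set chord n}) (c : chord n).

(** The vertex is a [nat], so that the value at [n.+1] is available and equals the cardinal of
    [S]. *)
Definition side_rank S (v : nat) := #|[set s in S | s < v]|.

Definition collapse_chord S c := mkchord (collapse S c.1) (collapse S c.2).

Lemma mkchordC m (u v : 'I_m.+1) : mkchord u v = mkchord v u.
Proof. by rewrite /mkchord; case: ltngtP => // /val_inj ->. Qed.

Lemma mkchord_fst m (u v : 'I_m.+1) : (mkchord u v).1 = minn u v :> nat.
Proof. by rewrite /mkchord; case: ifP => h /=; lia. Qed.

Lemma mkchord_snd m (u v : 'I_m.+1) : (mkchord u v).2 = maxn u v :> nat.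
Proof. by rewrite /mkchord; case: ifP => h /=; lia. Qed.

Lemma mkchord_map m1 m2 (f : 'I_m1.+1 -> 'I_m2.+1) u v :
  mkchord (f (mkchord u v).1) (f (mkchord u v).2) = mkchord (f u) (f v).
Proof. by rewrite {2 3}/mkchord; case: ifP => //= _; rewrite mkchordC. Qed.

Lemma mkchordE c : c.1 < c.2 -> mkchord c.1 c.2 = c.
Proof. by rewrite /mkchord => ->; case: c. Qed.

Lemma collapseE S v : 0 < #|S| ->
  collapse S v = side_rank S v %% #|S| :> nat.
Proof. by move=> S0; rewrite /collapse /= prednK. Qed.

Lemma side_rank_le_card S v : side_rank S v <= #|S|.
Proof. by apply/subset_leq_card/subsetP => s; rewrite inE => /andP[]. Qed.

Lemma side_rank_mono S u v : u <= v -> side_rank S u <= side_rank S v.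
Proof.
move=> uv; apply/subset_leq_card/subsetP => s; rewrite !inE => /andP[-> /=].
by move=> su; apply: leq_trans uv.
Qed.

Lemma side_rank_ltE S (s : 'I_n.+1) v : s \in S ->
  (side_rank S s < side_rank S v) = (s < v).
Proof.
move=> sS; have [vs|sv] := leqP v s.
  by apply/negbTE; rewrite -leqNgt side_rank_mono.
apply/proper_card/properP; split.
  by apply/subsetP => t; rewrite !inE => /andP[-> /= ts]; apply: ltn_trans sv.
by exists s; rewrite !inE sS ?ltnn.
Qed.

Lemma side_rank_lt S (s : 'I_n.+1) : s \in S -> side_rank S s < #|S|.
Proof.
move=> sS; have := ltn_ord s; rewrite -(@side_rank_ltE S) // => h.
exact: leq_trans h (side_rank_le_card S _).
Qed.

Lemma collapse_in S s : s \in S -> collapse S s = side_rank S s :> nat.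
Proof.
move=> sS; rewrite collapseE ?modn_small ?side_rank_lt //.
by rewrite card_gt0; apply/set0Pn; exists s.
Qed.

Lemma collapse_lt S : {in S &, forall s t, (collapse S s < collapse S t) = (s < t)}.
Proof. by move=> s t sS tS; rewrite !collapse_in // side_rank_ltE. Qed.

Lemma collapse_le S : {in S &, forall s t, (collapse S s <= collapse S t) = (s <= t)}.
Proof. by move=> s t sS tS; rewrite leqNgt collapse_lt // -leqNgt. Qed.

(* The vertex u lies on the arc between the sides s and t which avoids 0. *)
Definition between m (s t u : 'I_m.+1) := minn s t < u <= maxn s t.

(** Collapsing preserves the order of the sides of [S]. The only wrap-around concerns a vertex past
    the last side of [S]: it is sent to 0, and neither it nor 0 lies on the arc. *)
Lemma between_collapse S s t u : s \in S -> t \in S ->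
  between (collapse S s) (collapse S t) (collapse S u) = between s t u.
Proof.
wlog st : s t / s <= t => [W|].
  case/orP: (leq_total s t) => st sS tS; first exact: W.
  by rewrite /between minnC maxnC (minnC s) (maxnC s); apply: W.
move=> sS tS; have st' : collapse S s <= collapse S t by rewrite collapse_le.
rewrite /between (minn_idPl st) (maxn_idPr st) (minn_idPl st') (maxn_idPr st').
have S0 : 0 < #|S| by rewrite card_gt0; apply/set0Pn; exists s.
rewrite (collapseE u) // !collapse_in //.
have [ul|] := boolP (side_rank S u < #|S|).
  by rewrite modn_small // side_rank_ltE // [X in _ && X]leqNgt side_rank_ltE // -leqNgt.
rewrite -leqNgt => ge; have /eqP e : side_rank S u == #|S|.
  by rewrite eqn_leq ge side_rank_le_card.
rewrite e modnn ltn0 /=; apply/esym/negbTE; rewrite negb_and -!ltnNge orbC.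
by rewrite -(side_rank_ltE _ tS) e side_rank_lt.
Qed.

End Collapse.

Section CollapseTwice.
Variable n : nat.
Implicit Types S T : {set 'I_n.+1}.

Lemma card_collapse S T : T \subset S -> #|collapse S @: T| = #|T|.
Proof.
move=> /subsetP TS; rewrite card_in_imset // => s t sT tT e.
have [sS tS] := (TS s sT, TS t tT).
by apply/val_inj/eqP; rewrite /= eqn_leq -!(@collapse_le _ S) // e leqnn.
Qed.

(** The sides of [T] before [v] can be counted after collapsing onto [S], which keeps their order; a
    vertex past the last side of [S] is past the last side of [T] too, and wraps to 0 on both sides
    of the equation. *)
Lemma collapse_collapse S T v : T \subset S -> 0 < #|T| ->
  collapse (collapse S @: T) (collapse S v) = collapse T v :> nat.
Proof.
move=> TS T0; have S0 := leq_trans T0 (subset_leq_card TS).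
rewrite [LHS]collapseE ?[RHS]collapseE ?card_collapse //;
  have [lt|] := boolP (side_rank S v < #|S|).
  congr (_ %% _); rewrite /side_rank.
  have US : [set t in T | t < v] \subset S.
    by apply: subset_trans TS; apply/subsetP => t; rewrite inE => /andP[].
  rewrite -(card_collapse US); apply: eq_card => i; rewrite !inE.
  apply/andP/imsetP => [[/imsetP[t tT ->]]|[t]].
    have tS := subsetP TS t tT.
    rewrite (collapse_in tS) collapseE // modn_small // side_rank_ltE //.
    by move=> tv; exists t; rewrite // inE tT.
  rewrite inE => /andP[tT tv] ->; have tS := subsetP TS t tT.
  by rewrite imset_f // (collapse_in tS) collapseE // modn_small // side_rank_ltE.
rewrite -leqNgt => ge; have /eqP e : side_rank S v == #|S|.
  by rewrite eqn_leq ge side_rank_le_card.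
have -> : collapse S v = 0 :> nat by rewrite collapseE // e modnn.
have -> : side_rank T v = #|T|.
  rewrite /side_rank; congr #|pred_of_set _|; apply/setP => t; rewrite inE.
  case tT: (t \in T) => //=; rewrite -(@side_rank_ltE _ S) ?(subsetP TS) // e.
  by rewrite side_rank_lt ?(subsetP TS).
by rewrite modnn /side_rank (_ : [set _ in _ | _] = set0) ?cards0 ?mod0n //;
  apply/setP => i; rewrite !inE andbF.
Qed.

End CollapseTwice.

Section Monomials.

(** Iterated contractions live in polygons whose sizes are only provably equal. Comparing monomials
    of bare chord sets avoids transporting dissections along these equalities. The default [mone] is
    a junk value for sets which are not dissections. *)
Definition set_mon n (X : {set chord n}) : {cmonom ndiagram} :=
  if insub X is Some D then mon (D : dissection n) else mone.

Lemma set_monE n (D : dissection n) : set_mon D = mon D.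
Proof. by rewrite /set_mon valK. Qed.

Lemma set_mon_imset n m1 m2 (X : {set chord n})
    (f : chord n -> chord m1) (g : chord n -> chord m2) : m1 = m2 ->
  (forall c, c \in X ->
     (f c).1 = (g c).1 :> nat /\ (f c).2 = (g c).2 :> nat) ->
  set_mon (f @: X) = set_mon (g @: X).
Proof.
move=> e; case: m2 / e g => g h; congr set_mon; apply: eq_in_imset => c /h[].
by case: (f c) (g c) => [a b] [a' b'] /= /val_inj -> /val_inj ->.
Qed.

Lemma contract_contract n (S T : {set 'I_n.+1}) (X : {set chord n}) :
  T \subset S -> 0 < #|T| ->
  set_mon (contract (collapse S @: T) (contract S X)) = set_mon (contract T X).
Proof.
move=> TS T0; rewrite /contract -imset_comp; apply: set_mon_imset.
  by rewrite card_collapse.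
move=> c _ /=.
have E v := @collapse_collapse n S T v TS T0.
by rewrite mkchord_map !mkchord_fst !mkchord_snd !E.
Qed.

End Monomials.

Lemma lies_inP n (T : {set 'I_n.+1}) (c : chord n) :
  reflect (exists s t, [/\ s \in T, t \in T & separates c s t]) (lies_in T c).
Proof.
apply: (iffP exists_inP) => [[s sT /exists_inP[t tT h]]|[s [t [sT tT h]]]].
  by exists s, t.
by exists s => //; apply/exists_inP; exists t.
Qed.

Lemma min_sidesP n (X : {set chord n}) (s : 'I_n.+1) :
  reflect (forall t, same_face X s t -> s <= t) (s \in min_sides X).
Proof.
by rewrite inE; apply: (iffP forallP) => h t; [apply/implyP|apply/implyP/h].
Qed.

Lemma contract_f n (S : {set 'I_n.+1}) (X : {set chord n}) c :
  c \in X -> collapse_chord S c \in contract S X.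
Proof. exact: imset_f. Qed.

Section ContractEssential.
Variables (n : nat) (S : {set 'I_n.+1}).
Implicit Types (X : {set chord n}) (c : chord n) (T : {set 'I_n.+1}).

Lemma lies_in_collapse T c : T \subset S -> c.1 < c.2 ->
  lies_in (collapse S @: T) (collapse_chord S c) = lies_in T c.
Proof.
move=> /subsetP TS lt; apply/lies_inP/lies_inP.
  case=> _ [_ [/imsetP[s sT ->] /imsetP[t tT ->]]].
  have S0 : 0 < #|S| by rewrite card_gt0; apply/set0Pn; exists s; apply: TS.
  by rewrite separates_collapse ?TS // => h; exists s, t.
case=> s [t [sT tT h]]; exists (collapse S s), (collapse S t).
have S0 : 0 < #|S| by rewrite card_gt0; apply/set0Pn; exists s; apply: TS.
by rewrite !imset_f // separates_collapse ?TS.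
Qed.

(** Each chord is the only one of [X] to separate some two sides of [S], and its image separates
    their images; a chord with the same image would separate them as well. *)
Lemma collapse_chord_inj X : ordered X -> essential X S ->
  {in X &, injective (collapse_chord S)}.
Proof.
move=> oX eX c d cX dX e; have [s [t [sS tS sc sf]]] := eX c cX.
have S0 : 0 < #|S| by rewrite card_gt0; apply/set0Pn; exists s.
have /(congr1 (fun x => separates x (collapse S s) (collapse S t))) := e.
rewrite !separates_collapse ?oX // sc => /esym sd.
have [//|ncd] := eqVneq d c.
by move/forall_inP: sf => /(_ d); rewrite !inE ncd dX sd => /(_ isT).
Qed.

End ContractEssential.

(** * The two faces of a chord *)

Section Halves.
Variable n : nat.
Implicit Types (C E : {set chord n}) (e c : chord n) (s t : 'I_n.+1).

(* [piece E e true] is the face of e which does not contain the last side n.  *)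
Definition half_sides e (b : bool) : {set 'I_n.+1} := [set s | beyond e s == b].
Definition half_chords E e b := [set c in E :\ e | lies_in (half_sides e b) c].
Definition piece E e b := contract (half_sides e b) (half_chords E e b).

Variables (D : dissection n) (e : chord n).
Hypothesis eD : e \in chords D.

Let oD : ordered D. Proof. by case: (dissectionP D). Qed.
Let nD : noncrossing D. Proof. by case: (dissectionP D). Qed.
Let esD : essential D setT. Proof. by case: (dissectionP D). Qed.

Lemma half_sides_ex b : exists s, s \in half_sides e b.
Proof.
case: b; [exists e.1|exists e.2]; rewrite inE /beyond ?leqnn ?ltnn ?andbF //=.
by rewrite oD.
Qed.

Lemma half_sides_gt0 b : 0 < #|half_sides e b|.
Proof. by have [s sb] := half_sides_ex b; rewrite card_gt0; apply/set0Pn; exists s. Qed.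

Lemma face_sides1 s : face_sides [set e] s = half_sides e (beyond e s).
Proof.
apply/setP => t; rewrite !inE; apply/same_faceP/eqP => [h|h c /set1P -> //].
by rewrite h ?set11.
Qed.

Lemma half_sides_face b s : s \in half_sides e b -> half_sides e b = face_sides [set e] s.
Proof. by rewrite inE => /eqP <-; rewrite face_sides1. Qed.

Lemma half_dissection b : is_dissection (piece D e b).
Proof.
have [s sb] := half_sides_ex b; rewrite /piece /half_chords (half_sides_face sb).
by apply: is_dissection_face; rewrite sub1set.
Qed.

Lemma half_chords_sub C b : half_chords C e b \subset C.
Proof. by apply/subsetP => c; rewrite !inE => /andP[/andP[]]. Qed.

Lemma half_chords_mono C E b : C \subset E -> half_chords C e b \subset half_chords E e b.
Proof.
by move=> /subsetP h; apply/subsetP => c; rewrite !inE => /andP[/andP[-> /h ->] ->].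
Qed.

Lemma chord_face c : c \in chords D -> c != e ->
  exists s t, [/\ beyond e s = beyond e t, separates c s t & same_face (D :\ c) s t].
Proof.
move=> cD ce; have [s [t [_ _ h sf]]] := esD cD; exists s, t; split=> //.
by move/same_faceP: (sf) => -> //; rewrite !inE eq_sym ce.
Qed.

Lemma lies_in_half c b : c \in chords D -> c != e ->
  forall s t, separates c s t -> beyond e s = beyond e t ->
  lies_in (half_sides e b) c = (beyond e s == b).
Proof.
move=> cD ce s t sep est; apply/lies_inP/idP => [[s' [t' [s'b t'b sep']]]|sb].
  move: s'b t'b; rewrite !inE => /eqP s'b /eqP t'b.
  apply/eqP; rewrite -s'b.
  apply: (@noncrossing_split _ e c s t s' t'); rewrite -?separatesE ?oD ?nD //.
  by rewrite s'b t'b.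
by exists s, t; split; rewrite // !inE -?est.
Qed.

Lemma half_chords_essential b : essential (half_chords D e b) (half_sides e b).
Proof.
move=> c; rewrite !inE => /andP[/andP[ce cD] cb].
have [s [t [est sep sf]]] := chord_face cD ce.
move: cb; rewrite (lies_in_half _ cD ce sep est) => sb.
exists s, t; split; rewrite ?inE -?est //.
by apply: same_face_sub sf; rewrite setSD // half_chords_sub.
Qed.

Lemma half_chords_ordered b : ordered (half_chords D e b).
Proof. by apply: ordered_sub oD; apply: half_chords_sub. Qed.

Lemma half_chord_inj b : {in half_chords D e b &, injective (collapse_chord (half_sides e b))}.
Proof.
by apply: collapse_chord_inj; [apply: half_chords_ordered|apply: half_chords_essential].
Qed.

Section Sub.
Variables (C : {set chord n}) (b : bool).
Hypotheses (CD : C \subset chords D) (eC : e \in C).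
Let P := half_sides e b.

Lemma half_sub : piece C e b \subset piece D e b.
Proof. by apply/imsetS/half_chords_mono. Qed.

Lemma half_chordsE c s t : s \in P -> t \in P -> separates c s t ->
  (c \in half_chords C e b) = (c \in C).
Proof.
move=> sP tP sep; rewrite !inE.
have -> : lies_in P c by apply/lies_inP; exists s, t.
rewrite andbT; case: eqP => // ce; move: sep; rewrite ce separatesE.
by move: sP tP; rewrite !inE => /eqP -> /eqP ->; rewrite eqxx.
Qed.

Lemma same_face_half s t : s \in P -> t \in P ->
  same_face (piece C e b) (collapse P s) (collapse P t) = same_face C s t.
Proof.
move=> sP tP; rewrite (@same_face_collapse _ _ (half_chords C e b)) ?half_sides_gt0 //.
  apply/forall_inP/forall_inP => h c cC; apply/negP => sep.
    by move: (h c); rewrite (half_chordsE sP tP sep) cC sep => /(_ isT).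
  by move: (h c); rewrite -(half_chordsE sP tP sep) cC sep => /(_ isT).
by apply: ordered_sub oD; apply: subset_trans CD; apply: half_chords_sub.
Qed.

Lemma same_face_side s t : same_face C s t -> (s \in P) = (t \in P).
Proof. by move=> /same_faceP/(_ e eC); rewrite !inE => ->. Qed.

Lemma face_sides_half s : s \in P ->
  face_sides (piece C e b) (collapse P s) = collapse P @: face_sides C s.
Proof.
move=> sP; apply/setP => t'; rewrite inE.
have [t tP ->] := collapse_onto (half_sides_gt0 b) t'.
rewrite same_face_half //; apply/idP/imsetP => [st|[u]]; first by exists t; rewrite // inE.
rewrite inE => su /(collapse_inj (half_sides_gt0 b)) -> //.
by rewrite -(same_face_side su).
Qed.

(** As [e] belongs to [C], every face of [C] lies on one side of [e], and the collapse preserves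
    both the faces and the order of the sides. *)
Lemma min_sides_half : min_sides (piece C e b) = collapse P @: (min_sides C :&: P).
Proof.
apply/setP => t'; have [t tP ->] := collapse_onto (half_sides_gt0 b) t'.
apply/min_sidesP/imsetP => [h|[u /setIP[/min_sidesP uM uP] tu]].
  exists t => //; rewrite inE tP andbT; apply/min_sidesP => s st.
  have sP : s \in P by rewrite -(same_face_side st).
  by rewrite -(collapse_le tP sP) h // same_face_half.
move=> s'; have [s sP ->] := collapse_onto (half_sides_gt0 b) s'.
by rewrite same_face_half // tu collapse_le // (collapse_inj (
  half_sides_gt0 b) tP uP tu) // => /uM.
Qed.

Lemma rep_half s : s \in P -> rep (piece C e b) (collapse P s) = collapse P (rep C s).
Proof.
move=> sP; have [sr rM] := repP C s; have rP : rep C s \in P by rewrite -(same_face_side sr).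
apply/eqP; rewrite rep_eq.
  by rewrite same_face_half // same_face_sym.
by rewrite min_sides_half imset_f // inE rM.
Qed.

Lemma half_diff (T : {set 'I_n.+1}) : T \subset P ->
  [set c in piece D e b :\: piece C e b | lies_in (collapse P @: T) c]
    = contract P [set c in chords D :\: C | lies_in T c].
Proof.
move=> TP; apply/setP => c'; rewrite !inE; apply/idP/imsetP.
  case/andP=> /andP[nC /imsetP[c cD ec]]; rewrite ec.
  have cD' := cD; move: cD; rewrite !inE => /andP[/andP[ce cD] cP].
  rewrite lies_in_collapse ?oD // => cT; exists c => //.
  rewrite !inE cD cT !andbT; apply: contra nC => cC.
  by rewrite ec contract_f // !inE ce cC.
case=> c; rewrite !inE => /andP[/andP[cC cD] cT] ->.
have ce : c != e by apply: contraNneq cC => ->.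
have cP : lies_in P c.
  have /lies_inP[s [t [sT tT h]]] := cT; apply/lies_inP; exists s, t.
  by split=> //; apply: (subsetP TP).
have cDb : c \in half_chords D e b by rewrite !inE ce cD.
rewrite [X in _ && X](lies_in_collapse TP) ?oD // cT [X in _ && X && _]contract_f // !andbT.
apply: contra cC => /imsetP[d dC /half_chord_inj E].
have dD := subsetP (half_chords_mono b CD) d dC.
by rewrite (E cDb dD); apply: (subsetP (half_chords_sub C b)).
Qed.

End Sub.
End Halves.

(** * Quotient and remainder of a cut, split along one of its chords *)

Section CutMonomials.
Variables (n : nat).
Implicit Types (C E : {set chord n}) (e c : chord n) (s t : 'I_n.+1).

Definition face_mon E C s : {cmonom ndiagram} :=
  set_mon (contract (face_sides C s) [set c in E :\: C | lies_in (face_sides C s) c]).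
Definition qmon E C : {cmonom ndiagram} :=
  \big[mmul/mone]_(s in min_sides C) face_mon E C s.
Definition rmon C : {cmonom ndiagram} := set_mon (contract (min_sides C) C).

End CutMonomials.

Section QR.
Variables (n : nat) (D : dissection n) (e : chord n) (C : {set chord n}).
Hypotheses (CD : C \subset chords D) (eC : e \in C).
Let eD := subsetP CD e eC.

Lemma qmon_half b : qmon (piece D e b) (piece C e b)
  = \big[mmul/mone]_(s in min_sides C | beyond e s == b) face_mon D C s.
Proof.
rewrite /qmon (@min_sides_half _ D) // big_imset /=; last first.
  by move=> s t /setIP[_ sP] /setIP[_ tP]; apply: collapse_inj; rewrite ?(half_sides_gt0 eD).
apply: eq_big => [s|s /setIP[_ sP]]; first by rewrite !inE.
rewrite /face_mon (@face_sides_half _ D) //.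
have FP : face_sides C s \subset half_sides e b.
  by apply/subsetP => t; rewrite inE => st; rewrite -(same_face_side b eC st).
by rewrite half_diff // contract_contract // face_sides_gt0.
Qed.

Lemma qmon_cut : qmon D C =
  mmul (qmon (piece D e true) (piece C e true)) (qmon (piece D e false) (piece C e false)).
Proof.
rewrite !qmon_half /qmon (bigID (beyond e)) /=; congr mmul; apply: eq_bigl => s.
  by rewrite eqb_id.
by rewrite eqbF_neg.
Qed.

Lemma rmon_half b : rmon (piece C e b) =
  set_mon (contract (min_sides C :&: half_sides e b) (half_chords C e b)).
Proof.
rewrite /rmon (@min_sides_half _ D) // contract_contract ?subsetIr //.
have [s sb] := half_sides_ex eD b; have [sr rM] := repP C s.
rewrite card_gt0; apply/set0Pn; exists (rep C s).
by rewrite inE rM -(same_face_side b eC sr).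
Qed.

End QR.

Lemma min_sides0 n : min_sides (set0 : {set chord n}) = [set ord0].
Proof.
apply/setP => s; rewrite [RHS]inE; apply/min_sidesP/eqP => [h|-> //].
apply/val_inj/eqP; rewrite /= -leqn0; apply: (h ord0).
by apply/same_faceP => c; rewrite inE.
Qed.

Lemma face_sides0 n s : face_sides (set0 : {set chord n}) s = setT.
Proof. by apply/setP => t; rewrite !inE; apply/same_faceP => c; rewrite inE. Qed.

Lemma half1 n (e : chord n) b : piece [set e] e b = set0.
Proof.
apply/setP => c; rewrite [RHS]inE; apply/negbTE/negP => /imsetP[d].
by rewrite !inE => /andP[/andP[/negbTE ->]].
Qed.

Lemma qmon0 n (E : {set chord n}) : ordered E -> qmon E set0 = set_mon E.
Proof.
move=> oE; rewrite /qmon min_sides0 big_set1 /face_mon face_sides0.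
have -> : [set c in E :\: set0 | lies_in setT c] = E.
  apply/setP => c; rewrite !inE /=; case cE: (c \in E) => //=.
  apply/lies_inP; exists c.1, c.2; split; rewrite ?inE // separatesE /beyond.
  by rewrite leqnn ltnn andbF oE.
rewrite -[in RHS](imset_id E) /contract; apply: set_mon_imset.
  by rewrite cardsT card_ord.
have collT (v : 'I_n.+1) : collapse setT v = v :> nat.
  rewrite collapse_in ?inE // /side_rank -[RHS](card_ord v).
  have vn : v <= n.+1 by apply/ltnW/ltn_ord.
  have wI : injective (widen_ord vn) by move=> i j /(congr1 val) /= /val_inj.
  rewrite -(card_imset _ wI); apply: eq_card => s.
  rewrite !inE /=; apply/idP/imsetP => [lt|[i _ ->]]; last exact: (ltn_ord i).
  by exists (Ordinal lt) => //; apply: val_inj.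
move=> c /oE lt; rewrite mkchord_fst mkchord_snd !collT.
by rewrite (minn_idPl (ltnW lt)) (maxn_idPr (ltnW lt)).
Qed.

Lemma ordered_half n (D : dissection n) e b : e \in chords D -> ordered (piece D e b).
Proof.
move=> eD; pose X := Dissection (half_dissection eD b).
by have [] := dissectionP X.
Qed.

Lemma qmon1 n (D : dissection n) e : e \in chords D ->
  qmon D [set e] = mmul (set_mon (piece D e true)) (set_mon (piece D e false)).
Proof.
move=> eD; rewrite (qmon_cut (e := e)) ?set11 ?sub1set // !half1 !qmon0 //;
  exact: ordered_half.
Qed.

Section Cut.
Variables (n : nat) (D : dissection n) (C : {set chord n}).
Hypothesis CD : C \subset chords D.
Let M := min_sides C.

Let oD : ordered D. Proof. by case: (dissectionP D). Qed.
Let oC : ordered C. Proof. exact: ordered_sub oD. Qed.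

Definition cut_diss : dissection _ := Dissection (is_dissection_cut CD).

Lemma separates_rep c s t : c \in C -> separates c (rep C s) (rep C t) = separates c s t.
Proof.
move=> cC; have [sr _] := repP C s; have [tr _] := repP C t.
by rewrite !separatesE (same_faceP _ _ _ sr) // (same_faceP _ _ _ tr).
Qed.

Lemma cut_essential : essential C M.
Proof.
move=> e eC; have [_ _ _ eD] := dissectionP D.
have [s [t [_ _ se sf]]] := eD _ (subsetP CD e eC).
have [sr rs] := repP C s; have [tr rt] := repP C t.
exists (rep C s), (rep C t); split=> //; first by rewrite separates_rep.
have CeC := subD1set C e.
apply: same_face_trans (same_face_sub CeC tr).
rewrite same_face_sym in sr; apply: same_face_trans (same_face_sub CeC sr) _.
by apply: same_face_sub sf; rewrite setSD.
Qed.

Lemma cut_chord_inj : {in C &, injective (collapse_chord M)}.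
Proof. exact: collapse_chord_inj oC cut_essential. Qed.

Variable e : chord n.
Hypothesis eC : e \in C.
Let e' := collapse_chord M e.

Lemma cut_chord_in : e' \in chords cut_diss. Proof. exact: contract_f. Qed.

Lemma rep_half_side b s : (rep C s \in half_sides e b) = (s \in half_sides e b).
Proof. by have [sr _] := repP C s; rewrite -(same_face_side b eC sr). Qed.

Lemma min_half_gt0 b : 0 < #|M :&: half_sides e b|.
Proof.
have [s sb] := half_sides_ex (subsetP CD e eC) b; have [_ rM] := repP C s.
by rewrite card_gt0; apply/set0Pn; exists (rep C s); rewrite inE rM rep_half_side.
Qed.

Lemma lies_in_min b c : c \in C ->
  lies_in (M :&: half_sides e b) c = lies_in (half_sides e b) c.
Proof.
move=> cC; apply/lies_inP/lies_inP => [[s [t [/setIP[_ sP] /setIP[_ tP] h]]]|].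
  by exists s, t.
case=> s [t [sP tP h]]; exists (rep C s), (rep C t).
by rewrite !in_setI !(repP C _).2 !rep_half_side sP tP separates_rep.
Qed.

(** The collapse exchanges the inner and the outer face of [e] when [e.2] is past the last minimal
    side and wraps to the root; [b0] records this. It is harmless for monomials, which commute. *)
Lemma half_cut : exists b0, forall b,
  half_sides e' (b0 (+) b) = collapse M @: (M :&: half_sides e b) /\
  half_chords (contract M C) e' (b0 (+) b) = contract M (half_chords C e b).
Proof.
have [b0 hb] := beyond_collapse (min_sides_gt0 C) (oC eC).
have H b : half_sides e' (b0 (+) b) = collapse M @: (M :&: half_sides e b).
  apply/setP => t'; have [t tM ->] := collapse_onto (min_sides_gt0 C) t'.
  rewrite inE hb // (inj_eq (can_inj (addKb b0))).
  apply/idP/imsetP => [tb|[u]]; first by exists t; rewrite // in_setI tM inE.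
  case/setIP=> uM; rewrite inE => ub /(collapse_inj (min_sides_gt0 C)) -> //.
exists b0 => b; split=> //; apply/setP => c'; rewrite !inE; apply/idP/imsetP.
  case/andP=> /andP[ne /imsetP[c cC ec]]; rewrite ec H.
  rewrite lies_in_collapse ?subsetIl ?oC // lies_in_min // => cb; exists c => //.
  by rewrite !inE cC cb !andbT; apply: contraNneq ne => ce; rewrite ec ce.
case=> c; rewrite !inE => /andP[/andP[ne cC] cb] ->.
rewrite H lies_in_collapse ?subsetIl ?oC // lies_in_min // cb andbT contract_f // andbT.
by apply: contra ne => /eqP/cut_chord_inj ->.
Qed.

(** Both sides contract the polygon onto the minimal sides of [C] lying on a given side of [e], in
    one step or in two. *)
Lemma qmon_cut_diss : qmon (contract M C) [set e'] =
  mmul (rmon (piece C e true)) (rmon (piece C e false)).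
Proof.
have [b0 H] := half_cut.
have E b : set_mon (piece (contract M C) e' (b0 (+) b)) = rmon (piece C e b).
  have [H1 H2] := H b.
  rewrite (rmon_half CD eC) /piece H1 H2 contract_contract ?subsetIl //.
  exact: min_half_gt0.
have := qmon1 cut_chord_in; rewrite /= => ->.
by rewrite -!E; case: (b0); rewrite //= mulmC.
Qed.

End Cut.

(** * Orientation of chords *)

Lemma rep_le n (C : {set chord n}) s t : same_face C s t -> rep C s <= t.
Proof.
move=> st; have [sr /min_sidesP rM] := repP C s; apply: rM.
by apply: same_face_trans st; rewrite same_face_sym.
Qed.

Lemma betweenC m (s t u : 'I_m.+1) : between s t u = between t s u.
Proof. by rewrite /between minnC maxnC. Qed.

Lemma separates_between n (e : chord n) s t : e.1 < e.2 ->
  separates e s t = (between s t e.1 != between s t e.2).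
Proof.
move=> lt; case: (ltngtP s t) => [st|st|/val_inj->].
- by rewrite separates_cut // /between (minn_idPl (ltnW st)) (maxn_idPr (ltnW st)).
- rewrite separatesE eq_sym -separatesE separates_cut //.
  by rewrite /between (minn_idPr (ltnW st)) (maxn_idPl (ltnW st)).
by rewrite separatesE eqxx /between minnn maxnn; lia.
Qed.

Lemma between_beyond n (e : chord n) s t :
  beyond e s -> ~~ beyond e t -> between s t e.1 = (t < e.1).
Proof. by rewrite /beyond /between; lia. Qed.

Lemma mkchord_ends n (u v w : 'I_n.+1) : (w == (mkchord u v).1) || (w == (mkchord u v).2)
  = (w == u) || (w == v) :> bool.
Proof. by rewrite /mkchord; case: ifP => //= _; rewrite orbC. Qed.

Lemma adj_mkchord n (E : {set chord n}) u v : ordered E ->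
  adj E u v = (mkchord u v \in E).
Proof.
move=> oE; rewrite /adj /mkchord; case: ifP => [lt|/negbT ge].
  case vu : ((v, u) \in E); rewrite ?orbF //.
  by have := oE _ vu; rewrite /= ltnNge ltnW.
case uv : ((u, v) \in E) => //.
by have := oE _ uv; rewrite /= (negbTE ge).
Qed.

Section Orientation.
Variables (n : nat) (D : dissection n).
Let oD : ordered D. Proof. by case: (dissectionP D). Qed.

Lemma dissection_acyclic : acyclic D.
Proof. by case: ((is_dissectionP D).1 (chordsP D)). Qed.

Lemma dissection_connected u v : connect (adj D) u v.
Proof.
have [_ _ aD cD] := (is_dissectionP D).1 (chordsP D).
have c1 : #|comp_min D| <= 1 by have := acyclic_card oD aD; rewrite cD; lia.
have [cu mu] := crepP D u; have [cv mv] := crepP D v.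
apply: connect_trans cu _; rewrite conn_sym.
by rewrite (card_le1_eqP c1 _ _ mv mu).
Qed.

Lemma connect_end u v w : connect (adj (D :\ mkchord u v)) w u ||
  connect (adj (D :\ mkchord u v)) w v.
Proof.
set E := D :\ _; have oE : ordered E by apply: ordered_sub oD; apply: subD1set.
pose P := [pred w | connect (adj E) w u || connect (adj E) w v].
have cl : closed (adj D) P.
  apply: intro_closed => [|x y]; first exact: conn_sym.
  rewrite adj_mkchord // => xy; rewrite !inE.
  have [exy|nxy] := eqVneq (mkchord x y) (mkchord u v).
    have /orP[/eqP->|/eqP->] : (y == u) || (y == v).
      by rewrite -mkchord_ends -exy mkchord_ends eqxx orbT.
    - by rewrite connect0.
    - by rewrite connect0 orbT.
  have a : connect (adj E) y x by rewrite connect1 // adj_sym adj_mkchord // !inE nxy.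
  by case/orP => h; rewrite (connect_trans a h) ?orbT.
have /(closed_connect cl) := dissection_connected w u.
by rewrite !inE connect0.
Qed.

(** Only this chord separates [a] from [b], so once it is removed the vertices of the arc between
    [a] and [b] away from 0 form a union of components. The end of the chord in this arc is thus the
    one cut off from the root. *)
Lemma points_to_between u v a b : mkchord u v \in chords D ->
  separates (mkchord u v) a b -> same_face (D :\ mkchord u v) a b ->
  points_to D u v = between a b u.
Proof.
wlog ab : a b / a <= b => [W|] cD sep sf.
  case/orP: (leq_total a b) => ab; first exact: W.
  by rewrite betweenC; apply: W; rewrite // 1?same_face_sym // separatesE eq_sym -separatesE.
have {}ab : a < b.
  rewrite ltn_neqAle ab andbT; apply: contraTneq sep => /val_inj->.
  by rewrite separatesE eqxx.
set E := D :\ _ in sf *; have oE : ordered E by apply: ordered_sub oD; apply: subD1set.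
have cl := same_face_closed oE ab sf.
have btw x : (x \in [pred v : 'I_n.+1 | a < v <= b]) = between a b x.
  by rewrite inE /between (minn_idPl (ltnW ab)) (maxn_idPr (ltnW ab)).
have uv : between a b u != between a b v.
  have := sep; rewrite separates_between ?oD // /mkchord; case: ifP => //= _.
  by rewrite eq_sym.
have b0 : between a b ord0 = false by rewrite -btw inE.
rewrite /points_to -/E; apply/idP/idP => [/(closed_connect cl)|bu].
  by rewrite !btw b0 => bv; move: uv; rewrite bv eqbF_neg negbK.
case/orP: (connect_end u v ord0) => h; last by rewrite conn_sym.
by move/(closed_connect cl): h; rewrite !btw b0 bu.
Qed.

End Orientation.

Definition chord_rev n (E C : {set chord n}) (c : chord n) : bool :=
  let M := min_sides C in
  points_to E c.1 c.2 !=
    points_to (contract M C) (collapse M c.1) (collapse M c.2).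

Definition krev n (E C : {set chord n}) := #|[set c in C | chord_rev E C c]|.

Section Reversal.
Variables (n : nat) (D : dissection n) (C : {set chord n}).
Hypothesis CD : C \subset chords D.
Let M := min_sides C.
Let oD : ordered D. Proof. by case: (dissectionP D). Qed.
Let oC : ordered C. Proof. exact: ordered_sub oD. Qed.

Lemma same_face_cut1 c a b : c \in C -> same_face (D :\ c) a b ->
  same_face (contract M C :\ collapse_chord M c)
    (collapse M (rep C a)) (collapse M (rep C b)).
Proof.
move=> cC sf; have [ra ma] := repP C a; have [rb mb] := repP C b.
apply: (@same_face_sub _ _ (contract M (C :\ c))).
  apply/subsetP => d'; rewrite !inE => /andP[ne /imsetP[d dC ed]]; rewrite ed.
  by apply: contract_f; rewrite !inE dC andbT; apply: contraNneq ne => <-; rewrite ed.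
have CcC := subD1set C c.
rewrite (@same_face_collapse _ _ C) ?min_sides_gt0 //.
apply: same_face_trans (same_face_sub CcC rb).
rewrite same_face_sym in ra; apply: same_face_trans (same_face_sub CcC ra) _.
by apply: same_face_sub sf; rewrite setSD.
Qed.

(** In r_C a side is represented by the minimal side of its face, so the pair [a], [b] which reads
    off the orientation of [c] becomes [rep C a], [rep C b]. Either end of [c] may be tested, since
    each arc contains exactly one of them. *)
Lemma chord_revE c a b w : c \in C -> separates c a b -> same_face (D :\ c) a b ->
  (w == c.1) || (w == c.2) ->
  chord_rev D C c = (between a b w != between (rep C a) (rep C b) w).
Proof.
move=> cC sep sf; have lt := oC cC; have E := mkchordE lt.
suff -> : chord_rev D C c = (between a b c.1 != between (rep C a) (rep C b) c.1).
  case/orP => /eqP -> //.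
  have := sep; rewrite -(separates_rep _ _ cC) !separates_between //.
  have := sep; rewrite separates_between //.
  by do 4!case: (between _ _ _).
rewrite /chord_rev (@points_to_between _ _ _ _ a b) ?E ?(subsetP CD) //.
congr (_ != _); have [ra ma] := repP C a; have [rb mb] := repP C b.
rewrite -(@between_collapse _ M (rep C a) (rep C b)) //.
apply: (@points_to_between _ (cut_diss CD)) => /=.
- exact: contract_f.
- by rewrite separates_collapse ?min_sides_gt0 // separates_rep.
- exact: same_face_cut1.
Qed.

Lemma krevE : krev D C = \sum_(c in C) chord_rev D C c.
Proof.
rewrite /krev -sum1_card big_mkcond [RHS]big_mkcond; apply: eq_bigr => c _.
by rewrite inE; case: (c \in C) => //=; case: chord_rev.
Qed.

End Reversal.

Section ReversalCut.
Variables (n : nat) (D : dissection n) (C : {set chord n}).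
Hypothesis CD : C \subset chords D.
Let M := min_sides C.
Let oD : ordered D. Proof. by case: (dissectionP D). Qed.
Let oC : ordered C. Proof. exact: ordered_sub oD. Qed.

Variable e : chord n.
Hypothesis eC : e \in C.
Let eD := subsetP CD e eC.

(** A chord other than [e] is alone in separating two sides of one face of [e]. Their
    representatives stay in that face, and collapsing onto it preserves arcs. *)
Lemma chord_rev_piece b c : c \in half_chords C e b ->
  chord_rev (piece D e b) (piece C e b) (collapse_chord (half_sides e b) c)
    = chord_rev D C c.
Proof.
move=> cCb; have cC := subsetP (half_chords_sub e C b) c cCb.
have ce : c != e by move: cCb; rewrite !inE; case: eqP.
have cP : lies_in (half_sides e b) c by move: cCb; rewrite !inE => /andP[].
have [s [t [est sep sf]]] := chord_face eD (subsetP CD c cC) ce.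
move: cP; rewrite (lies_in_half eD _ (subsetP CD c cC) ce sep est) => /eqP sb.
have sP : s \in half_sides e b by rewrite inE sb.
have tP : t \in half_sides e b by rewrite inE -est sb.
have [sr rsM] := repP C s; have [tr rtM] := repP C t.
set P := half_sides e b in sP tP *.
pose D' := Dissection (half_dissection eD b).
have sub : piece C e b \subset chords D' by exact: half_sub.
have eP : (collapse P c.1 == (collapse_chord P c).1) ||
  (collapse P c.1 == (collapse_chord P c).2).
  by rewrite mkchord_ends eqxx.
rewrite (chord_revE CD cC sep sf (w := c.1)) ?eqxx //.
rewrite -(between_collapse _ sP tP) -(between_collapse (S := P)); first last.
- by rewrite -(same_face_side b eC tr).
- by rewrite -(same_face_side b eC sr).
rewrite -!(rep_half (D := D)) //.
have := eP; apply: (@chord_revE _ D' (piece C e b) sub).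
- exact: contract_f.
- by rewrite separates_collapse ?(half_sides_gt0 eD) // (oC cC).
apply: (@same_face_sub _ _ (contract P (half_chords D e b :\ c))).
  apply/subsetP => d'; rewrite !inE => /andP[ne /imsetP[d dC ed]]; rewrite ed.
  by apply: contract_f; rewrite 2!inE dC andbT; apply: contraNneq ne => dc; rewrite ed dc.
rewrite (@same_face_collapse _ _ (half_chords D e b)) ?(half_sides_gt0 eD) ?subD1set //.
  by apply: same_face_sub sf; rewrite setSD // half_chords_sub.
exact: half_chords_ordered.
Qed.

Lemma krev_piece b :
  krev (piece D e b) (piece C e b) = \sum_(c in half_chords C e b) chord_rev D C c.
Proof.
pose D' := Dissection (half_dissection eD b).
rewrite (@krevE _ D') ?half_sub // /piece big_imset /=; last first.
  move=> c d cC dC; apply: (half_chord_inj eD);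
    exact: (subsetP (half_chords_mono e b CD)).
by apply: eq_bigr => c cC; rewrite chord_rev_piece.
Qed.

Lemma sum_halves (F : chord n -> nat) : \sum_(c in C) F c =
  F e + (\sum_(c in half_chords C e true) F c + \sum_(c in half_chords C e false) F c).
Proof.
rewrite (bigD1 e) //=; congr (_ + _).
rewrite (bigID (lies_in (half_sides e true))) /=; congr (_ + _); apply: eq_bigl => c.
  by rewrite !inE [_ && (c != e)]andbC.
rewrite !inE [(c \in C) && _]andbC; case ce: (c != e) => //=; case cC: (c \in C) => //=.
have [s [t [est sep _]]] := chord_face eD (subsetP CD c cC) ce.
by rewrite !(lies_in_half eD _ (subsetP CD c cC) ce sep est); case: (beyond e s).
Qed.

Lemma rep_cut1 s : rep [set collapse_chord M e] (collapse M (rep C s)) =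
  collapse M (rep [set e] s).
Proof.
have M0 := min_sides_gt0 C.
have Ce : [set e] \subset C by rewrite sub1set.
have [sr rM] := repP C s; have [sr1 r1] := repP [set e] s.
have r1M : rep [set e] s \in M.
  apply/min_sidesP => t st; move/min_sidesP: r1; apply; exact: same_face_sub st.
have E1 : [set collapse_chord M e] = contract M [set e] by rewrite /contract imset_set1.
apply/eqP; rewrite rep_eq E1.
  rewrite (@same_face_collapse _ _ C) // same_face_sym (same_face_trans _ sr1) //.
  by rewrite same_face_sym (same_face_sub Ce).
apply/min_sidesP => t'; have [t tM ->] := collapse_onto M0 t'.
rewrite (@same_face_collapse _ _ C) // collapse_le //.
by move/min_sidesP: r1; apply.
Qed.

(** The chords other than [e] contribute equally on both sides by [krev_piece]. What remains is [e]
    itself, which may be reversed when C is cut or later, when its image is cut in r_C; these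
    reversals never cancel. *)
Lemma krev_cut : krev D C + krev (contract M C) [set collapse_chord M e] =
  krev D [set e] + (krev (piece D e true) (piece C e true)
                    + krev (piece D e false) (piece C e false)).
Proof.
have e'R := contract_f M eC; have oe := oC eC.
rewrite krevE (@krevE _ (cut_diss CD)) ?sub1set // krevE ?sub1set //.
have [C1 e1] : [set e] \subset chords D /\ e \in [set e] by rewrite sub1set set11.
rewrite sum_halves !krev_piece !big_set1 -[LHS]addnAC; congr (_ + _).
have [a [b [ea eb sf]]] : exists a b, [/\ beyond e a, ~~ beyond e b & same_face (D :\ e) a b].
  have [_ _ _ es] := dissectionP D; have [s [t [_ _]]] := es _ eD.
  rewrite separatesE; case es1: (beyond e s) => et sf; [exists s, t|exists t, s].
    by split=> //; move: et; case: beyond.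
  by rewrite es1 same_face_sym; split=> //; move: et; case: beyond.
have sep : separates e a b by rewrite separatesE ea (negbTE eb).
rewrite (chord_revE CD eC sep sf (w := e.1)) ?eqxx //.
have [[ra ma] [rb mb]] := (repP C a, repP C b).
rewrite (@chord_revE _ _ [set e] C1 e a b e.1) ?eqxx //.
rewrite (@chord_revE _ (cut_diss CD) [set collapse_chord M e] _ (collapse_chord M e)
   (collapse M (rep C a)) (collapse M (rep C b)) (collapse M e.1)) ?set11 ?sub1set //; first last.
- by rewrite mkchord_ends eqxx.
- exact: (same_face_cut1 CD eC sf).
- by rewrite separates_collapse ?min_sides_gt0 ?separates_rep.
have r1M s : rep [set e] s \in M.
  have [_ r1] := repP [set e] s.
  by apply/min_sidesP => t st; move/min_sidesP: r1; apply; apply: same_face_sub st;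
    rewrite sub1set.
rewrite !rep_cut1 !between_collapse //.
have r1 s : beyond e (rep [set e] s) = beyond e s.
  by have [/same_faceP h _] := repP [set e] s; rewrite -h ?set11.
have rC s : beyond e (rep C s) = beyond e s.
  by have [/same_faceP h _] := repP C s; rewrite -h.
rewrite !between_beyond ?r1 ?rC //.
(* A coarser cut has smaller minimal sides, so [b], [rep C b], [rep [set e] b] decrease. The
   comparison with [e.1], which decides the orientation of [e], changes at most once along this
   chain. *)
have le1 : rep C b <= b by rewrite rep_le ?same_face_refl.
have le2 : rep [set e] b <= rep C b.
  by apply: rep_le; apply: same_face_sub rb; rewrite sub1set.
move: le1 le2; rewrite /=; clear.
move: (nat_of_ord b) (nat_of_ord (rep C b)) (nat_of_ord (rep [set e] b)) => i j k.
by move: (nat_of_ord e.1) => l; case: (ltnP i l); case: (ltnP j l); case: (ltnP k l); lia.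
Qed.

End ReversalCut.

(** * The coefficients of L *)

Section Degrees.
Variables (n : nat) (D : dissection n).
Implicit Types C : {set chord n}.
Let oD : ordered D. Proof. by case: (dissectionP D). Qed.

Lemma card_dissection : #|chords D| = n.
Proof. by case: ((is_dissectionP D).1 (chordsP D)). Qed.

End Degrees.

Lemma q_monE n (D : dissection n) (C : subchords D) : q_mon C = qmon D (val C).
Proof. by apply: eq_bigr => s _; rewrite -set_monE. Qed.

Lemma r_monE n (D : dissection n) (C : subchords D) : r_mon C = rmon (val C).
Proof. by rewrite /r_mon -set_monE. Qed.

Lemma card_min_cut n (D : dissection n) (C : {set chord n}) : C \subset chords D ->
  #|min_sides C|.-1 = #|C|.
Proof.
move=> CD; rewrite -(card_dissection (cut_diss CD)) /= card_in_imset //.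
exact: (cut_chord_inj CD).
Qed.

Lemma wdeg_rmon n (D : dissection n) (C : {set chord n}) : C \subset chords D ->
  wdeg (rmon C) = #|C|.
Proof. by move=> CD; rewrite -(r_monE (exist _ C CD)) wdeg_mon (card_min_cut CD). Qed.

Lemma wdeg_qmon n (D : dissection n) (C : {set chord n}) : C \subset chords D ->
  (wdeg (qmon D C) + #|C|)%N = n.
Proof.
move=> CD; rewrite -(wdeg_rmon CD) -(r_monE (exist _ C CD)) -(q_monE (exist _ C CD)).
exact: wdeg_qr.
Qed.

Lemma dissection1E (D : dissection 1) : chords D = [set (ord0, ord_max)].
Proof.
have [oD _ _ _] := dissectionP D; have := card_dissection D.
move=> /eqP/cards1P[c ec]; rewrite ec; congr [set _].
have := oD c; rewrite ec set11 => /(_ isT); case: c {ec} => [[i hi] [j hj]] /= lt.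
by congr pair; apply: val_inj => /=; lia.
Qed.

Lemma mon_a : mon (Dissection is_dissection1) = ucm diagram_a.
Proof. by []. Qed.

Lemma rmon_a n (D : dissection n) (C : {set chord n}) : C \subset chords D ->
  (rmon C == ucm diagram_a) = (#|C| == 1%N).
Proof.
move=> CD; apply/eqP/eqP => [/(congr1 wdeg)|C1].
  by rewrite (wdeg_rmon CD) wdegU.
have : #|min_sides C|.-1 = 1%N by rewrite (card_min_cut CD).
rewrite -(r_monE (exist _ C CD)) /r_mon; move: (cut_diagram _) => /=.
move: (#|_|.-1) => m X em; subst m.
rewrite -mon_a; congr mon; apply: val_inj; exact: dissection1E.
Qed.

Lemma ucm_inj (I : choiceType) : injective (@ucm I).
Proof.
by move=> i j /(congr1 (fun m : {cmonom I} => m j)); rewrite !cmU eqxx; case: eqP.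
Qed.

Section CutCoefficients.
Variables (K : fieldType) (x : K).
Local Open Scope ring_scope.
Implicit Types D F G : ndiagram.

(** Arbitrary monomials are allowed on both sides of the tensor, because splitting a cut along a
    chord produces factors equal to [mone]. *)
Definition cut_coef (m1 m2 : {cmonom ndiagram}) n (E : {set chord n}) : K :=
  \sum_(C : {set chord n} | [&& C \subset E, qmon E C == m1 & rmon C == m2])
    x ^+ krev E C.

Definition chord_coef (m : {cmonom ndiagram}) n (E : {set chord n}) : K :=
  \sum_(e in E | qmon E [set e] == m) x ^+ krev E [set e].

Lemma coef_cutE D1 D2 D : coef x D1 D2 D = cut_coef (ucm D1) (ucm D2) (chords (tagged D)).
Proof.
rewrite /coef /coproduct raddf_sum /= /cut_coef.
rewrite [RHS]big_mkcondr (@big_sub _ _ _ _ [pred C : {set chord (tag D).+1} |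
  C \subset chords (tagged D)]) //=.
apply: eq_bigr => C _; rewrite mcoeffU q_monE r_monE xpair_eqE andbC.
by case: ifP => _; rewrite ?mulr1n ?mulr0n.
Qed.

(** By degree and uniqueness of the diagram of degree 1, the remainder is [a] exactly when a single
    chord is cut; hence [chord_coef] gives the coefficients of D o a. *)
Lemma cut_coef_a D n (X : dissection n) :
  cut_coef (ucm D) (ucm diagram_a) (chords X) = chord_coef (ucm D) (chords X).
Proof.
rewrite /cut_coef /chord_coef.
transitivity (\sum_(C in [set [set e] | e in chords X] | qmon (chords X) C == ucm D)
    x ^+ krev (chords X) C).
  apply: eq_bigl => C; rewrite andbCA andbC; congr (_ && _).
  case CX: (C \subset _) => /=.
    rewrite (@rmon_a _ X) //; apply/cards1P/imsetP => [[e ec]|[e eX ->]]; last by exists e.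
    by exists e => //; move: CX; rewrite ec sub1set.
  apply/esym/negbTE; apply: contraFN CX => /imsetP[e eX ->].
  by rewrite sub1set.
rewrite big_mkcondr big_imset /=; last by move=> c d _ _ /set1_inj.
by rewrite -big_mkcondr.
Qed.

Section Singleton.
Variables (D : ndiagram) (u : {malg K[ndiagram]}).
Hypotheses (uD : msupp u = [fset D]%fset) (u1 : u@_D = 1).

Lemma prelieUl v E : (prelie x u v)@_E = \sum_(F <- msupp v) v@_F * coef x D F E.
Proof.
rewrite /prelie uD big_seq_fset1 raddf_sum /=; apply: eq_bigr => F _.
by rewrite mcoeffZ u1 mul1r mcoeff_prelie_basis.
Qed.

Lemma prelieUr v E : (prelie x v u)@_E = \sum_(F <- msupp v) v@_F * coef x F D E.
Proof.
rewrite /prelie raddf_sum /=; apply: eq_bigr => F _; rewrite uD big_seq_fset1.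
by rewrite mcoeffZ u1 mulr1 mcoeff_prelie_basis.
Qed.

End Singleton.

Lemma prelieUU D1 D2 u1 u2 : msupp u1 = [fset D1]%fset -> u1@_D1 = 1 ->
  msupp u2 = [fset D2]%fset -> u2@_D2 = 1 -> prelie x u1 u2 = prelie_basis x D1 D2.
Proof.
move=> s1 e1 s2 e2; apply/malgP => E; rewrite (prelieUl s1 e1) s2 big_seq_fset1.
by rewrite e2 mul1r mcoeff_prelie_basis.
Qed.

Lemma msupp_diagram D : msupp (<< D >> : {malg K[ndiagram]}) = [fset D]%fset.
Proof. by rewrite msuppU oner_eq0. Qed.

Lemma mcoeff_diagram D : (<< D >> : {malg K[ndiagram]})@_D = 1.
Proof. by rewrite mcoeffUU. Qed.

Lemma L_diagE D E : (L_diag x D)@_E = chord_coef (ucm D) (chords (tagged E)).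
Proof.
have -> : L_diag x D = prelie_basis x D diagram_a.
  by apply: prelieUU; [apply: msupp_diagram|apply: mcoeff_diagram|apply:
    msupp_diagram|apply: mcoeff_diagram].
by rewrite mcoeff_prelie_basis coef_cutE cut_coef_a.
Qed.

Lemma prelie_prelie D1 D2 D3 u1 u2 u3 :
  msupp u1 = [fset D1]%fset -> u1@_D1 = 1 -> msupp u2 = [fset D2]%fset -> u2@_D2 = 1 ->
  msupp u3 = [fset D3]%fset -> u3@_D3 = 1 ->
  prelie x u1 (prelie x u2 u3) - prelie x (prelie x u1 u2) u3 =
  prelie x u1 (prelie_basis x D2 D3) - prelie x (prelie_basis x D1 D2) u3.
Proof.
by move=> s1 e1 s2 e2 s3 e3; rewrite (prelieUU s2 e2 s3 e3) (prelieUU s1 e1 s2 e2).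
Qed.

Lemma L_prod_basis D1 D2 : L_prod x D1 D2 =
  prelie x << D1 >> (prelie_basis x D2 diagram_a)
  - prelie x (prelie_basis x D1 D2) << diagram_a >>.
Proof.
by apply: prelie_prelie; [apply: msupp_diagram|apply: mcoeff_diagram|apply: msupp_diagram
  |apply: mcoeff_diagram|apply: msupp_diagram|apply: mcoeff_diagram].
Qed.

Lemma mcoeff_pick (v : {malg K[ndiagram]}) (m : {cmonom ndiagram}) F :
  m = ucm F -> \sum_(G <- msupp v | m == ucm G) v@_G = v@_F.
Proof.
move=> ->; under eq_bigl do rewrite (inj_eq (@ucm_inj _)) eq_sym.
rewrite -big_filter; have [Fv|Fv] := boolP (F \in msupp v).
  by rewrite filter_pred1_uniq ?fset_uniq // big_seq1.
by rewrite mcoeff_outdom // big1_seq // => G; rewrite mem_filter => /= /andP[/eqP->];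
  rewrite (negbTE Fv).
Qed.

End CutCoefficients.

Lemma ucm_neq1 (D : ndiagram) : (ucm D == mone) = false.
Proof. exact: cm1_eq1. Qed.

Lemma mul_eq_ucm (m1 m2 : {cmonom ndiagram}) D :
  ((mmul m1 m2 : {cmonom ndiagram}) == ucm D) =
  (m1 == ucm D) && (m2 == mone) || (m1 == mone) && (m2 == ucm D).
Proof.
apply/eqP/orP => [e|[] /andP[/eqP-> /eqP->]]; rewrite ?mulm1 ?mul1m //.
have := congr1 (@mdeg _) e; rewrite mdegM mdegU.
have z m : mdeg m = 0%N -> m = mone :> {cmonom ndiagram} by exact: mdeg_eq0I.
case E1: (mdeg m1) => [|k]; last case E2: (mdeg m2) => [|l]; last by lia.
- by rewrite (z _ E1) mul1m in e; right; rewrite (z _ E1) e !eqxx.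
- by rewrite (z _ E2) mulm1 in e; left; rewrite (z _ E2) e !eqxx.
Qed.

Section SplitCoefficients.
Variables (K : fieldType) (x : K).
Local Open Scope ring_scope.
Implicit Types D F G : ndiagram.
Local Notation cut_coef := (cut_coef x).
Local Notation chord_coef := (chord_coef x).

Definition ind (m1 m2 : {cmonom ndiagram}) : K := (m1 == m2)%:R.

(* The coefficient of E in L(m1 m2), the diagram of degree 0 being allowed as *)
(* a factor; hence each way of writing E counts twice when m1 = m2.           *)
Definition split_coef (m1 m2 : {cmonom ndiagram}) n (E : {set chord n}) : K :=
  \sum_(e in E) x ^+ krev E [set e] *
    (ind (set_mon (piece E e true)) m1 * ind (set_mon (piece E e false)) m2 +
     ind (set_mon (piece E e true)) m2 * ind (set_mon (piece E e false)) m1).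

Lemma ind_mul (m1 m2 : {cmonom ndiagram}) D : ind (mmul m1 m2) (ucm D) =
  ind m1 (ucm D) * ind m2 mone + ind m1 mone * ind m2 (ucm D).
Proof.
rewrite /ind mul_eq_ucm; have [->|_] := eqVneq m1 (ucm D).
  by rewrite ucm_neq1 /= orbF mul0r addr0 mul1r.
by rewrite andFb orFb mul0r add0r; case: (m1 == mone); rewrite ?mul1r ?mul0r.
Qed.

Lemma chord_coefE D n (E : dissection n) :
  chord_coef (ucm D) (chords E) = split_coef (ucm D) mone (chords E).
Proof.
rewrite /chord_coef /split_coef big_mkcondr; apply: eq_bigr => e eE.
by rewrite -ind_mul -qmon1 // /ind; case: eqP => _; rewrite ?mulr1 ?mulr0.
Qed.

Lemma set_mon_eq1 n (X : dissection n) : (set_mon X == mone) = (n == 0%N).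
Proof.
rewrite set_monE; apply/eqP/eqP => [/(congr1 wdeg)|n0]; first by rewrite wdeg_mon wdeg1.
by move: X; rewrite n0.
Qed.

Lemma cut_coef0 D m n (X : dissection n) : set_mon X = mone ->
  cut_coef (ucm D) m (chords X) = 0.
Proof.
move/eqP; rewrite set_mon_eq1 => /eqP n0; rewrite /cut_coef big1 // => C /and3P[CX /eqP qD _].
by have := wdeg_qmon CX; rewrite qD wdegU; lia.
Qed.

Lemma pick_basis D1 D2 n (X : dissection n) (v := prelie_basis x D1 D2) :
  \sum_(F <- msupp v | mon X == ucm F) v@_F = cut_coef (ucm D1) (ucm D2) (chords X).
Proof.
case: n X => [|n] X.
  rewrite cut_coef0 ?set_monE // big1 // => F /eqP /(congr1 wdeg).
  by rewrite wdeg_mon wdegU.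
rewrite (mcoeff_pick v (erefl (mon X))) mcoeff_prelie_basis coef_cutE //.
Qed.

Lemma prelie_basis_a D1 D2 E :
  (prelie x << D1 >> (prelie_basis x D2 diagram_a))@_E =
  \sum_(C : {set chord (tag E).+1} | (C \subset chords (tagged E)) &&
     (qmon (chords (tagged E)) C == ucm D1))
    x ^+ krev (chords (tagged E)) C * chord_coef (ucm D2) (contract (min_sides C) C).
Proof.
rewrite (prelieUl x (msupp_diagram _ _) (mcoeff_diagram _ _));
  under eq_bigr do rewrite coef_cutE big_distrr.
rewrite (eq_bigr (fun F => \sum_(C : {set chord (tag E).+1} | (C \subset chords (tagged E)) &&
     (qmon (chords (tagged E)) C == ucm D1)) x ^+ krev (chords (tagged E)) C *
     (if rmon C == ucm F then (prelie_basis x D2 diagram_a)@_F else 0))); last first.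
  move=> F _; under eq_bigl do rewrite andbA.
  rewrite big_mkcondr; apply: eq_bigr => C _.
  by case: ifP; rewrite ?mulr0 // mulrC.
rewrite exchange_big; apply: eq_bigr => C /andP[CE _].
rewrite -big_distrr -big_mkcond /=; congr (_ * _).
by rewrite -(r_monE (exist _ C CE)) pick_basis cut_coef_a.
Qed.

Lemma prelie_a_basis D1 D2 E :
  (prelie x (prelie_basis x D1 D2) << diagram_a >>)@_E =
  \sum_(e in chords (tagged E)) x ^+ krev (chords (tagged E)) [set e] *
    ((set_mon (piece (chords (tagged E)) e true) == mone)%:R *
       cut_coef (ucm D1) (ucm D2) (piece (chords (tagged E)) e false) +
     (set_mon (piece (chords (tagged E)) e false) == mone)%:R *
       cut_coef (ucm D1) (ucm D2) (piece (chords (tagged E)) e true)).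
Proof.
rewrite (prelieUr x (msupp_diagram _ _) (mcoeff_diagram _ _));
  under eq_bigr do rewrite coef_cutE cut_coef_a big_distrr.
set T := chords (tagged E); set v := prelie_basis _ _ _.
rewrite (eq_bigr (fun F => \sum_(e in T) x ^+ krev T [set e] *
     (if qmon T [set e] == ucm F then v@_F else 0))); last first.
  move=> F _; rewrite big_mkcondr; apply: eq_bigr => e _.
  by case: ifP; rewrite ?mulr0 // mulrC.
rewrite exchange_big; apply: eq_bigr => e eT.
rewrite -big_distrr -big_mkcond /=; congr (_ * _).
rewrite qmon1 //.
pose X b := Dissection (half_dissection eT b).
have pk b : \sum_(F <- msupp v | set_mon (piece T e b) == ucm F) v@_F =
    cut_coef (ucm D1) (ucm D2) (piece T e b).
  by have := pick_basis D1 D2 (X b); rewrite -set_monE.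
have cc0 b : set_mon (piece T e b) = mone -> cut_coef (ucm D1) (ucm D2) (piece T e b) = 0.
  exact: (@cut_coef0 _ _ _ (X b)).
have [m1|n1] := eqVneq (set_mon (piece T e true)) mone.
  by rewrite m1 mul1r mul1m (cc0 true m1) mulr0 addr0 pk.
have [m2|n2] := eqVneq (set_mon (piece T e false)) mone.
  by rewrite m2 mul1r mulm1 mul0r add0r pk.
rewrite !mul0r addr0 big1 // => F.
by rewrite mul_eq_ucm (negbTE n1) (negbTE n2) andbF.
Qed.

End SplitCoefficients.

(** * Cuts containing a chord as pairs of cuts of its two pieces *)

Section Join.
Variables (n : nat) (D : dissection n) (e : chord n).
Hypothesis eD : e \in chords D.
Local Notation m b := #|half_sides e b|.-1.

Lemma half_chords_side c b b' : c \in half_chords D e b ->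
  lies_in (half_sides e b') c = (b' == b).
Proof.
rewrite !inE => /andP[/andP[ce cD]].
have [s [t [est sep _]]] := chord_face eD cD ce.
by rewrite !(lies_in_half eD _ cD ce sep est) => /eqP ->; rewrite eq_sym.
Qed.

Lemma half_chords_cover c : c \in chords D -> c != e ->
  exists b, c \in half_chords D e b.
Proof.
move=> cD ce; have [s [t [est sep _]]] := chord_face eD cD ce.
exists (beyond e s); rewrite !inE cD ce /=.
by rewrite !(lies_in_half eD _ cD ce sep est).
Qed.

Definition unpiece b (X : {set chord (m b)}) : {set chord n} :=
  [set c in half_chords D e b | collapse_chord (half_sides e b) c \in X].

(** The inverse of the map sending a cut through [e] to its traces on the two pieces. *)
Definition join (X : {set chord (m true)}) (Y : {set chord (m false)}) :=
  e |: (unpiece X :|: unpiece Y).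

Lemma unpiece_piece (C : {set chord n}) b : C \subset chords D ->
  unpiece (piece C e b) = half_chords C e b.
Proof.
move=> CD; have sub := half_chords_mono e b CD.
apply/setP => c; rewrite inE; apply/andP/idP => [[cD /imsetP[d dC]]|cC].
  by move/(half_chord_inj eD) => -> //; apply: (subsetP sub).
by rewrite (subsetP sub) // contract_f.
Qed.

Lemma piece_unpiece b (X : {set chord (m b)}) : X \subset piece D e b ->
  contract (half_sides e b) (unpiece X) = X.
Proof.
move=> /subsetP XD; apply/setP => d; apply/imsetP/idP => [[c]|dX].
  by rewrite inE => /andP[_ h] ->.
have /imsetP[c cD dc] := XD d dX.
by exists c => //; rewrite inE cD -[collapse_chord _ _]dc.
Qed.

Lemma unpiece_half b (X : {set chord (m b)}) c : c \in unpiece X -> c \in half_chords D e b.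
Proof. by rewrite inE => /andP[]. Qed.

Lemma half_chords_join X Y b :
  half_chords (join X Y) e b = if b then unpiece X else unpiece Y.
Proof.
apply/setP => c; rewrite in_set in_setD1 in_setU1.
have ne b' (Z : {set chord (m b')}) : e \notin unpiece Z.
  by apply/negP => /unpiece_half; rewrite !inE eqxx.
have [->|ce] /= := eqVneq c e; first by case: b; rewrite (negbTE (ne _ _)).
rewrite in_setU; case cX: (c \in unpiece X); case cY : (c \in unpiece Y) => //=.
- have := half_chords_side true (unpiece_half cX).
  by rewrite (half_chords_side true (unpiece_half cY)).
- by rewrite (half_chords_side b (unpiece_half cX)); case: b.
- by rewrite (half_chords_side b (unpiece_half cY)); case: b.
- by case: b.
Qed.

Lemma join_sub X Y : join X Y \subset chords D.
Proof.
apply/subsetP => c; rewrite in_setU1 in_setU => /predU1P[-> //|/orP[]] /unpiece_half;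
  exact: (subsetP (half_chords_sub e D _)).
Qed.

Lemma join_piece (C : {set chord n}) : C \subset chords D -> e \in C ->
  join (piece C e true) (piece C e false) = C.
Proof.
move=> CD eC; apply/setP => c; rewrite in_setU1 in_setU !unpiece_piece //.
have [->|ce] /= := eqVneq c e; first by rewrite eC.
apply/orP/idP => [[]|cC]; try exact: (subsetP (half_chords_sub e C _)).
have [b] := half_chords_cover (subsetP CD c cC) ce; rewrite !inE ce cC /=.
by case: b => /andP[_ ->]; [left|right].
Qed.

Lemma reindex_piece (R : zmodType) (F : {set chord (m true)} -> {set chord (m false)} -> R) :
  (\sum_(C : {set chord n} | (C \subset chords D) && (e \in C)) F (piece C e true) (
    piece C e false) =
  \sum_(X : {set chord (m true)} | X \subset piece D e true)
    \sum_(Y : {set chord (m false)} | Y \subset piece D e false) F X Y)%R.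
Proof.
rewrite pair_big /= (reindex_onto (fun C => (piece C e true, piece C e false))
   (fun p => join p.1 p.2)) /=; last first.
  move=> [X Y] /= /andP[XD YD].
  by rewrite /piece !half_chords_join !piece_unpiece.
apply: eq_bigl => C; apply/andP/andP => [[CD eC]|[_ /eqP <-]].
  by rewrite !half_sub // join_piece.
by rewrite join_sub in_setU1 eqxx.
Qed.

End Join.

(** * Closed formula for L of a product *)

Section ProductFormula.
Variables (K : fieldType) (x : K).
Local Open Scope ring_scope.
Implicit Types D F G : ndiagram.
Local Notation cut_coef := (cut_coef x).
Local Notation chord_coef := (chord_coef x).

Local Notation ind := (@ind K).

Lemma cut_coefE m1 m2 n (E : {set chord n}) : cut_coef m1 m2 E =
  \sum_(C : {set chord n} | C \subset E) ind (qmon E C) m1 * ind (rmon C) m2 * x ^+ krev E C.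
Proof.
rewrite /cut_coef big_mkcondr; apply: eq_bigr => C _; rewrite /ind.
by do 2!case: eqP => _; rewrite ?mul1r ?mul0r.
Qed.

Lemma expand_product (a a' b b' c c' d d' u v : K) :
  (a * b' + a' * b) * (c * d' + c' * d) * (u * v) =
  a * c * u * (b' * d' * v) + a' * c' * u * (b * d * v)
  + a * c' * u * (b' * d * v) + a' * c * u * (b * d' * v).
Proof. by ring. Qed.

Lemma expand_split (a a' b b' c d u v : K) :
  u * d + c * v + a * b' + a' * b = a * b' + a' * b + (c * v + d * u).
Proof. by ring. Qed.

Lemma mul_sums4 (I J : finType) (P : pred I) (Q : pred J) (f1 f2 f3 f4 : I -> K)
    (g1 g2 g3 g4 : J -> K) :
  (\sum_(i | P i) f1 i) * (\sum_(j | Q j) g1 j) + (\sum_(i | P i) f2 i) * (\sum_(j | Q j) g2 j)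
  + (\sum_(i | P i) f3 i) * (\sum_(j | Q j) g3 j) + (\sum_(i | P i) f4 i) * (\sum_(j | Q j) g4 j)
  = \sum_(i | P i) \sum_(j | Q j) (f1 i * g1 j + f2 i * g2 j + f3 i * g3 j + f4 i * g4 j).
Proof.
rewrite !big_distrlr /= -!big_split /=; apply: eq_bigr => i _.
by rewrite -!big_split.
Qed.

(** A generator is irreducible: in each product equal to [ucm D1] or [ucm D2] one factor is 1. The
    four terms record which piece supplies D1 and which supplies D2. *)
Lemma sum_split D1 D2 n1 n2 (E1 : {set chord n1}) (E2 : {set chord n2}) :
  \sum_(X : {set chord n1} | X \subset E1) \sum_(Y : {set chord n2} | Y \subset E2)
     ind (mmul (qmon E1 X) (qmon E2 Y)) (ucm D1) *
     ind (mmul (rmon X) (rmon Y)) (ucm D2) * x ^+ (krev E1 X + krev E2 Y) =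
  cut_coef (ucm D1) (ucm D2) E1 * cut_coef mone mone E2
  + cut_coef mone mone E1 * cut_coef (ucm D1) (ucm D2) E2
  + cut_coef (ucm D1) mone E1 * cut_coef mone (ucm D2) E2
  + cut_coef mone (ucm D2) E1 * cut_coef (ucm D1) mone E2.
Proof.
rewrite !cut_coefE mul_sums4; apply: eq_bigr => X _; apply: eq_bigr => Y _.
move: (qmon E1 X) (qmon E2 Y) (rmon X) (rmon Y) (krev E1 X) (krev E2 Y) => q1 q2 r1 r2 k1 k2.
rewrite (ind_mul K q1) (ind_mul K r1) exprD.
exact: expand_product.
Qed.

(** When all chords are cut every face has a single side, which is its own representative. *)
Lemma krev_full n (E : dissection n) : krev E E = 0%N.
Proof.
rewrite krevE // big1 // => c cE; have [oE _ sE eE] := dissectionP E.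
have [a [b [_ _ sep sf]]] := eE c cE.
rewrite (chord_revE (subxx _) cE sep sf (w := c.1)) ?eqxx //.
have repE s : rep E s = s.
  have [sr _] := repP E s; apply/eqP; apply: contraTT sr => /negbTE ne.
  by apply: (sE s (rep E s)); rewrite ?inE // eq_sym ne.
by rewrite !repE eqxx.
Qed.

Lemma krev0 n (E : {set chord n}) : krev E set0 = 0%N.
Proof. by apply/eqP; rewrite cards_eq0; apply/eqP/setP => c; rewrite !inE. Qed.

Lemma rmon_full n (E : dissection n) : rmon E = set_mon E.
Proof.
have [oE _ sE _] := dissectionP E.
suff -> : rmon E = qmon E set0 by rewrite qmon0.
rewrite /qmon min_sides0 big_set1 /face_mon face_sides0 /rmon.
have -> : min_sides E = setT.
  apply/setP => s; rewrite [RHS]inE; apply/min_sidesP => t st.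
  have [->//|ne] := eqVneq s t.
  by move: (sE s t (in_setT _) (in_setT _) ne); rewrite st.
congr (set_mon (contract _ _)); apply/setP => c; rewrite !inE /=;
  case cE: (c \in chords E) => //=.
apply/esym/lies_inP; exists c.1, c.2; split; rewrite ?inE // separatesE /beyond.
by rewrite leqnn ltnn andbF oE.
Qed.

Lemma eq1_wdeg (m : {cmonom ndiagram}) : wdeg m = 0%N -> m = mone.
Proof.
move=> m0; apply/eqP/cmP => D; rewrite cm1; apply/eqP; rewrite cmE_eq0; apply/negP => Dm.
move: m0; rewrite /wdeg (big_fsetD1 _ Dm) /= => /eqP; rewrite addn_eq0 => /andP[].
by rewrite muln_eq0 orbF cmE_eq0 Dm.
Qed.

(** By degree the quotient is 1 only when every chord is cut. In the dual [cut_coef_r1], the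
    remainder is 1 only when none is. *)
Lemma cut_coef_q1 m n (E : dissection n) : cut_coef mone m (chords E) = ind (set_mon E) m.
Proof.
rewrite cut_coefE (bigD1 (chords E)) //= big1 ?addr0 => [|C /andP[CE ne]].
  rewrite krev_full expr0 mulr1 rmon_full; have q1 : qmon E E = mone.
    by apply: eq1_wdeg; have := wdeg_qmon (subxx (chords E)); rewrite card_dissection; lia.
  by rewrite q1 /ind eqxx mul1r.
suff /negbTE q1 : qmon E C != mone by rewrite /ind q1 !mul0r.
apply: contraNneq ne => q1; rewrite eqEcard CE card_dissection.
by have := wdeg_qmon CE; rewrite q1 wdeg1 add0n => ->; rewrite leqnn.
Qed.

Lemma cut_coef_r1 m n (E : dissection n) : cut_coef m mone (chords E) = ind (set_mon E) m.
Proof.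
have [oE _ _ _] := dissectionP E.
rewrite cut_coefE (bigD1 set0) ?sub0set //= big1 ?addr0 => [|C /andP[CE ne]].
  rewrite krev0 expr0 mulr1 qmon0 //.
  rewrite (eq1_wdeg (m := rmon set0)) /ind ?eqxx ?mulr1 //.
  by rewrite (wdeg_rmon (sub0set (chords E))) cards0.
suff /negbTE r1 : rmon C != mone by rewrite /ind r1 mulr0 mul0r.
apply: contraNneq ne => r1; rewrite -cards_eq0 -(wdeg_rmon CE) r1.
by rewrite wdeg1.
Qed.

Lemma chord_coef_cut D n (E : dissection n) (C : {set chord n}) : C \subset chords E ->
  chord_coef (ucm D) (contract (min_sides C) C) =
  \sum_(e in C) ind (qmon (contract (min_sides C) C) [set collapse_chord (min_sides C) e]) (ucm D)
    * x ^+ krev (contract (min_sides C) C) [set collapse_chord (min_sides C) e].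
Proof.
move=> CE; rewrite /chord_coef big_mkcondr {1}/contract big_imset /=; last first.
  exact: (cut_chord_inj CE).
by apply: eq_bigr => e _; rewrite /ind; case: eqP => _; rewrite ?mul1r ?mul0r.
Qed.

(** Of the four terms of [sum_split], those where one piece supplies both D1 and D2 force the other
    piece to have degree 0, and are exactly the subtracted coefficient of (D1 o D2) o a. *)
Lemma L_prodE D1 D2 E : (L_prod x D1 D2)@_E = split_coef x (ucm D1) (ucm D2) (chords (tagged E)).
Proof.
rewrite L_prod_basis mcoeffB prelie_basis_a prelie_a_basis /split_coef.
set T := tagged E; apply/eqP; rewrite subr_eq -big_split /=; apply/eqP.
under eq_bigr => C /andP[CE _] do rewrite (chord_coef_cut _ CE) big_distrr /=.
rewrite big_mkcondr /=.
rewrite (eq_bigr (fun C : {set chord (tag E).+1} => \sum_(e in C)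
   ind (qmon T C) (ucm D1) *
   ind (qmon (contract (min_sides C) C) [set collapse_chord (min_sides C) e]) (ucm D2)
   * x ^+ (krev T C + krev (contract (min_sides C) C) [set collapse_chord (
     min_sides C) e]))); last first.
  move=> C CE; rewrite /ind; case: eqP => _; last by rewrite big1 // => e _; rewrite !mul0r.
  by apply: eq_bigr => e _; rewrite exprD mul1r mulrCA.
(* From here on [e] is fixed and C runs over the cuts containing it. *)
rewrite (exchange_big_dep (mem (chords T))) /=; last by move=> C e /subsetP CE /CE.
apply: eq_bigr => e eT.
transitivity (x ^+ krev T [set e] * \sum_(X : {set chord #|half_sides e true|.-1} |
  X \subset piece T e true)
     \sum_(Y : {set chord #|half_sides e false|.-1} | Y \subset piece T e false)
     ind (mmul (qmon (piece T e true) X) (qmon (piece T e false) Y)) (ucm D1) *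
     ind (mmul (rmon X) (rmon Y)) (ucm D2) * x ^+ (krev (piece T e true) X + krev (
       piece T e false) Y)).
  rewrite -(reindex_piece eT) big_distrr /=; apply: eq_bigr => C /andP[CE eC].
  rewrite (krev_cut CE eC).
  rewrite (qmon_cut CE eC).
  rewrite (qmon_cut_diss CE eC) exprD.
  exact: mulrCA.
pose X b := Dissection (half_dissection eT b).
have q1 b m : cut_coef mone m (piece T e b) = ind (set_mon (piece T e b)) m.
  exact: (cut_coef_q1 m (X b)).
have r1 b m : cut_coef m mone (piece T e b) = ind (set_mon (piece T e b)) m.
  exact: (cut_coef_r1 m (X b)).
rewrite sum_split !q1 !r1 -mulrDr; congr (_ * _).
exact: expand_split.
Qed.

End ProductFormula.

(** * Diagrams split at a root chord *)

(* Adjacency of vertices given as natural numbers, so that diagrams of        *)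
(* different polygons can be compared.                                        *)
Definition nadj n (E : {set chord n}) (i j : nat) : bool :=
  [exists u : 'I_n.+1, exists v : 'I_n.+1, [&& u == i :> nat, v == j :> nat & adj E u v]].

Section NatAdjacency.
Variable n : nat.
Implicit Types (E : {set chord n}) (i j k l : nat).

Lemma nadjP E i j : reflect
  (exists u v : 'I_n.+1, [/\ u = i :> nat, v = j :> nat & adj E u v]) (nadj E i j).
Proof.
apply: (iffP existsP) => [[u /existsP[v /and3P[/eqP iu /eqP jv uv]]]|[u [v [iu jv uv]]]].
  by exists u, v.
by exists u; apply/existsP; exists v; rewrite iu jv !eqxx.
Qed.

Lemma nadj_ord E (u v : 'I_n.+1) : nadj E u v = adj E u v.
Proof.
by apply/nadjP/idP => [[a [b [/val_inj-> /val_inj->]]]|uv] //; exists u, v.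
Qed.

Lemma nadjC E i j : nadj E i j = nadj E j i.
Proof.
by apply/nadjP/nadjP => -[u [v [iu jv uv]]]; exists v, u; rewrite adj_sym.
Qed.

Lemma nadj_le E i j : nadj E i j -> (i <= n) && (j <= n).
Proof. by case/nadjP => u [v [<- <- _]]; rewrite !leq_ord. Qed.

Lemma nadj_chord E (c : chord n) : c \in E -> nadj E c.1 c.2.
Proof. by rewrite nadj_ord /adj -surjective_pairing => ->. Qed.

Lemma nadj_ordered E i j : ordered E -> i < j -> nadj E i j ->
  exists2 c : chord n, c \in E & c.1 = i :> nat /\ c.2 = j :> nat.
Proof.
move=> oE ij /nadjP[u [v [ui vj /orP[]]]] h; first by exists (u, v).
by have := oE _ h; rewrite /= ui vj ltnNge ltnW.
Qed.

End NatAdjacency.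

Lemma nadj_contractP n (S : {set 'I_n.+1}) (E : {set chord n}) i j : reflect
  (exists u v, [/\ adj E u v, collapse S u = i :> nat & collapse S v = j :> nat])
  (nadj (contract S E) i j).
Proof.
apply: (iffP (nadjP _ _ _)) => [[a [b [<- <- /orP[]/imsetP[c cE]]]]|[u [v [uv <- <-]]]].
- rewrite /mkchord; case: ifP => _ [-> ->]; [exists c.1, c.2|exists c.2, c.1];
    by rewrite /adj -surjective_pairing cE ?orbT.
- rewrite /mkchord; case: ifP => _ [-> ->]; [exists c.2, c.1|exists c.1, c.2];
    by rewrite /adj -surjective_pairing cE ?orbT.
exists (collapse S u), (collapse S v); split=> //.
have H (c : chord n) : c \in E -> adj (contract S E) (collapse S c.1) (collapse S c.2).
  move=> /(contract_f S); rewrite /adj /collapse_chord /mkchord.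
  by case: ifP => _ ->; rewrite ?orbT.
by case/orP: uv => /H //=; rewrite adj_sym.
Qed.

Section DissectionFacts.
Variables (n : nat) (D : dissection n).
Implicit Types i j k l : nat.
Let oD : ordered D. Proof. by case: (dissectionP D). Qed.

Lemma nadj_irr i : nadj D i i = false.
Proof.
apply/negbTE/negP => /nadjP[u [v [ui vi /orP[]/oD]]] /=; rewrite ui vi ltnn //.
Qed.

Lemma no_triangle i j k : nadj D i j -> nadj D j k -> nadj D i k -> False.
Proof.
move=> ij jk ik.
have ne : [/\ i != j, j != k & i != k].
  by split; apply/negP => /eqP e; move: ij jk ik; rewrite e nadj_irr.
case/nadjP: ij => u [v [ui vj uv]]; case/nadjP: jk => v' [w [vj' wk vw]].
have evv : v' = v by apply: val_inj; rewrite /= vj vj'.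
case/nadjP: ik => u' [w' [ui' wk' uw]].
have euu : u' = u by apply: val_inj; rewrite /= ui ui'.
have eww : w' = w by apply: val_inj; rewrite /= wk wk'.
subst v' u' w'; have /forallP aD := dissection_acyclic D.
have un : uniq [:: u; v; w].
  rewrite /= !inE -!val_eqE /= ui vj wk; case: ne => /negbTE -> /negbTE -> /negbTE -> //.
have sz : size [:: u; v; w] <= n.+1.
  by rewrite -(card_uniqP un) -[leqRHS]card_ord max_card.
have := aD (Bseq sz); rewrite /ucycleb /= uv vw adj_sym uw /=.
by move: un => /= ->.
Qed.

Lemma nadj_nocross i j k l : i < k -> k < j -> j < l -> nadj D i j -> nadj D k l -> False.
Proof.
move=> ik kj jl /(nadj_ordered oD (ltn_trans ik kj))[c cD [c1 c2]].
move=> /(nadj_ordered oD (ltn_trans kj jl))[d dD [d1 d2]].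
have [_ nD _ _] := dissectionP D; have := nD c d cD dD.
by rewrite /crossing c1 c2 d1 d2 ik kj jl.
Qed.

End DissectionFacts.

Lemma nadj_inj n (D E : dissection n) : (forall i j, nadj D i j = nadj E i j) -> D = E.
Proof.
move=> h; apply/val_inj/setP => c /=.
have aux (F G : dissection n) : (forall i j, nadj F i j = nadj G i j) ->
    c \in chords F -> c \in chords G.
  move=> FG cF; have [oF _ _ _] := dissectionP F; have [oG _ _ _] := dissectionP G.
  have := nadj_chord cF; rewrite FG nadj_ord adj_mkchord // mkchordE //; exact: oF.
by apply/idP/idP; apply: aux.
Qed.

Lemma mon_nadj n m (D : dissection n) (E : dissection m) : mon D = mon E ->
  n = m /\ forall i j, nadj D i j = nadj E i j.
Proof.
move=> e; have nm : n = m by have := congr1 wdeg e; rewrite !wdeg_mon.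
split=> //; subst m; suff -> : D = E by [].
case: n D E e => [|n] D E e.
  apply: val_inj => /=; have := card_dissection D; have := card_dissection E.
  by move=> /cards0_eq -> /cards0_eq ->.
by have /eqP := ucm_inj e; rewrite eq_Tagged => /eqP.
Qed.

Lemma nadj_mon n m (D : dissection n) (E : dissection m) : n = m ->
  (forall i j, nadj D i j = nadj E i j) -> mon D = mon E.
Proof. by move=> nm; subst m => /nadj_inj ->. Qed.

Lemma nadj_ndiagram (D E : ndiagram) : tag D = tag E ->
  (forall i j, nadj (tagged D) i j = nadj (tagged E) i j) -> D = E.
Proof. by case: D E => [n D] [m E] /= nm; subst m => /nadj_inj ->. Qed.

Definition rdeg n (E : {set chord n}) := #|[set j | adj E ord0 j]|.

Lemma rdegE n (E : {set chord n}) : rdeg E = \sum_(0 <= j < n.+1) nadj E 0 j.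
Proof.
rewrite big_mkord /rdeg -sum1_card big_mkcond; apply: eq_bigr => j _.
by rewrite inE -nadj_ord; case: nadj.
Qed.

Lemma side_rankS n (S : {set 'I_n.+1}) w (wn : w < n.+1) :
  side_rank S w.+1 = side_rank S w + (Ordinal wn \in S).
Proof.
rewrite /side_rank; have [wS|wS] := boolP (Ordinal wn \in S).
  rewrite (cardsD1 (Ordinal wn)) inE wS ltnS leqnn addnC; congr (_ + _).
  by apply: eq_card => s; rewrite !inE -val_eqE /= ltnS [s < w]ltn_neqAle; case: (s \in S);
    rewrite ?andbF.
rewrite addn0; apply: eq_card => s; rewrite !inE ltnS leq_eqVlt.
case sS: (s \in S) => //=; case: eqP => //= sw; case/negP: wS.
by rewrite (_ : Ordinal wn = s) //; apply: val_inj.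
Qed.

(** * The two pieces in coordinates *)

Section HalfRank.
Variables (n : nat) (e : chord n).
Hypothesis lt_e : e.1 < e.2.

Lemma side_rank_inner w : w <= n.+1 -> side_rank (half_sides e true) w = minn w e.2 - e.1.
Proof.
elim: w => [|w IH] wn.
  by rewrite /side_rank min0n sub0n; apply/eqP; rewrite cards_eq0; apply/eqP/setP => s;
    rewrite !inE ltn0 andbF.
rewrite side_rankS IH 1?ltnW // inE /beyond /=; move: lt_e; lia.
Qed.

Lemma side_rank_outer w : w <= n.+1 ->
  side_rank (half_sides e false) w = minn w e.1 + (w - e.2).
Proof.
elim: w => [|w IH] wn.
  by rewrite /side_rank min0n sub0n; apply/eqP; rewrite cards_eq0; apply/eqP/setP => s;
    rewrite !inE ltn0 andbF.
rewrite side_rankS IH 1?ltnW // inE /beyond /=; move: lt_e; lia.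
Qed.

Lemma side_rank_card (S : {set 'I_n.+1}) : side_rank S n.+1 = #|S|.
Proof. by apply: eq_card => s; rewrite inE ltn_ord andbT. Qed.

Lemma card_inner : #|half_sides e true| = e.2 - e.1.
Proof. by rewrite -side_rank_card side_rank_inner //; have := ltn_ord e.2; lia. Qed.

Lemma card_outer : #|half_sides e false| = n.+1 - (e.2 - e.1).
Proof. by rewrite -side_rank_card side_rank_outer //; have := ltn_ord e.2; move: lt_e; lia. Qed.

Lemma collapse_inner (w : 'I_n.+1) : e.1 <= w <= e.2 ->
  collapse (half_sides e true) w = (if w == e.2 then 0 else w - e.1) :> nat.
Proof.
move=> h; rewrite collapseE card_inner; last by move: lt_e; lia.
rewrite side_rank_inner; last exact: ltnW.
rewrite -val_eqE /=; case: eqP => [->|ne]; first by rewrite minnn modnn.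
by rewrite modn_small; lia.
Qed.

Lemma collapse_outer (w : 'I_n.+1) : (w <= e.1) || (e.2 <= w) ->
  collapse (half_sides e false) w = (if w <= e.1 then nat_of_ord w else w - (e.2 - e.1)) :> nat.
Proof.
move=> h; have := ltn_ord e.2 => e2n; have wn := ltn_ord w.
rewrite collapseE card_outer; last by move: lt_e; lia.
rewrite side_rank_outer; last exact: ltnW.
rewrite modn_small; first by case: ifP => h1; move: lt_e h h1; lia.
move: lt_e h; lia.
Qed.

End HalfRank.

Section RootPiece.
Variables (n : nat) (D : dissection n) (e : chord n).
Implicit Types (c : chord n).
Hypotheses (eD : e \in chords D) (e0 : e.1 = ord0).
Let oD : ordered D. Proof. by case: (dissectionP D). Qed.
Let nD : noncrossing D. Proof. by case: (dissectionP D). Qed.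
Let lt_e : e.1 < e.2. Proof. exact: oD. Qed.
Local Notation v := (nat_of_ord e.2).
Let e00 : e.1 = 0 :> nat. Proof. by rewrite e0. Qed.

Lemma lies_in_inner c : c \in chords D -> c != e ->
  lies_in (half_sides e true) c = (c.2 <= v).
Proof.
move=> cD ce; have lt_c := oD cD; have := nD cD eD; rewrite /crossing e0 /= => nc.
apply/lies_inP/idP => [[s [t []]]|cv].
  rewrite !inE !eqb_id separatesE /beyond e00 /=; move: nc; lia.
have ne : ~~ ((c.1 == 0 :> nat) && (c.2 == e.2 :> nat)).
  apply: contra ce => /andP[/eqP c1 /eqP c2]; apply/eqP.
  rewrite [c]surjective_pairing [e]surjective_pairing.
  by congr pair; apply: val_inj; rewrite /= ?c1 ?e00 ?c2.
have [c1|c1] := posnP c.1.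
  exists c.1, c.2; rewrite !inE !eqb_id separatesE /beyond e00 /=; split; move: lt_c; lia.
exists c.1, ord0; rewrite !inE !eqb_id separatesE /beyond e00 /=; split; move: lt_c lt_e; lia.
Qed.

Lemma lies_in_outer c : c \in chords D -> c != e ->
  lies_in (half_sides e false) c = (v <= c.1) || (c.1 == ord0) && (v < c.2).
Proof.
move=> cD ce; have lt_c := oD cD; have := nD cD eD; rewrite /crossing e0 /= => nc.
have [s [t [est sep _]]] := chord_face eD cD ce.
have H b := lies_in_half eD b cD ce sep est.
have : lies_in (half_sides e false) c = ~~ lies_in (half_sides e true) c.
  by rewrite !H; case: (beyond e s).
rewrite lies_in_inner // => ->; rewrite -ltnNge -val_eqE /=; move: nc lt_e; rewrite e00; lia.
Qed.

Lemma mkchord_neq (u w : 'I_n.+1) :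
  (mkchord u w != e) = ~~ ((u == 0 :> nat) && (w == v :> nat) ||
    (w == 0 :> nat) && (u == v :> nat)).
Proof.
congr negb; rewrite /mkchord; case: ifP => uw;
  rewrite [e]surjective_pairing xpair_eqE -!val_eqE /= e00; move: lt_e; rewrite e00; lia.
Qed.

Lemma adj_inner (u w : 'I_n.+1) : adj (half_chords D e true) u w =
  [&& adj D u w, u <= v, w <= v & ~~ ((u == 0 :> nat) && (w == v :> nat) ||
    (w == 0 :> nat) && (u == v :> nat))].
Proof.
rewrite -mkchord_neq !adj_mkchord //; last exact: half_chords_ordered.
rewrite in_set in_setD1; case cD: (mkchord u w \in chords D); rewrite ?andbF //= andbT.
case ce: (mkchord u w != e); rewrite ?andbF //= andbT.
by rewrite lies_in_inner // mkchord_snd geq_max.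
Qed.

Lemma adj_outer (u w : 'I_n.+1) : adj (half_chords D e false) u w =
  [&& adj D u w & [|| (v <= u) && (v <= w),
    (u == 0 :> nat) && (v < w) | (w == 0 :> nat) && (v < u)]].
Proof.
rewrite !adj_mkchord //; last exact: half_chords_ordered.
rewrite in_set in_setD1; case cD: (mkchord u w \in chords D); rewrite ?andbF //= andbT.
case ce: (mkchord u w == e) => /=.
  by have := mkchord_neq u w; rewrite ce /= => /esym; move: lt_e e00; lia.
rewrite lies_in_outer ?ce // -val_eqE /= mkchord_fst mkchord_snd; move: lt_e; rewrite e0 /=; lia.
Qed.

(** The ends 0 and [v] of [e] merge into the root of the piece, which inherits the neighbours of
    both. The condition [0 < a + b] removes the loop left by [e]. *)
Lemma nadj_inner a b : nadj (piece D e true) a b =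
  [&& a < v, b < v, 0 < a + b
    & [|| nadj D a b, (a == 0) && nadj D v b | (b == 0) && nadj D a v]].
Proof.
have cw (w : 'I_n.+1) : w <= v -> collapse (half_sides e true) w =
  (if w == v :> nat then 0 else w) :> nat.
  by move=> h; rewrite collapse_inner // ?e00 ?subn0.
apply/nadj_contractP/idP => [[u [w []]]|/and4P[av bv ab h]].
  rewrite adj_inner -nadj_ord => /and4P[uw uv wv ne]; rewrite !cw // => <- <-.
  move: uw uv wv ne; case: (eqVneq (u : nat) v) => [->|nu]; case: (eqVneq (w : nat) v) => [->|nw];
    rewrite ?nadj_irr //= => uw uv wv ne.
  - rewrite uw orbT andbT; move: lt_e; rewrite e00; lia.
  - rewrite uw !orbT andbT; move: lt_e; rewrite e00; lia.
  rewrite uw /= andbT; have : (u : nat) != w by apply: contraTneq uw => ->; rewrite nadj_irr.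
  lia.
have wit i j : nadj D i j -> i <= v -> j <= v ->
  ~~ ((i == 0) && (j == v) || (j == 0) && (i == v)) ->
    exists u w : 'I_n.+1, [/\ adj (half_chords D e true) u w,
      collapse (half_sides e true) u = (if i == v then 0 else i) :> nat &
      collapse (half_sides e true) w = (if j == v then 0 else j) :> nat].
  move=> /nadjP[u [w [<- <- uw]]] uv wv ne; exists u, w; split; rewrite ?cw //.
  by rewrite adj_inner uw uv wv.
have neq k : k < v -> (k == v) = false by move=> kv; lia.
case/or3P: h => [h|/andP[/eqP a0 h]|/andP[/eqP b0 h]].
- have := wit a b h; rewrite !neq //; apply; lia.
- by have := wit v b h; rewrite eqxx neq // -a0; apply; lia.
- by have := wit a v h; rewrite eqxx neq // -b0; apply; lia.
Qed.

Lemma nadj_outer a b : nadj (piece D e false) a b =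
  (0 < a + b) && [|| nadj D (a + v) (b + v),
    (a == 0) && nadj D 0 (b + v) | (b == 0) && nadj D (a + v) 0].
Proof.
have v0 : 0 < v by move: lt_e; rewrite e00.
have cw (w : 'I_n.+1) : (w == 0 :> nat) || (v <= w) ->
  collapse (half_sides e false) w = w - v :> nat.
  move=> h; rewrite collapse_outer // ?e00 ?subn0; last by lia.
  by case: ifP => // h'; lia.
apply/nadj_contractP/idP => [[u [w []]]|/andP[ab h]].
  rewrite adj_outer -nadj_ord => /andP[uw h].
  have nuw : (u : nat) != w by apply: contraTneq uw => ->; rewrite nadj_irr.
  rewrite !cw; try lia; move=> <- <-.
  case/or3P: h => [/andP[uv wv]|/andP[/eqP u0 wv]|/andP[/eqP w0 uv]].
  - by rewrite !subnK // uw andbT; lia.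
  - have k : w - v + v = w by lia.
    by rewrite u0 in uw; rewrite u0 sub0n eqxx k uw !orbT andbT; lia.
  - have k : u - v + v = u by lia.
    by rewrite w0 in uw; rewrite w0 sub0n eqxx k uw !orbT andbT; lia.
have wit i j : nadj D i j -> [|| (v <= i) && (v <= j),
  (i == 0) && (v < j) | (j == 0) && (v < i)] ->
    exists u w : 'I_n.+1, [/\ adj (half_chords D e false) u w,
      collapse (half_sides e false) u = i - v :> nat &
      collapse (half_sides e false) w = j - v :> nat].
  move=> /nadjP[u [w [<- <- uw]]] h'; exists u, w; split; rewrite ?cw //; try lia.
  by rewrite adj_outer uw.
case/or3P: h => [h|/andP[/eqP a0 h]|/andP[/eqP b0 h]].
- have := wit _ _ h; rewrite !addnK; apply; lia.
- have := wit _ _ h; rewrite !addnK sub0n -a0; apply; lia.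
- have := wit _ _ h; rewrite !addnK sub0n -b0; apply; lia.
Qed.

End RootPiece.

(** Connected vertices force any two sides to be separated, which needs at least [n] chords; with no
    more than [n], each chord is essential and there is no cycle. This spares a search for cycles in
    the constructions below. *)
Lemma connected_dissection n (E : {set chord n}) : ordered E -> noncrossing E ->
  #|E| <= n -> (forall u, connect (adj E) u ord0) -> is_dissection E.
Proof.
move=> oE nE cE conn; have conn2 u v : connect (adj E) u v.
  by apply: connect_trans (conn u) _; rewrite conn_sym.
have sE : separated E setT.
  move=> s t _ _ ne; case: (ltngtP s t) => [lt|lt|/val_inj e].
  - exact: conn_separated.
  - by rewrite same_face_sym; apply: conn_separated.
  - by rewrite e eqxx in ne.
have {}cE : #|E| = n by apply/eqP; rewrite eqn_leq cE separated_card.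
apply/is_dissectionP; split=> //; apply: essential_acyclic => //.
exact: separated_essential.
Qed.

Lemma homo_connect (T1 T2 : finType) (e1 : rel T1) (e2 : rel T2) (f : T1 -> T2) a b :
  (forall x y, e1 x y -> e2 (f x) (f y)) -> connect e1 a b -> connect e2 (f a) (f b).
Proof.
move=> h /connectP[p]; elim: p a => [|c p IH] a /=; first by move=> _ ->.
by case/andP => /h /connect1 ac /IH{IH} cb /cb; apply: connect_trans.
Qed.

Section RootSplit.
Variable n : nat.
Implicit Types (E : {set chord n}) (v a b : nat).

Definition inner_adj E v a b := [&& a < v, b < v, 0 < a + b
    & [|| nadj E a b, (a == 0) && nadj E v b | (b == 0) && nadj E a v]].

Definition outer_adj E v a b := (0 < a + b) &&
  [|| nadj E (a + v) (b + v), (a == 0) && nadj E 0 (b + v) | (b == 0) && nadj E (a + v) 0].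

(* The chord {0, v} of E cuts E in X and Y. *)
Definition root_split E v p (X : {set chord p}) q (Y : {set chord q}) :=
  [/\ nadj E 0 v, v = p.+1, n = (p + q).+1,
      forall a b, nadj X a b = inner_adj E v a b
    & forall a b, nadj Y a b = outer_adj E v a b].

End RootSplit.

Lemma set_mon_nadj n m (D : dissection n) (E : dissection m) :
  set_mon D = set_mon E <-> n = m /\ (forall i j, nadj D i j = nadj E i j).
Proof.
rewrite !set_monE; split=> [/mon_nadj//|[nm h]]; exact: nadj_mon.
Qed.

Section RootSplitP.
Variables (n : nat) (E : dissection n) (p q : nat) (X : dissection p) (Y : dissection q).
Let oE : ordered E. Proof. by case: (dissectionP E). Qed.

Lemma root_split_piece (e : chord n) : e \in chords E -> e.1 = ord0 ->
  set_mon (piece E e true) = mon X -> set_mon (piece E e false) = mon Y ->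
  root_split E e.2 X Y.
Proof.
move=> eE e0; rewrite -!set_monE.
move=> /(set_mon_nadj (Dissection (half_dissection eE true)) X)[/= n1 h1].
move=> /(set_mon_nadj (Dissection (half_dissection eE false)) Y)[/= n2 h2].
have lt := oE eE; have e00 : e.1 = 0 :> nat by rewrite e0.
rewrite card_inner // e00 in n1; rewrite card_outer // e00 in n2.
have := ltn_ord e.2 => e2; split.
- by have := nadj_chord eE; rewrite e00.
- by lia.
- by lia.
- by move=> a b; rewrite -h1 nadj_inner.
- by move=> a b; rewrite -h2 nadj_outer.
Qed.

Lemma piece_root_split v : root_split E v X Y -> exists e : chord n, [/\ e \in chords E,
  e.1 = ord0,
  e.2 = v :> nat, set_mon (piece E e true) = mon X & set_mon (piece E e false) = mon Y].
Proof.
case=> vE vp nq hX hY; have v0 : 0 < v by rewrite vp.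
have [e eE [e0 e2]] := nadj_ordered oE v0 vE.
have {}e0 : e.1 = ord0 by apply: val_inj.
have e00 : e.1 = 0 :> nat by rewrite e0.
have lt := oE eE; exists e; split=> //; rewrite -!set_monE.
  apply/(set_mon_nadj (Dissection (half_dissection eE true)) X); split.
    by rewrite card_inner // e00; lia.
  by move=> a b /=; rewrite nadj_inner // hX e2.
apply/(set_mon_nadj (Dissection (half_dissection eE false)) Y); split.
  by rewrite card_outer // e00; lia.
by move=> a b /=; rewrite nadj_outer // hY e2.
Qed.

Section Split.
Variable v : nat.
Hypothesis sE : root_split E v X Y.

Let vE : nadj E 0 v. Proof. by case: sE. Qed.

Lemma root_split_le : 0 < v <= n.
Proof. by case: sE => _ h1 h2 _ _; lia. Qed.

Lemma no_root_triangle j : nadj E 0 j -> nadj E v j = false.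
Proof.
move=> j0; apply/negbTE/negP => vj; apply: (no_triangle (D := E) (i := 0) (j := v) (k :=
  j)) => //.
Qed.

Lemma split_inner i j : 0 < i < v -> 0 < j < v -> nadj E i j = nadj X i j.
Proof.
case: sE => _ _ _ -> _ iv jv; rewrite /inner_adj.
have [/andP[i0 iv'] /andP[j0 jv']] := (iv, jv).
rewrite iv' jv' (gtn_eqF i0) (gtn_eqF j0) !orbF addn_gt0 i0 //.
Qed.

Lemma split_outer i j : v < i -> v < j -> nadj E i j = nadj Y (i - v) (j - v).
Proof.
case: sE => _ _ _ _ -> iv jv; rewrite /outer_adj (subnK (ltnW iv)) (subnK (ltnW jv)).
have -> : (i - v == 0) = false by lia.
have -> : (j - v == 0) = false by lia.
by rewrite !orbF; have -> : 0 < i - v + (j - v) by lia.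
Qed.

Lemma split_across i j : 0 < i < v -> v < j -> nadj E i j = false.
Proof.
move=> /andP[i0 iv] vj; apply/negbTE/negP => h.
exact: (nadj_nocross i0 iv vj vE h).
Qed.

Lemma split_root_inner j : 0 < j < v -> nadj X 0 j = nadj E 0 j || nadj E v j.
Proof.
case: sE => _ _ _ -> _ /andP[j0 jv]; rewrite /inner_adj jv j0 /= (ltn_trans j0 jv) (gtn_eqF j0).
by rewrite orbF.
Qed.

Lemma split_root_outer j : v < j -> nadj Y 0 (j - v) = nadj E 0 j || nadj E v j.
Proof.
case: sE => _ _ _ _ -> vj; rewrite /outer_adj (subnK (ltnW vj)) !add0n.
have -> : (j - v == 0) = false by lia.
by rewrite orbF subn_gt0 vj /= orbC.
Qed.

Lemma split_root j : nadj E 0 j =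
  (j == v) || ~~ nadj E v j && (if j < v then nadj X 0 j else nadj Y 0 (j - v)).
Proof.
case: (ltngtP j v) => [jv|vj|->]; last by rewrite vE.
  have [->|j0] := posnP j.
    by rewrite !nadj_irr nadjC vE.
  rewrite split_root_inner ?j0 //=; case h: (nadj E 0 j) => /=.
    by rewrite no_root_triangle.
  by rewrite andNb.
rewrite split_root_outer //=; case h: (nadj E 0 j) => /=.
  by rewrite no_root_triangle.
by rewrite andNb.
Qed.

(** Contracting the chord {0, v} merges the neighbourhoods of 0 and [v], which are disjoint as a
    tree has no triangle; the 1 stands for the contracted chord. *)
Lemma rdeg_split : rdeg X + rdeg Y + 1 = rdeg E + \sum_(1 <= j < n.+1) nadj E v j.
Proof.
have [_ vp nq _ _] := sE; rewrite !rdegE.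
have split0 m (Z : dissection m) : \sum_(0 <= j < m.+1) nadj Z 0 j =
  \sum_(1 <= j < m.+1) nadj Z 0 j.
  by rewrite big_nat_recl // nadj_irr add0n big_add1.
rewrite !split0 -vp.
have -> : \sum_(1 <= j < v) nadj X 0 j = \sum_(1 <= j < v) (nadj E 0 j + nadj E v j).
  apply: eq_big_nat => j jv; rewrite split_root_inner //.
  by case h: (nadj E 0 j); rewrite // no_root_triangle.
have -> : \sum_(1 <= j < q.+1) nadj Y 0 j = \sum_(v.+1 <= j < n.+1) (nadj E 0 j + nadj E v j).
  rewrite -(add1n v) big_addn (_ : n.+1 - v = q.+1); last by lia.
  apply: eq_big_nat => j jv; rewrite -[in LHS](addnK v j) split_root_outer; last by lia.
  by case h: (nadj E 0 (j + v)); rewrite // no_root_triangle.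
have cat F : \sum_(1 <= j < n.+1) F j = \sum_(1 <= j < v) F j + (
  F v + \sum_(v.+1 <= j < n.+1) F j).
  have /andP[v1 v2] := root_split_le.
  by rewrite (@big_cat_nat _ _ _ v) //= 1?ltnW //; congr (_ + _); rewrite big_ltn.
rewrite !cat !big_split /= vE nadj_irr; lia.
Qed.

End Split.
End RootSplitP.

(** The contraction forgets only whether a neighbour of the merged root was joined to 0 or to [v];
    the neighbourhood of [v] restores this. *)
Lemma root_split_uniq n (E E' : dissection n) v p q (X : dissection p) (Y : dissection q) :
  root_split E v X Y -> root_split E' v X Y ->
  (forall j, nadj E v j = nadj E' v j) -> E = E'.
Proof.
move=> s s' vE.
have root j : nadj E 0 j = nadj E' 0 j.
  by rewrite (split_root s) (split_root s') vE.
have lt i j : 0 < i -> i < j -> nadj E i j = nadj E' i j.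
  move=> i0 ij; case: (ltngtP i v) => [iv|vi|->] //; last first.
    by rewrite (split_outer s) ?(split_outer s') //; exact: ltn_trans ij.
  case: (ltngtP j v) => [jv|vj|->].
  - by rewrite (split_inner s) ?(split_inner s') ?i0 ?iv ?jv ?(ltn_trans i0 ij).
  - by rewrite (split_across s) ?(split_across s') ?i0 ?iv.
  - by rewrite nadjC vE nadjC.
apply: nadj_inj => i j; case: (ltngtP i j) => [ij|ji|->]; last by rewrite !nadj_irr.
  by have [->|i0] := posnP i; [apply: root|apply: lt].
rewrite nadjC [RHS]nadjC.
by have [->|i0] := posnP j; [apply: root|apply: lt].
Qed.

Lemma nadj_bound n (D : dissection n) i j : nadj D i j -> [&& i <= n, j <= n & i != j].
Proof.
move=> h; have /andP[-> ->] := nadj_le h.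
by apply: contraTneq h => ->; rewrite nadj_irr.
Qed.

(** * Concatenating two diagrams at the root, and moving a root chord *)

Section Glue.
Variables (p q : nat) (X : dissection p) (Y : dissection q).
Local Notation n := (p + q).+1.
Local Notation v := p.+1.
Let oX : ordered X. Proof. by case: (dissectionP X). Qed.
Let oY : ordered Y. Proof. by case: (dissectionP Y). Qed.

Definition shift_vertex (j : nat) : nat := if j is 0 then 0 else j + v.
Let f (j : 'I_p.+1) : 'I_n.+1 := inord j.
Let g (j : 'I_q.+1) : 'I_n.+1 := inord (shift_vertex j).

Let fE j : f j = j :> nat.
Proof. by rewrite inordK //; have := ltn_ord j; lia. Qed.

Let gE j : g j = shift_vertex j :> nat.
Proof. by rewrite inordK // /shift_vertex; have := ltn_ord j; case: (nat_of_ord j) => [|k];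
  lia. Qed.

Let vE : (inord v : 'I_n.+1) = v :> nat.
Proof. by rewrite inordK //; lia. Qed.

Definition glue_set : {set chord n} :=
  (ord0, inord v) |: ([set (f c.1, f c.2) | c in chords X] :|:
                      [set (g c.1, g c.2) | c in chords Y]).

Lemma glue_setP (c : chord n) : c \in glue_set ->
  [\/ c.1 = 0 :> nat /\ c.2 = v :> nat,
      exists2 d : chord p, d \in chords X & c.1 = d.1 :> nat /\ c.2 = d.2 :> nat
    | exists2 d : chord q, d \in chords Y &
        c.1 = shift_vertex d.1 :> nat /\ c.2 = shift_vertex d.2 :> nat].
Proof.
rewrite in_setU1 in_setU => /predU1P[->|/orP[]/imsetP[d dD ->]].
- by apply: Or31; rewrite /= vE.
- by apply: Or32; exists d; rewrite // !fE.
- by apply: Or33; exists d; rewrite // !gE.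
Qed.

Let glueX a b : (a, b) \in chords X -> (f a, f b) \in glue_set.
Proof. by move=> h; rewrite in_setU1 !in_setU; apply/or3P/Or32/imsetP; exists (a, b). Qed.

Let glueY a b : (a, b) \in chords Y -> (g a, g b) \in glue_set.
Proof. by move=> h; rewrite in_setU1 !in_setU; apply/or3P/Or33/imsetP; exists (a, b). Qed.

Let homX a b : adj X a b -> adj glue_set (f a) (f b).
Proof. by rewrite /adj; case/orP => /glueX ->; rewrite ?orbT. Qed.

Let homY a b : adj Y a b -> adj glue_set (g a) (g b).
Proof. by rewrite /adj; case/orP => /glueY ->; rewrite ?orbT. Qed.

Lemma shift_lt i j : (shift_vertex i < shift_vertex j) = (i < j).
Proof. by rewrite /shift_vertex; case: i j => [|i] [|j]; lia. Qed.

Lemma shift_cases i : (i = 0 /\ shift_vertex i = 0) \/ (0 < i /\ shift_vertex i = i + v).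
Proof. by case: i => [|i]; [left|right]. Qed.

Lemma glue_is_dissection : is_dissection glue_set.
Proof.
apply: connected_dissection.
- move=> c /glue_setP[[-> ->]|[d /oX dX [-> ->]]|[d /oY dY [-> ->]]] //.
  by rewrite shift_lt.
- have [_ nX _ _] := dissectionP X; have [_ nY _ _] := dissectionP Y.
  move=> c d; rewrite /crossing.
  case/glue_setP=> [[-> ->]|[c' cX [-> ->]]|[c' cY [-> ->]]];
    case/glue_setP=> [[-> ->]|[d' dX [-> ->]]|[d' dY [-> ->]]].
  + lia.
  + have := ltn_ord d'.2; lia.
  + case: (shift_cases d'.1) (shift_cases d'.2); lia.
  + have := ltn_ord c'.2; lia.
  + exact: nX.
  + have := ltn_ord c'.2; case: (shift_cases d'.1) (shift_cases d'.2); lia.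
  + case: (shift_cases c'.1) (shift_cases c'.2); lia.
  + have := ltn_ord d'.2; case: (shift_cases c'.1) (shift_cases c'.2); lia.
  + rewrite !shift_lt; exact: nY.
- rewrite cardsU1; apply: leq_trans (leq_add (leq_b1 _) (leq_card_setU _ _)) _.
  rewrite add1n ltnS leq_add //; apply: leq_trans (leq_imset_card _ _) _;
    by rewrite card_dissection.
move=> u; have f0 : f ord0 = ord0 by apply: val_inj; rewrite /= fE.
have g0 : g ord0 = ord0 by apply: val_inj; rewrite /= gE.
case: (ltngtP u v) => [uv|vu|e].
- have -> : u = f (inord u) by apply: val_inj; rewrite /= fE inordK.
  rewrite -f0; apply: (homo_connect homX); exact: dissection_connected.
- have -> : u = g (inord (u - v)).
    apply: val_inj; have := ltn_ord u => un; rewrite /= gE inordK; last by lia.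
    by rewrite /shift_vertex; case E: (u - v) => [|k]; lia.
  rewrite -g0; apply: (homo_connect homY); exact: dissection_connected.
have -> : u = inord v by apply: val_inj; rewrite /= vE.
by rewrite connect1 // /adj !inE eqxx orbT.
Qed.

Definition glue : dissection n := Dissection glue_is_dissection.

Lemma nadj_glue i j : nadj glue i j =
  [|| (i == 0) && (j == v), (j == 0) && (i == v), nadj X i j
    | [&& (i == 0) || (v < i), (j == 0) || (v < j) & nadj Y (i - v) (j - v)]].
Proof.
have nX a b : adj X a b -> nadj glue a b.
  by move=> h; apply/nadjP; exists (f a), (f b); rewrite !fE; split=> //; apply: homX.
have nY a b : adj Y a b -> nadj glue (shift_vertex a) (shift_vertex b).
  by move=> h; apply/nadjP; exists (g a), (g b); rewrite !gE; split=> //; apply: homY.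
have v0 : nadj glue 0 v.
  by apply/nadjP; exists ord0, (inord v); rewrite vE; split=> //; rewrite /adj !inE eqxx.
apply/idP/idP => [/nadjP[a [b [<- <- ab]]]|].
  have H (c : chord n) : c \in glue_set -> (
      [|| (c.1 == 0 :> nat) && (c.2 == v :> nat), nadj X c.1 c.2
      | [&& (c.1 == 0 :> nat) || (v < c.1), (c.2 == 0 :> nat) ||
        (v < c.2) & nadj Y (c.1 - v) (c.2 - v)]]).
    case/glue_setP=> [[-> ->]|[d dX [-> ->]]|[d dY [-> ->]]].
    - by rewrite !eqxx.
    - by rewrite nadj_chord ?orbT.
    - have hd := nadj_chord dY; apply/orP; right; apply/orP; right.
      have s k : (shift_vertex k == 0) || (v < shift_vertex k) by case: (shift_cases k); lia.
      have s' k : shift_vertex k - v = k by case: (shift_cases k); lia.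
      by rewrite !s !s'.
  case/orP: ab => /H /=; first by case/or3P => ->; rewrite ?orbT.
  rewrite [nadj X b a]nadjC [nadj Y _ _]nadjC; case/or3P => [->|->|/and3P[-> -> ->]];
    rewrite ?orbT //.
case/or4P => [/andP[/eqP -> /eqP ->] //|/andP[/eqP -> /eqP ->]|/nadjP[a [b [<- <- /nX]]] //|].
  by rewrite nadjC.
case/and3P => i0 j0 /nadjP[a [b [ai bj /nY]]].
have s k (w : nat) : w = k - v -> (k == 0) || (v < k) -> shift_vertex w = k.
  by move=> -> ; case: (shift_cases (k - v)); lia.
by rewrite (s i a) // (s j b).
Qed.

Lemma glue_leaf j : nadj glue v j = (j == 0).
Proof.
rewrite nadj_glue; have -> : nadj X v j = false.
  by apply/negbTE/negP => /nadj_bound; lia.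
by rewrite eqxx ltnn /= andbT !orbF.
Qed.

Lemma glue_split : root_split glue v X Y.
Proof.
split=> //.
- by rewrite nadjC glue_leaf.
- move=> a b; rewrite /inner_adj [nadj _ v b]glue_leaf [nadj _ a v]nadjC glue_leaf nadj_glue.
  have := @nadj_bound _ X a b; have := @nadj_bound _ Y (a - v) (b - v).
  have := nadj_irr Y 0.
  case: (nadj X a b); case E: (nadj Y (a - v) (b - v)) => //; last by lia.
  + by lia.
  + by lia.
  have [[-> ->]|] : (a = 0 /\ b = 0) \/ ~ (a = 0 /\ b = 0) by lia.
    by [].
  by lia.
- move=> a b; rewrite /outer_adj !nadj_glue !addnK.
  have F i j : (p < i) || (p < j) -> nadj X i j = false.
    by move=> h; apply/negbTE/negP => /nadj_bound; lia.
  rewrite !F ?sub0n; try lia.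
  have := nadj_irr Y 0; case: a b => [|a] [|b] //=; lia.
Qed.

End Glue.

(* The chord {0, w} is replaced by {v, w}. *)
Definition swap_adj n (G : {set chord n}) (v w i j : nat) :=
  nadj G i j && ~~ ((i == 0) && (j == w) || (j == 0) && (i == w))
  || ((i == v) && (j == w) || (i == w) && (j == v)).

(** A chord away from the root which crossed {v, w} would cross {0, v} or {0, w}; a chord at the
    root would end between [v] and [w], which the last hypothesis excludes. The path 0, v, w keeps
    the graph connected. *)
Lemma swap_dissection n (G : dissection n) v w : nadj G 0 v -> nadj G 0 w -> v != w ->
  (forall k, minn v w < k < maxn v w -> ~~ nadj G 0 k) ->
  exists E : dissection n, forall i j, nadj E i j = swap_adj G v w i j.
Proof.
move=> v0 w0 vw cons; have [oG nG _ _] := dissectionP G.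
have /nadjP[r [a [r0 av ra]]] := v0; have /nadjP[r' [b [r0' bw rb]]] := w0.
have er : r = ord0 by apply: val_inj.
have er' : r' = ord0 by apply: val_inj.
subst r r' v w; have a0 : 0 < a by move/nadj_bound: v0; lia.
have b0 : 0 < b by move/nadj_bound: w0; lia.
have nab : a != b by apply: contraNneq vw => ->.
pose E := mkchord a b |: (G :\ mkchord ord0 b).
have GE (c : chord n) : c \in G -> c != mkchord ord0 b -> c \in E.
  by move=> cG cb; rewrite !inE cG cb orbT.
have oE : ordered E.
  move=> c; rewrite !inE => /predU1P[->|/andP[_ /oG //]].
  by rewrite mkchord_fst mkchord_snd; lia.
have crossN (c : chord n) : c \in G -> c != mkchord ord0 b ->
    ~~ crossing (mkchord a b) c && ~~ crossing c (mkchord a b).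
  move=> cG cb; have lt := oG _ cG; have nc := nadj_chord cG.
  have X i j k l := @nadj_nocross _ G i j k l.
  have := X 0 a c.1 c.2; have := X 0 b c.1 c.2.
  rewrite v0 w0 nc /crossing mkchord_fst mkchord_snd => h1 h2.
  have [c0|c0] := posnP c.1.
    have := cons c.2; rewrite -{1}c0 nc => h3.
    rewrite c0; have : ~ (minn a b < c.2 < maxn a b) by move=> /h3.
    by move: vw a0 b0; lia.
  by move: vw a0 b0 h1 h2; lia.
have nE : noncrossing E.
  move=> c d; rewrite !inE => /predU1P[->|/andP[cb cG]] /predU1P[->|/andP[db dG]].
  - by rewrite /crossing; lia.
  - by case/andP: (crossN d dG db).
  - by case/andP: (crossN c cG cb).
  - exact: nG.
have adjE x y : adj E x y = (mkchord x y == mkchord a b) ||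
  (adj G x y && (mkchord x y != mkchord ord0 b)).
  by rewrite !adj_mkchord // !inE andbC.
have Eab : adj E a b by rewrite adjE eqxx.
have ab0 : mkchord ord0 a != mkchord ord0 b.
  by rewrite /mkchord a0 b0 xpair_eqE eqxx.
have E0a : adj E ord0 a by rewrite adjE ra ab0 orbT.
have dE : is_dissection E.
  apply: connected_dissection => // [|u].
    rewrite cardsU1 -[leqRHS](card_dissection G) (cardsD1 (mkchord ord0 b) (chords G)).
    by rewrite -(adj_mkchord ord0 b oG) rb leq_add2r leq_b1.
  apply: connect_sub (dissection_connected G u ord0) => x y xy.
  have [e|ne] := eqVneq (mkchord x y) (mkchord ord0 b); last first.
    by apply: connect1; rewrite adjE xy ne orbT.
  have c0b : connect (adj E) ord0 b by apply: connect_trans (connect1 E0a) (connect1 Eab).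
  have /orP[/eqP->|/eqP->] : (x == ord0) ||
    (x == b) by rewrite -mkchord_ends -e mkchord_ends eqxx.
    have : (y == ord0) || (y == b) by rewrite -mkchord_ends -e mkchord_ends eqxx orbT.
    by case/orP=> /eqP->.
  have : (y == ord0) || (y == b) by rewrite -mkchord_ends -e mkchord_ends eqxx orbT.
  by case/orP=> /eqP->; rewrite // conn_sym.
exists (Dissection dE) => i j.
have mk (x y z t : 'I_n.+1) : (mkchord x y == mkchord z t) =
    ((x == z :> nat) && (y == t :> nat) || (x == t :> nat) && (y == z :> nat)).
  rewrite [mkchord x y]surjective_pairing [mkchord z t]surjective_pairing xpair_eqE.
  by rewrite -!val_eqE /= !mkchord_fst !mkchord_snd; lia.
have H (x y : 'I_n.+1) : nadj E x y = swap_adj G a b x y.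
  rewrite nadj_ord adjE !mk /swap_adj nadj_ord /= orbC; congr (_ && ~~ _ || _).
  by rewrite [(x == b :> nat) && _]andbC.
have [/andP[i_n j_n]|out] := boolP ((i <= n) && (j <= n)).
  by have := H (Ordinal (i_n : i < n.+1)) (Ordinal (j_n : j < n.+1)).
have -> : nadj E i j = false by apply: contraNF out => /nadj_le.
rewrite /swap_adj; have -> : nadj G i j = false by apply: contraNF out => /nadj_le.
have := ltn_ord a; have := ltn_ord b; move: out; lia.
Qed.

Section SwapSplit.
Variables (n : nat) (G : dissection n) (p q : nat) (X : dissection p) (Y : dissection q) (
  v w : nat).
Hypotheses (sG : root_split G v X Y) (leaf : forall j, nadj G v j = (j == 0)).

(** The chords {0, w} and {v, w} have the same image once 0 and [v] are merged, so both pieces are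
    unchanged. *)
Lemma swap_split (E : dissection n) : w != v -> nadj G 0 w ->
  (forall i j, nadj E i j = swap_adj G v w i j) ->
  root_split E v X Y /\ forall j, nadj E v j = (j == 0) || (j == w).
Proof.
move=> wv w0 hE; have [v0 vp nq hX hY] := sG.
have vpos : 0 < v by rewrite vp.
have wpos : 0 < w by move/nadj_bound: w0; lia.
have Ev j : nadj E v j = (j == 0) || (j == w) by rewrite hE /swap_adj leaf; lia.
have Ev' j : nadj E j v = (j == 0) || (j == w) by rewrite nadjC.
have leaf' j : nadj G j v = (j == 0) by rewrite nadjC.
split=> //; split=> //.
- move=> a b; rewrite hX /inner_adj !Ev !Ev' !leaf !leaf' hE /swap_adj.
  have [[-> ->]|[[-> ->]|]] : (a = 0 /\ b = w) \/ (a = w /\ b =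
    0) \/ ~~ ((a == 0) && (b == w) || (b == 0) && (a == w)) by lia.
  + by rewrite w0; lia.
  + by rewrite nadjC w0; lia.
  by move=> h; rewrite h andbT; case: (nadj G a b); move: h; lia.
move=> a b; rewrite hY /outer_adj !hE /swap_adj.
have G1 k : nadj G (0 + v) k = (k == 0) by rewrite add0n leaf.
have G2 k : nadj G k (0 + v) = (k == 0) by rewrite add0n leaf'.
have w0' : nadj G w 0 by rewrite nadjC.
case: a b => [|a] [|b] //=; rewrite ?G1 ?G2 ?andbF ?orbF ?add0n ?eqxx.
- have [->|ne] := eqVneq (b.+1 + v) w; first by rewrite w0; lia.
  by case: (nadj G 0 _); lia.
- have [->|ne] := eqVneq (a.+1 + v) w; first by rewrite w0'; lia.
  by case: (nadj G _ 0); lia.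
- by case: (nadj G _ _); lia.
Qed.

(** The converse of [swap_split]: since the pieces agree, the diagrams differ only in which of 0 and
    [v] carries the extra neighbour. *)
Lemma split_swap (E : dissection n) : root_split E v X Y -> w != 0 ->
  (forall j, nadj E v j = (j == 0) || (j == w)) ->
  [/\ w != v, nadj G 0 w & forall i j, nadj E i j = swap_adj G v w i j].
Proof.
move=> sE w0 Ev.
have wv : w != v by apply/eqP => e; have := nadj_irr E v; rewrite Ev e eqxx orbT.
have v0 : 0 < v by case: sG => _ -> _.
have root j : nadj E 0 j = nadj G 0 j && (j != w).
  rewrite (split_root sE) (split_root sG) Ev leaf; have [->|jv] := eqVneq j v;
    first by rewrite (eq_sym v w) wv.
  by case: (if _ then _ else _); case: (j == 0); case: (j == w).
have Gw : nadj G 0 w.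
  rewrite (split_root sG) leaf w0 (negbTE wv) /=.
  have [lt|gt] := ltnP w v.
    by rewrite (split_root_inner sE) ?Ev ?eqxx ?orbT // lt0n w0.
  by rewrite (split_root_outer sE) ?Ev ?eqxx ?orbT // ltn_neqAle eq_sym wv.
split=> // i j.
have lt a b : a < b -> nadj E a b = swap_adj G v w a b.
  move=> ab; have [a0|a0] := posnP a.
    by rewrite a0 root /swap_adj; move: (nadj G 0 b) => z; lia.
  rewrite /swap_adj; have -> : ((a == 0) && (b == w) || (b == 0) && (a == w)) = false by lia.
  rewrite andbT; case: (eqVneq a v) => [->|av].
    by rewrite Ev leaf; lia.
  case: (eqVneq b v) => [->|bv].
    by rewrite nadjC Ev [nadj G _ _]nadjC leaf; lia.
  rewrite /= ?andbF ?orbF.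
  case: (ltngtP a v) => [av'|va|e]; last by rewrite e eqxx in av.
    case: (ltngtP b v) => [bv'|vb|e]; last by rewrite e eqxx in bv.
      by rewrite (split_inner sE) ?(split_inner sG) ?a0 ?av' ?bv' ?(ltn_trans a0 ab).
    by rewrite (split_across sE) ?(split_across sG) ?a0 ?av'.
  by rewrite (split_outer sE) ?(split_outer sG) //; apply: ltn_trans ab.
case: (ltngtP i j) => [ij|ji|->]; first exact: lt.
  rewrite nadjC lt // /swap_adj nadjC; move: (nadj G i j) => z; lia.
by rewrite nadj_irr /swap_adj nadj_irr; move: wv; lia.
Qed.

End SwapSplit.

(** * Chords away from the root *)

Section NonRoot.
Variables (n : nat) (D : dissection n) (e : chord n).
Hypotheses (eD : e \in chords D) (e0 : 0 < e.1).
Let oD : ordered D. Proof. by case: (dissectionP D). Qed.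
Let lt_e : e.1 < e.2. Proof. exact: oD. Qed.

Definition skip_vertex (j : nat) : nat := if j <= e.1 then j else j - (e.2 - e.1).

Lemma root_side j : nadj D 0 j -> (j <= e.1) || (e.2 <= j).
Proof.
move=> j0; have := @nadj_nocross _ D 0 j e.1 e.2; rewrite j0 (nadj_chord eD) => h.
by case: leqP => //= h1; case: leqP => // h2; case: (h e0 h1 h2).
Qed.

Lemma root_collapse (j : 'I_n.+1) : adj D ord0 j ->
  collapse (half_sides e false) j = skip_vertex j :> nat.
Proof. by rewrite -nadj_ord => /root_side; apply: collapse_outer. Qed.

Lemma root_in_outer (j : 'I_n.+1) : adj D ord0 j ->
  adj (piece D e false) ord0 (collapse (half_sides e false) j).
Proof.
move=> j0; rewrite -nadj_ord; apply/nadj_contractP; exists ord0, j.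
have jb : 0 < j by move: j0; rewrite -nadj_ord => /nadj_bound /=; lia.
have c0 : collapse (half_sides e false) ord0 = 0 :> nat.
  by rewrite collapse_outer.
split=> //; have cD : (ord0, j) \in chords D.
  by move: j0; rewrite adj_mkchord // /mkchord /= jb.
rewrite /adj !inE cD andbT; apply/orP; left; apply/andP; split.
  by apply: contraTneq e0 => <-.
apply/lies_inP; exists ord0, ord_max; rewrite !inE !eqbF_neg separatesE /beyond /=.
have := ltn_ord j; have := ltn_ord e.2; move: lt_e e0 jb; split; lia.
Qed.

Lemma root_collapse_inj : {in [set j | adj D ord0 j] &,
  injective (collapse (half_sides e false))}.
Proof.
move=> i j; rewrite !inE => i0 j0 /(congr1 (@nat_of_ord _)).
rewrite !root_collapse // /skip_vertex => h; apply: val_inj => /=.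
have ri := i0; have rj := j0; rewrite -nadj_ord in ri; rewrite -nadj_ord in rj.
have si := root_side ri; have sj := root_side rj; have ed := nadj_chord eD.
have T a b : nadj D 0 a -> nadj D 0 b -> ~ (a = e.1 :> nat /\ b = e.2 :> nat).
  by move=> a0 b0 [ea eb]; rewrite ea in a0; rewrite eb in b0; apply: (no_triangle a0 ed b0).
have := T _ _ ri rj; have := T _ _ rj ri; move: h si sj lt_e; do 2!case: ifP; lia.
Qed.

(** Root neighbours lie outside [e], as chords do not cross. No two of them are merged in the outer
    piece: they would be the two ends of [e] and form a triangle with the root. *)
Lemma nonroot_rdeg : rdeg D <= rdeg (piece D e false).
Proof.
rewrite /rdeg -(card_in_imset root_collapse_inj); apply/subset_leq_card/subsetP => k /imsetP[j].
by rewrite !inE => j0 ->; apply: root_in_outer.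
Qed.

Lemma nonroot_nadj_inv k : rdeg (piece D e false) <= rdeg D -> nadj (piece D e false) 0 k ->
  exists2 j, nadj D 0 j & k = skip_vertex j.
Proof.
rewrite /rdeg -(card_in_imset root_collapse_inj) => le /nadjP[r [a [r0 <- ra]]].
have er : r = ord0 by apply: val_inj.
have sub : collapse (half_sides e false) @: [set j | adj D ord0 j] \subset [set j |
  adj (piece D e false) ord0 j].
  by apply/subsetP => l /imsetP[j]; rewrite !inE => j0 ->; apply: root_in_outer.
have /eqP es : collapse (half_sides e false) @: [set j | adj D ord0 j] == [set j |
  adj (piece D e false) ord0 j].
  by rewrite eqEcard sub.
have : a \in [set j | adj (piece D e false) ord0 j] by rewrite inE -er.
rewrite -es => /imsetP[j]; rewrite inE => j0 ->; exists j.
  by rewrite (nadj_ord _ ord0).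
exact: root_collapse.
Qed.

End NonRoot.

Lemma rdeg_set_mon n m (D : dissection n) (E : dissection m) : mon D = mon E -> rdeg D = rdeg E.
Proof.
move=> /mon_nadj[nm h]; subst m; rewrite !rdegE.
by apply: eq_bigr => j _; rewrite h.
Qed.

Lemma rdeg0 (D : dissection 0) : rdeg D = 0.
Proof. by rewrite rdegE big_nat1 nadj_irr. Qed.

Lemma root_neighbor n (D : dissection n.+1) : exists j, nadj D 0 j.
Proof.
have /connectP[p] := dissection_connected D ord0 ord_max.
case: p => [_ /(congr1 val) //|j p /= /andP[h _] _].
by exists j; rewrite (nadj_ord _ ord0).
Qed.

Lemma rdeg_gt0 n (D : dissection n) : (0 < rdeg D) = (0 < n).
Proof.
case: n D => [|n] D; first by rewrite rdeg0.
have [j h] := root_neighbor D; have jn := nadj_bound h.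
have lt : j < n.+2 by lia.
by apply/card_gt0P; exists (Ordinal lt); rewrite inE -(nadj_ord _ ord0).
Qed.

Section ChordRev.
Variables (n : nat) (E : dissection n) (e : chord n).
Hypothesis eE : e \in chords E.
Let oE : ordered E. Proof. by case: (dissectionP E). Qed.

(** Cutting [e] alone can only move the outer side [b] backwards. So the only possible reversal is
    that of a chord pointing to [e.1], where [b] passes from after [e.1] to before it; nothing is
    before [e.1] when it is the root. *)
Lemma krev1_eq0 : points_to E e.1 e.2 || (e.1 == ord0) -> krev E [set e] = 0.
Proof.
have C1 : [set e] \subset chords E by rewrite sub1set.
have [a [b [ea eb sf]]] : exists a b, [/\ beyond e a,
  ~~ beyond e b & same_face (chords E :\ e) a b].
  have [_ _ _ es] := dissectionP E; have [s [t [_ _]]] := es _ eE.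
  rewrite separatesE; case es1: (beyond e s) => et sf; [exists s, t|exists t, s].
    by split=> //; move: et; case: beyond.
  by rewrite es1 same_face_sym; split=> //; move: et; case: beyond.
have sep : separates e a b by rewrite separatesE ea (negbTE eb).
move=> h; rewrite krevE // big_set1 (chord_revE C1 _ sep sf (w := e.1)) ?set11 ?eqxx //.
have r1 s : beyond e (rep [set e] s) = beyond e s.
  by have [/same_faceP h' _] := repP [set e] s; rewrite -h' ?set11.
rewrite !between_beyond ?r1 //.
have rb : rep [set e] b <= b by rewrite rep_le ?same_face_refl.
have : (b < e.1) || (e.1 == ord0).
  move: h; have eM := mkchordE (oE eE); rewrite (points_to_between (a := a) (b := b)) ?eM //.
  by rewrite between_beyond.
by rewrite -val_eqE /=; lia.
Qed.

End ChordRev.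

(** * Comparison of the coefficients *)

Section Coefficients.
Variables (K : fieldType) (charK0 : [pchar K]%R =i pred0) (x : K).
Variables (n : nat) (E : dissection n) (p q : nat) (X : dissection p) (Y : dissection q).
Local Notation T := (split_coef x (mon X) (mon Y) (chords E)).
Let oE : ordered E. Proof. by case: (dissectionP E). Qed.

Definition cuts (e : chord n) (X' Y' : {cmonom ndiagram}) :=
  (set_mon (piece E e true) == X') && (set_mon (piece E e false) == Y').

Lemma split_term (e : chord n) : (x ^+ krev E [set e] *
    (ind K (set_mon (piece E e true)) (mon X) * ind K (set_mon (piece E e false)) (mon Y) +
     ind K (set_mon (piece E e true)) (mon Y) * ind K (set_mon (piece E e false)) (mon X))
  = x ^+ krev E [set e] * (cuts e (mon X) (mon Y) + cuts e (mon Y) (mon X))%:R)%R.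
Proof.
rewrite /cuts /ind natrD.
by do 4!case: (_ == _); rewrite ?mulr1 ?mulr0.
Qed.

Lemma split_coef_ex : T != 0%R -> exists2 e : chord n, e \in chords E &
  cuts e (mon X) (mon Y) || cuts e (mon Y) (mon X).
Proof.
move=> nz; apply/exists_inP; apply: contraNT nz => /exists_inPn h.
rewrite /split_coef big1 // => e eE; rewrite split_term.
by have /norP[/negbTE -> /negbTE ->] := h e eE; rewrite mulr0.
Qed.

(** All powers of x being 1, the coefficient is a positive integer, hence nonzero in characteristic
    0. *)
Lemma split_coef_neq0 :
  (forall e : chord n, e \in chords E -> cuts e (mon X) (mon Y) || cuts e (mon Y) (mon X) ->
     krev E [set e] = 0) ->
  (exists2 e : chord n, e \in chords E & cuts e (mon X) (mon Y) ||
    cuts e (mon Y) (mon X)) -> T != 0%R.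
Proof.
move=> k0 [e eE ce]; rewrite /split_coef.
rewrite (eq_bigr (fun e => (cuts e (mon X) (mon Y) + cuts e (mon Y) (mon X))%:R%R)); last first.
  move=> d dE; rewrite split_term; case c1: (cuts d (mon X) (mon Y) || cuts d (mon Y) (mon X)).
    by rewrite k0 // expr0 mul1r.
  by move/norP: (negbT c1) => [/negbTE -> /negbTE ->]; rewrite mulr0.
rewrite -natr_sum; move/pcharf0P: charK0 => ->; rewrite -lt0n (bigD1 e) //=.
by rewrite addn_gt0; move: ce; do 2!case: cuts.
Qed.

End Coefficients.

Section RootCoefficients.
Variables (K : fieldType) (charK0 : [pchar K]%R =i pred0) (x : K).
Variables (n : nat) (E : dissection n) (p q : nat) (X : dissection p) (Y : dissection q).
Local Notation T := (split_coef x (mon X) (mon Y) (chords E)).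

Lemma cuts_root (e : chord n) p' q' (X' : dissection p') (Y' : dissection q') : e \in chords E ->
  cuts E e (mon X') (mon Y') ->
  e.1 = ord0 /\ root_split E e.2 X' Y' \/ 0 < e.1 /\ rdeg E <= rdeg Y'.
Proof.
move=> eE /andP[/eqP h1 /eqP h2]; have [e0|e0] := posnP e.1.
  have {}e0 : e.1 = ord0 by apply: val_inj.
  by left; split=> //; apply: root_split_piece.
right; split=> //; have le := nonroot_rdeg eE e0.
by rewrite -(rdeg_set_mon (D := Dissection (half_dissection eE false)) (E := Y')) // -set_monE.
Qed.

Lemma split_root_ex : T != 0%R -> rdeg X < rdeg E -> rdeg Y < rdeg E ->
  exists v, root_split E v X Y \/ root_split E v Y X.
Proof.
move=> /split_coef_ex[e eE /orP[]] /(cuts_root eE)[[_ h]|[_ h]] rX rY; try lia.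
  by exists e.2; left.
by exists e.2; right.
Qed.

Lemma rdeg_root_split v p' q' (X' : dissection p') (Y' : dissection q') :
  root_split E v X' Y' -> rdeg E <= rdeg X' + rdeg Y' + 1.
Proof. by move=> /rdeg_split ->; apply: leq_addr. Qed.

Lemma split_rdeg_le : T != 0%R -> rdeg E <= rdeg X + rdeg Y + 1.
Proof.
move=> /split_coef_ex[e eE /orP[]] /(cuts_root eE)[[_ /rdeg_root_split]|[_]]; lia.
Qed.

(** The degree bounds leave only chords at the root as contributors, and these are never
    reversed. *)
Lemma root_split_neq0 v : root_split E v X Y -> rdeg X < rdeg E -> rdeg Y < rdeg E -> T != 0%R.
Proof.
move=> sE rX rY; apply: (split_coef_neq0 charK0).
  move=> e eE /orP[] /(cuts_root eE)[[e1 _]|[_]]; try lia;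
    by apply: krev1_eq0; rewrite // e1 eqxx orbT.
have [e [eE _ _ h1 h2]] := piece_root_split sE.
by exists e => //; rewrite /cuts h1 h2 !eqxx.
Qed.

End RootCoefficients.

Section LeafSplit.
Variable n : nat.

(* G is the concatenation at the root of X, the leaf v, and Y. *)
Definition leaf_split (G : dissection n) v p (X : dissection p) q (Y : dissection q) :=
  root_split G v X Y /\ forall j, nadj G v j = (j == 0).

Variables (p q : nat) (X : dissection p) (Y : dissection q).

Lemma leaf_split_uniq G G' v v' : leaf_split G v X Y -> leaf_split G' v' X Y -> G = G' /\ v = v'.
Proof.
move=> [s l] [s' l']; have vv : v = v' by case: s s' => _ -> _ _ _ [_ ->].
by subst v'; split=> //; apply: root_split_uniq s s' _ => j; rewrite l l'.
Qed.

Lemma leaf_root G v : leaf_split G v X Y -> forall j, 0 < j ->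
  nadj G 0 j = (j == v) || (if j < v then nadj X 0 j else nadj Y 0 (j - v)).
Proof. by move=> [s l] j j0; rewrite (split_root s) l -lt0n j0. Qed.

Lemma rdeg_leaf G v : leaf_split G v X Y -> rdeg G = rdeg X + rdeg Y + 1.
Proof.
move=> [s l]; rewrite (rdeg_split s) big_nat big1 ?addn0 // => j /andP[j0 _].
by rewrite l eqn0Ngt j0.
Qed.

Lemma root_split_leaf (E : dissection n) v : root_split E v X Y -> rdeg E = rdeg X + rdeg Y + 1 ->
  leaf_split E v X Y.
Proof.
move=> s r; split=> // j; have [->|j0] := posnP j; first by rewrite nadjC; case: s.
apply/negbTE/negP => vj; have := rdeg_split s; have := nadj_bound vj => jn.
rewrite r (bigD1_seq j) ?iota_uniq ?mem_index_iota //=; last by lia.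
by rewrite vj; lia.
Qed.

Lemma root_split_one (E : dissection n) v : root_split E v X Y -> rdeg E = rdeg X + rdeg Y ->
  exists2 w, w != 0 & forall j, nadj E v j = (j == 0) || (j == w).
Proof.
move=> s r; have v0 : nadj E v 0 by rewrite nadjC; case: s.
have S1 : \sum_(1 <= j < n.+1) nadj E v j = 1 by have := rdeg_split s; rewrite r; lia.
have : exists2 w, 0 < w & nadj E v w.
  case: (boolP (has (fun j => nadj E v j) (index_iota 1 n.+1))) => [/hasP[w]|/hasPn h].
    by rewrite mem_index_iota => /andP[w0 _] vw; exists w.
  by move: S1; rewrite big_seq big1 // => j /h /negbTE ->.
case=> w w0 vw; exists w; first by rewrite -lt0n.
move=> j; have [->|j0] := posnP j; first by rewrite v0.
have [->|jw] := eqVneq j w; first by rewrite vw orbT.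
apply/negbTE/negP => vj.
have jn := nadj_bound vj; have wn := nadj_bound vw.
have : \sum_(1 <= k < n.+1) nadj E v k >= \sum_(1 <= k < n.+1) ((k == j) + (k == w)).
  apply: leq_sum => k _; have [->|_] := eqVneq k j; first by rewrite (negbTE jw) vj.
  by case: eqP => [->|//]; rewrite vw.
rewrite S1 big_split /=.
have one k : 0 < k <= n -> \sum_(1 <= l < n.+1) (l == k) = 1.
  move=> kn; rewrite -big_mkcond /= sum1_count /index_iota.
  rewrite (eq_count (a2 := pred1 k)) // count_uniq_mem ?iota_uniq // mem_iota; lia.
by rewrite !one; lia.
Qed.

Lemma rdeg_one (E : dissection n) v w : root_split E v X Y -> w != 0 -> w <= n ->
  (forall j, nadj E v j = (j == 0) || (j == w)) -> rdeg E = rdeg X + rdeg Y.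
Proof.
move=> s w0 wn h; have := rdeg_split s.
rewrite big_nat (eq_bigr (fun j => (j == w) : nat)) => [|j /andP[j0 _]]; last first.
  by rewrite h eqn0Ngt j0.
rewrite -big_nat -big_mkcond /= sum1_count /index_iota.
rewrite (eq_count (a2 := pred1 w)) // count_uniq_mem ?iota_uniq // mem_iota; lia.
Qed.

End LeafSplit.

Lemma leaf_split_ex n p q (X : dissection p) (Y : dissection q) : n = (p + q).+1 ->
  exists G : dissection n, leaf_split G p.+1 X Y.
Proof.
move=> nE; subst n; exists (glue X Y); split; [exact: glue_split|exact: glue_leaf].
Qed.

Lemma root_split_inj n (E : dissection n) v p q r s (X : dissection p) (Y : dissection q)
    (Z : dissection r) (W : dissection s) : root_split E v X Y -> root_split E v Z W ->
  mon X = mon Z /\ mon Y = mon W.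
Proof.
case=> _ vp nq hX hY [_ vr ns hZ hW]; split; apply: nadj_mon; try lia.
  by move=> i j; rewrite hX hZ.
by move=> i j; rewrite hY hW.
Qed.

(** * Pairs of factors with the same coefficients *)

Section Same.
Variables (K : fieldType) (charK0 : [pchar K]%R =i pred0) (x : K).

(** Factors of degree 0 are allowed, so that L of a single diagram is covered too. Only diagrams of
    positive degree are tested, since only these index the basis. *)
Definition same_coef p q r s (X : dissection p) (Y : dissection q)
    (Z : dissection r) (W : dissection s) :=
  forall n (E : dissection n.+1), split_coef x (mon X) (mon Y) (chords E) =
                                  split_coef x (mon Z) (mon W) (chords E).

Lemma split_coefC m1 m2 n (E : {set chord n}) : split_coef x m1 m2 E = split_coef x m2 m1 E.
Proof. by apply: eq_bigr => e _; congr (_ * _)%R; apply: addrC. Qed.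

Lemma same_coef_sym p q r s (X : dissection p) (Y : dissection q)
    (Z : dissection r) (W : dissection s) : same_coef X Y Z W -> same_coef Z W X Y.
Proof. by move=> h n E; rewrite h. Qed.

Lemma same_coefl p q r s (X : dissection p) (Y : dissection q)
    (Z : dissection r) (W : dissection s) : same_coef X Y Z W -> same_coef Y X Z W.
Proof. by move=> h n E; rewrite split_coefC h. Qed.

Lemma same_coefr p q r s (X : dissection p) (Y : dissection q)
    (Z : dissection r) (W : dissection s) : same_coef X Y Z W -> same_coef X Y W Z.
Proof. by move=> h n E; rewrite h split_coefC. Qed.

Lemma same_rdeg_le p q r s (X : dissection p) (Y : dissection q)
    (Z : dissection r) (W : dissection s) : same_coef X Y Z W ->
  rdeg X + rdeg Y <= rdeg Z + rdeg W.
Proof.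
move=> h; have [G lG] := leaf_split_ex X Y (erefl _); have rG := rdeg_leaf lG.
have : split_coef x (mon X) (mon Y) (chords G) != 0%R.
  by case: lG => sG _; apply: root_split_neq0 sG _ _ => //; lia.
by rewrite h => /split_rdeg_le; lia.
Qed.

Lemma same_rdeg p q r s (X : dissection p) (Y : dissection q)
    (Z : dissection r) (W : dissection s) : same_coef X Y Z W ->
  rdeg X + rdeg Y = rdeg Z + rdeg W.
Proof.
move=> h; apply/eqP; rewrite eqn_leq (same_rdeg_le h) /=.
exact: same_rdeg_le (same_coef_sym h).
Qed.

Lemma same_root_split p q r s (X : dissection p) (Y : dissection q)
    (Z : dissection r) (W : dissection s) n (E : dissection n) v :
  same_coef X Y Z W -> root_split E v X Y ->
  rdeg X < rdeg E -> rdeg Y < rdeg E -> rdeg Z < rdeg E -> rdeg W < rdeg E ->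
  exists u, root_split E u Z W \/ root_split E u W Z.
Proof.
move=> h sE rX rY rZ rW; have := root_split_neq0 charK0 x sE rX rY.
have [_ _ nE _ _] := sE; move: E sE rX rY rZ rW; rewrite nE => E sE rX rY rZ rW.
by rewrite h => /split_root_ex; apply.
Qed.

Lemma same_leaf_split p q r s (X : dissection p) (Y : dissection q)
    (Z : dissection r) (W : dissection s) n (G : dissection n) v :
  same_coef X Y Z W -> leaf_split G v X Y ->
  exists u, leaf_split G u Z W \/ leaf_split G u W Z.
Proof.
move=> h lG; have rG := rdeg_leaf lG; have rXY := same_rdeg h; have [sG _] := lG.
have [||||u [s'|s']] := same_root_split h sG; try lia.
  by exists u; left; apply: root_split_leaf => //; lia.
by exists u; right; apply: root_split_leaf => //; lia.
Qed.

(** The two concatenations on either side are exactly the diagrams of maximal root degree with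
    nonzero coefficient, hence form the same set. *)
Lemma same_leaf_splits p q r s (X : dissection p) (Y : dissection q)
    (Z : dissection r) (W : dissection s) : same_coef X Y Z W ->
  exists (G G' : dissection (p + q).+1),
    [/\ leaf_split G p.+1 X Y, leaf_split G' q.+1 Y X &
      leaf_split G r.+1 Z W /\ leaf_split G' s.+1 W Z \/
      leaf_split G s.+1 W Z /\ leaf_split G' r.+1 Z W].
Proof.
move=> h; have [G lG] := leaf_split_ex X Y (erefl _).
have [G' lG'] := @leaf_split_ex (p + q).+1 _ _ Y X (congr1 S (addnC p q)).
have pqrs : p + q = r + s.
  by have [u [[[_ _ e _ _] _]|[[_ _ e _ _] _]]] := same_leaf_split h lG; lia.
have [Q lQ] := leaf_split_ex Z W (congr1 S pqrs).
have [Q' lQ'] := @leaf_split_ex (p + q).+1 _ _ W Z (congr1 S (etrans pqrs (addnC r s))).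
have h' := same_coef_sym h.
have dec H u : leaf_split H u Z W \/ leaf_split H u W Z -> H = Q \/ H = Q'.
  by case=> l; [left; case: (leaf_split_uniq l lQ)|right; case: (leaf_split_uniq l lQ')].
have dec' H u : leaf_split H u X Y \/ leaf_split H u Y X -> H = G \/ H = G'.
  by case=> l; [left; case: (leaf_split_uniq l lG)|right; case: (leaf_split_uniq l lG')].
have [u /dec GQ] := same_leaf_split h lG.
have [u' /dec GQ'] := same_leaf_split (same_coefl h) lG'.
have [w /dec' QG] := same_leaf_split h' lQ.
have [w' /dec' QG'] := same_leaf_split (same_coefl h') lQ'.
(* Both inclusions enter: one alone would allow [G = G' = Q] with a different [Q']. *)
have e : (G = Q /\ G' = Q') \/ (G = Q' /\ G' = Q).
  by case: GQ GQ' QG QG' => [?|?] [?|?] [?|?] [?|?]; subst; auto.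
by exists G, G'; split=> //; case: e => [[-> ->]|[-> ->]]; [left|right].
Qed.

Lemma last_root n (G : dissection n) v : (exists2 j, nadj G 0 j & j < v) ->
  exists w, [/\ nadj G 0 w, w < v & forall k, w < k < v -> ~~ nadj G 0 k].
Proof.
case=> j j0 jv; have ex : exists j, nadj G 0 j && (j < v) by exists j; rewrite j0.
have ub k : nadj G 0 k && (k < v) -> k <= v by case/andP=> _ /ltnW.
case: (ex_maxnP ex ub) => w /andP[w0 wv] max; exists w; split=> // k /andP[wk kv].
by apply/negP => k0; have := max k; rewrite k0 kv leqNgt wk => /(_ isT).
Qed.

Lemma first_root n (G : dissection n) v : (exists2 j, nadj G 0 j & v < j) ->
  exists w, [/\ nadj G 0 w, v < w & forall k, v < k < w -> ~~ nadj G 0 k].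
Proof.
case=> j j0 jv; have ex : exists j, nadj G 0 j && (v < j) by exists j; rewrite j0.
case: (ex_minnP ex) => w /andP[w0 wv] min; exists w; split=> // k /andP[vk kw].
by apply/negP => k0; have := min k; rewrite k0 vk leqNgt kw => /(_ isT).
Qed.

Lemma leaf_root_inner n (G : dissection n) v p q (X : dissection p) (Y : dissection q) :
  leaf_split G v X Y -> 0 < p -> exists2 j, nadj G 0 j & j < v.
Proof.
move=> lG; case: p X lG => // p X lG _; have [j Xj] := root_neighbor X.
have := nadj_bound Xj; have [[_ vp _ _ _] _] := lG => jb.
by exists j; [rewrite (leaf_root lG) ?Xj; [case: ifP; rewrite ?orbT //|]|]; lia.
Qed.

Lemma leaf_root_outer n (G : dissection n) v p q (X : dissection p) (Y : dissection q) :
  leaf_split G v X Y -> 0 < q -> exists2 j, nadj G 0 j & v < j.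
Proof.
move=> lG; case: q Y lG => // q Y lG _; have [j Yj] := root_neighbor Y.
have := nadj_bound Yj => jb; exists (j + v); last by lia.
rewrite (leaf_root lG); last by lia.
have -> : (j + v < v) = false by lia.
by rewrite addnK Yj orbT.
Qed.

(* The root neighbour w is moved from the root to the leaf v. *)
Lemma same_swap p q r s (X : dissection p) (Y : dissection q)
    (Z : dissection r) (W : dissection s) n (G G' : dissection n) v u u' w :
  same_coef X Y Z W -> 0 < p -> 0 < q -> 0 < r -> 0 < s ->
  leaf_split G v X Y -> leaf_split G u Z W -> leaf_split G' u' W Z -> v != u ->
  nadj G 0 w -> v != w -> (forall k, minn v w < k < maxn v w -> ~~ nadj G 0 k) ->
  exists E : dissection n, exists z, [/\ root_split E v X Y, root_split E u' W Z,
    nadj G' 0 z, forall i j, nadj E i j = swap_adj G v w i j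
    & forall i j, nadj E i j = swap_adj G' u' z i j].
Proof.
move=> h p0 q0 r0 s0 lG lGu lG' vu w0 vw cons;
  have [[sG lv] [sGu lu] [sG' lu']] := And3 lG lGu lG'.
have v0 : nadj G 0 v by case: sG.
have [E hE] := swap_dissection v0 w0 vw cons.
have wv : w != v by rewrite eq_sym.
have [sE Ev] := swap_split sG lv wv w0 hE.
have wb := nadj_bound w0.
have rE := rdeg_one sE (_ : w != 0) (_ : w <= n) Ev.
have {}rE : rdeg E = rdeg X + rdeg Y by apply: rE; lia.
have rXY := same_rdeg h; have := (rdeg_gt0 X, rdeg_gt0 Y); have := (rdeg_gt0 Z, rdeg_gt0 W).
rewrite p0 q0 r0 s0 => -[rZ rW] [rX rY].
have nw0 : nadj E 0 w = false by rewrite hE /swap_adj !eqxx andbF /=; move/nadj_bound: v0; lia.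
have vw1 : nadj E v w by rewrite Ev eqxx orbT.
have [||||t [sE'|sE']] := same_root_split h sE; try lia.
  (* If E split at [u], the neighbour moved onto [u] would have to be [w], the root neighbour lost
     by E; but [w] hangs on [v], which differs from [u]. *)
  have tu : t = u by case: sE' sGu => _ -> _ _ _ [_ -> _ _ _].
  subst t; have [z z0 Eu] := root_split_one sE' (etrans rE rXY).
  have [zu Gz hE'] := split_swap sGu lu sE' z0 Eu.
  have ub := nadj_bound (_ : nadj G 0 u); have {}ub := ub ltac:(by case: sGu).
  have wz : w = z.
    by move: nw0; rewrite hE' /swap_adj w0; move: ub wb z0; lia.
  by move: vw1; rewrite hE' /swap_adj lv; move: ub wb z0 vu vw; lia.
have tu : t = u' by case: sE' sG' => _ -> _ _ _ [_ -> _ _ _].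
subst t; have [z z0 Eu] := root_split_one sE' (etrans rE (etrans rXY (addnC _ _))).
have [zu Gz hE'] := split_swap sG' lu' sE' z0 Eu.
by exists E, z.
Qed.

(** If the leaves [v] and [u] differ, the two diagrams E and F obtained from G by moving onto [v]
    the root neighbour before or after it must both arise from G' in the same way. Two such
    witnesses pin down the leaf of G' as [v], and then E splits at [v] both as X, Y and as W, Z. *)
Lemma same_nonempty p q r s (X : dissection p) (Y : dissection q)
    (Z : dissection r) (W : dissection s) n (G G' : dissection n) v u u' :
  same_coef X Y Z W -> 0 < p -> 0 < q -> 0 < r -> 0 < s ->
  leaf_split G v X Y -> leaf_split G u Z W -> leaf_split G' u' W Z ->
  mon X = mon Z /\ mon Y = mon W \/ mon X = mon W /\ mon Y = mon Z.
Proof.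
move=> h p0 q0 r0 s0 lG lGu lG'.
have [vu|vu] := eqVneq v u.
  left; case: lG lGu => sG _ [sGu _]; rewrite -vu in sGu; exact: root_split_inj sG sGu.
have [w [w0 wv wc]] := last_root (leaf_root_inner lG p0).
have [w' [w0' vw' wc']] := first_root (leaf_root_outer lG q0).
have v0 : nadj G 0 v by case: lG => -[].
have [E [z [sE sE' z0 hE hE']]] : exists E : dissection n, exists z,
  [/\ root_split E v X Y, root_split E u' W Z,
    nadj G' 0 z, forall i j, nadj E i j = swap_adj G v w i j
    & forall i j, nadj E i j = swap_adj G' u' z i j].
  apply: (same_swap h p0 q0 r0 s0 lG lGu lG' vu w0); first by lia.
  by move=> k kvw; apply: wc; lia.
have [F [z' [sF sF' z0' hF hF']]] : exists E : dissection n, exists z,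
  [/\ root_split E v X Y, root_split E u' W Z,
    nadj G' 0 z, forall i j, nadj E i j = swap_adj G v w' i j
    & forall i j, nadj E i j = swap_adj G' u' z i j].
  apply: (same_swap h p0 q0 r0 s0 lG lGu lG' vu w0'); first by lia.
  by move=> k kvw; apply: wc'; lia.
have [[_ vp _ _ _] _] := lG; have [[_ up _ _ _] _] := lG'.
have rootE k : nadj G 0 k && (k != w) = nadj G' 0 k && (k != z).
  have := hE' 0 k; rewrite hE /swap_adj; have := nadj_bound z0; have := nadj_bound w0.
  by move: vp up; case: (nadj G 0 k); case: (nadj G' 0 k); lia.
have rootF k : nadj G 0 k && (k != w') = nadj G' 0 k && (k != z').
  have := hF' 0 k; rewrite hF /swap_adj; have := nadj_bound z0'; have := nadj_bound w0'.
  by move: vp up; case: (nadj G 0 k); case: (nadj G' 0 k); lia.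
(* Only [w'] leaves the root of G in F, so [w] is still a root neighbour of F and hence of G'. As E
   has lost [w], the neighbour moved in G' is [w] itself. *)
have G'w : nadj G' 0 w.
  by have := rootF w; rewrite w0; case: (nadj G' 0 w) => //=; lia.
have wz : w = z by have := rootE w; rewrite w0 G'w eqxx /=; lia.
have G'v : nadj G' 0 v.
  by have := rootE v; rewrite v0; case: (nadj G' 0 v) => //=; lia.
have uv : v = u'.
  (* The chord {v, w} of E is not in G', where it would close a triangle with the root; so it is the
     one created by the move, and [v] is the leaf [u']. *)
  have : nadj E v w by rewrite hE /swap_adj !eqxx orbT.
  rewrite hE' -wz /swap_adj; case Gvw: (nadj G' v w); last by lia.
  by case: (no_triangle G'v Gvw G'w).
right; rewrite -uv in sE'; exact: root_split_inj sE sE'.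
Qed.

Lemma same_coef_eq p q r s (X : dissection p) (Y : dissection q)
    (Z : dissection r) (W : dissection s) :
  same_coef X Y Z W -> 0 < p -> 0 < q -> 0 < r -> 0 < s ->
  mon X = mon Z /\ mon Y = mon W \/ mon X = mon W /\ mon Y = mon Z.
Proof.
move=> h p0 q0 r0 s0; have [G [G' [lG lG' [[l1 l2]|[l1 l2]]]]] := same_leaf_splits h.
  exact: same_nonempty h p0 q0 r0 s0 lG l1 l2.
by case: (same_nonempty (same_coefr h) p0 q0 s0 r0 lG l1 l2); [right|left].
Qed.

End Same.

Lemma cuts_degree n (E : dissection n) (e : chord n) p q (X : dissection p) (Y : dissection q) :
  e \in chords E -> cuts E e (mon X) (mon Y) -> (e.2 - e.1).-1 = p /\ n - (e.2 - e.1) = q.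
Proof.
move=> eE /andP[/eqP h1 /eqP h2]; have [oE _ _ _] := dissectionP E; have lt := oE _ eE.
have := set_monE (Dissection (half_dissection eE true)); rewrite /= h1 => /(congr1 wdeg).
rewrite !wdeg_mon card_inner // => ->.
have := set_monE (Dissection (half_dissection eE false)); rewrite /= h2 => /(congr1 wdeg).
rewrite !wdeg_mon card_outer // => ->; split=> //.
by have := ltn_ord e.2; move: lt; lia.
Qed.

(** * A single diagram against a product *)

Section Single.
Variables (K : fieldType) (charK0 : [pchar K]%R =i pred0) (x : K).

Lemma same_neq0 p q r s (X : dissection p) (Y : dissection q)
    (Z : dissection r) (W : dissection s) n (E : dissection n) :
  same_coef x X Y Z W -> 0 < n -> split_coef x (mon X) (mon Y) (chords E) != 0%R ->
  split_coef x (mon Z) (mon W) (chords E) != 0%R.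
Proof. by case: n E => // n E h _; rewrite h. Qed.

Lemma same_cuts p q r s (X : dissection p) (Y : dissection q)
    (Z : dissection r) (W : dissection s) n (E : dissection n) v :
  same_coef x X Y Z W -> root_split E v X Y -> rdeg X < rdeg E -> rdeg Y < rdeg E ->
  exists2 e : chord n, e \in chords E & cuts E e (mon Z) (mon W) || cuts E e (mon W) (mon Z).
Proof.
move=> h sE rX rY; have := root_split_neq0 charK0 x sE rX rY.
by move/(same_neq0 h) => H; apply: (split_coef_ex (x := x)); apply: H;
  case: sE => _ _ nE _ _; lia.
Qed.

Definition star n (D : dissection n) := forall j, 0 < j <= n -> nadj D 0 j.

Variables (d r s : nat) (D : dissection d) (O : dissection 0) (Z : dissection r) (
  W : dissection s).
Hypotheses (h : same_coef x D O Z W) (r0 : 0 < r) (s0 : 0 < s).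
Let rO := rdeg0 O.
Let rD : rdeg D = rdeg Z + rdeg W. Proof. by have := same_rdeg charK0 h; rewrite rO; lia. Qed.
Let rZ : 0 < rdeg Z. Proof. by rewrite rdeg_gt0. Qed.
Let rW : 0 < rdeg W. Proof. by rewrite rdeg_gt0. Qed.

Variable n : nat.
Variables (G G' : dissection n).
Hypotheses (lG : leaf_split G d.+1 D O) (lGu : leaf_split G r.+1 Z W).
Hypotheses (lG' : leaf_split G' 1 O D) (lGu' : leaf_split G' s.+1 W Z).

Let nd : n = d.+1. Proof. by case: lG => -[_ _ e _ _] _; lia. Qed.
Let drs : d = r + s. Proof. by case: lGu => -[_ _ e _ _] _; lia. Qed.

Let rootG j : 0 < j -> nadj G 0 j = (j == d.+1) || nadj D 0 j.
Proof.
move=> j0; rewrite (leaf_root lG) //; case: (ltngtP j d.+1) => //= jd.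
have -> : nadj D 0 j = false by apply/negbTE/negP => /nadj_bound; lia.
by apply/negbTE/negP => /nadj_bound; lia.
Qed.

Let rootG' j : nadj G' 0 j.+2 = nadj D 0 j.+1.
Proof. by rewrite (leaf_root lG') // subSS subn0. Qed.

(** Moving the root neighbour [w] which precedes the leaf [r.+1] of Z.a.W onto that leaf gives a
    diagram E of L(ZW) with the root degree of D. As E also occurs in L(D), some chord [e] of E has
    D as one of its pieces, and each position of [e] is either impossible or propagates root
    neighbours of D. *)
Lemma root_run : exists2 w, w <= r & forall j, w <= j <= d -> nadj D 0 j.
Proof.
have [sGu lu] := lGu; have u0 : nadj G 0 r.+1 by case: sGu.
have [w [w0 wu wc]] := last_root (leaf_root_inner lGu r0).
have wb := nadj_bound w0; exists w; first by lia.
have [||E hE] := @swap_dissection _ G r.+1 w u0 w0; first by lia.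
  by move=> k kw; apply: wc; lia.
have wne : w != r.+1 by lia.
have [sE Eu] := swap_split sGu lu wne w0 hE.
have rE : rdeg E = rdeg Z + rdeg W by apply: (rdeg_one sE _ _ Eu); lia.
have Dw : nadj D 0 w by move: w0; rewrite rootG; lia.
have rootE j : nadj E 0 j = nadj G 0 j && (j != w).
  by rewrite hE /swap_adj; move: wb; case: (nadj G 0 j); lia.
have Ed : nadj E 0 d.+1 by rewrite rootE rootG // eqxx /=; lia.
have [||e eE ce] := same_cuts (same_coef_sym h) sE; try lia.
have [oE _ _ _] := dissectionP E; have lt_e := oE _ eE; have e2n := ltn_ord e.2.
(* If D is the inner piece, [e] is {0, d.+1}, because [O] has root degree 0. The vertex [w] is
   joined to the root in D but not in E, so {w, d.+1} is a chord of E, and it crosses {0, r.+1}. *)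
case/orP: ce => ce; have [dc1 dc2] := cuts_degree eE ce.
  case: (cuts_root eE ce) => [[_ sE']|]; last by lia.
  have e2 : e.2 = d.+1 :> nat by case: sE' => _ ->.
  have := split_root_inner sE' (j := w); rewrite Dw rootE eqxx andbF /= e2.
  have wpos : 0 < w < d.+1 by lia.
  move=> /(_ wpos)/esym; rewrite nadjC => wd.
  have Eu0 : nadj E 0 r.+1 by case: sE.
  by case: (nadj_nocross (D := E) (i := 0) (j := r.+1) (k := w) (l := d.+1)); rewrite ?wd //; lia.
(* Now D is the outer piece. If [e] is {0, 1}, contracting it lowers root neighbours by one, and the
   run spreads from [d] down to [w]. *)
case: (cuts_root eE ce) => [[_ sE']|[e1 _]].
  have e2 : e.2 = 1 :> nat by case: sE' => _ ->.
  have shift j : 1 < j -> nadj E 0 j -> nadj D 0 j.-1.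
    move=> j1 Ej; have := split_root_outer sE' (j := j); rewrite e2 => /(_ j1).
    by rewrite Ej subn1.
  have down k : w <= d - k -> nadj D 0 (d - k).
    elim: k => [|k IH] wk; first by rewrite subn0; apply: (shift d.+1) => //; lia.
    have Dk : nadj D 0 (d - k) by apply: IH; lia.
    have -> : d - k.+1 = (d - k).-1 by lia.
    have := nadj_bound Dk => dkb.
    by apply: shift; [lia|rewrite rootE rootG ?Dk ?orbT /=; lia].
  by move=> j jw; rewrite (_ : j = d - (d - j)); [apply: down|]; lia.
(* If [e] is away from the root, its ends are consecutive, and equality of the root degrees makes
   every root neighbour of D the image of one of E. As [w] is not joined to the root in E, it comes
   from [w.+1], and the run spreads upwards from [w]. *)
have inv j : nadj D 0 j -> exists2 i, nadj E 0 i & j = skip_vertex e i.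
  have pE : set_mon (piece E e false) = mon D by case/andP: ce => _ /eqP.
  have pD := (set_mon_nadj (Dissection (half_dissection eE false)) D).1.
  rewrite /= set_monE pE in pD; have [_ hD] := pD erefl.
  rewrite -hD; apply: nonroot_nadj_inv => //.
  rewrite (rdeg_set_mon (D := Dissection (half_dissection eE false)) (E := D)) ?rE ?rD //.
  by rewrite -set_monE.
have next j : w <= j -> nadj D 0 j -> e.1 <= w -> nadj E 0 j.+1.
  move=> wj /inv[i Ei]; rewrite /skip_vertex; case: ifP => ie ji ew.
    by move: Ei; rewrite rootE; lia.
  by rewrite (_ : j.+1 = i) //; lia.
have ew : e.1 <= w.
  have [i Ei] := inv _ Dw; rewrite /skip_vertex; case: ifP => ie wi; last by lia.
  by move: Ei; rewrite -wi rootE eqxx andbF.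
have up k : w + k <= d -> nadj D 0 (w + k).
  elim: k => [|k IH] wk; first by rewrite addn0.
  have Dk : nadj D 0 (w + k) by apply: IH; lia.
  have := next _ (leq_addr _ _) Dk ew; rewrite rootE rootG // addnS => /andP[/orP[/eqP|//]]; lia.
by move=> j jw; rewrite (_ : j = w + (j - w)); [apply: up|]; lia.
Qed.

Lemma star_W : star W.
Proof.
have [w wr run] := root_run; move=> j js; have [sGu lu] := lGu.
have := split_root_outer sGu (j := j + r.+1); rewrite addnK lu.
move=> ->; last by lia.
rewrite rootG; last by lia.
have [//|ne] := eqVneq (j + r.+1) d.+1; rewrite run //; lia.
Qed.

(** The root neighbours of a.D are those of D raised by one. Reading D.a as Z.a.W and a.D as W.a.Z,
    vertex [j] of Z corresponds to vertex [j.+1] of W.a.Z: this lies in the star W, is the leaf, or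
    is vertex [j - s] of Z. *)
Lemma star_Z : star Z.
Proof.
move=> j; have [m] := ubnP j; elim: m j => // m IH j; rewrite ltnS => jm jr.
have Zj : nadj Z 0 j = nadj G 0 j.
  rewrite (leaf_root lGu); last by lia.
  by have [-> ->] : (j == r.+1) = false /\ j < r.+1 by lia.
rewrite Zj rootG; last by lia.
apply/orP; right; case: j jm jr {Zj} => // j jm jr; rewrite -rootG' (leaf_root lGu') //.
case: (ltngtP j.+2 s.+1) => //= js.
  by apply: star_W; lia.
by rewrite subSS; apply: IH; lia.
Qed.

Lemma star_D : star D.
Proof.
move=> j jd; have := rootG (j := j); rewrite (leaf_root lGu); last by lia.
have -> : (j == d.+1) = false by lia.
rewrite /= => <-; last by lia.
case: (ltngtP j r.+1) => //= jr; [apply: star_Z|apply: star_W]; lia.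
Qed.

(** The witness E is the star D.a with {0, d} replaced by {d, d.+1}. Its root degree is only that of
    D, so chords away from the root may contribute to L(D) and their orientation has to be
    checked. *)
Lemma not_same_single : False.
Proof.
have d0 : 0 < d by lia.
have [sG lv] := lG; have v0 : nadj G 0 d.+1 by case: sG.
have w0 : nadj G 0 d by rewrite rootG // star_D ?orbT //; lia.
have [||E hE] := @swap_dissection _ G d.+1 d v0 w0; first by lia.
  by move=> k; lia.
have dne : d != d.+1 by lia.
have [sE Ev] := swap_split sG lv dne w0 hE.
have rE : rdeg E = rdeg D + rdeg O by apply: (rdeg_one sE _ _ Ev); lia.
have rootE j : nadj E 0 j = nadj G 0 j && (j != d).
  by rewrite hE /swap_adj; case: (nadj G 0 j); lia.
have [oE _ _ _] := dissectionP E.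
have nz : split_coef x (mon D) (mon O) (chords E) != 0%R.
  apply: (split_coef_neq0 charK0); last first.
    have [e [eE _ _ h1 h2]] := piece_root_split sE.
    by exists e => //; rewrite /cuts h1 h2 !eqxx.
  move=> e eE _; apply: krev1_eq0 => //; have lt_e := oE _ eE; have e2n := ltn_ord e.2.
  have [e0|e0] := posnP e.1; first by apply/orP; right; apply/eqP/val_inj.
  have nE := nadj_chord eE; apply/orP; left.
  (* A chord away from the root ends at [d.+1], since otherwise it would close a triangle in the
     star D. It then points to [d.+1], which is joined to the root, and is not reversed. *)
  have e2d : e.2 = d.+1 :> nat.
    apply/eqP; apply: contraT => ne.
    have := split_inner sE (i := e.1) (j := e.2); rewrite nE => /(_ _ _)/esym D12.
    have D12' : nadj D e.1 e.2 by apply: D12; lia.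
    by case: (no_triangle (star_D _) D12' (star_D _)); lia.
  have Ev0 : nadj E e.2 0 by rewrite e2d Ev.
  apply: connect1; rewrite mkchordE // adj_mkchord; last exact: ordered_sub (subD1set _ _) oE.
  rewrite in_setD1 -adj_mkchord // -nadj_ord; apply/andP; split=> //.
  apply/eqP => ee; have := mkchord_fst e.2 ord0.
  by rewrite ee minn0 => e00; rewrite e00 in e0.
have {}nz := same_neq0 h _ nz; have {}nz : split_coef x (mon Z) (mon W) (chords E) != 0%R.
  by apply: nz; rewrite nd.
have Edd : nadj E d d.+1 by rewrite nadjC Ev eqxx orbT.
(* The vertex [d] is no longer joined to the root, so a splitting chord {0, u} has u < d. Then {d,
   d.+1} survives in the outer piece away from its root, which a star excludes. *)
have out p q (X : dissection p) (Y : dissection q) u : p + q = d -> 0 < q -> star Y ->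
    root_split E u X Y -> False.
  move=> pqd q0 sY sEu; have [Eu0 up _ _ _] := sEu.
  have ud : u != d by apply: contraTneq Eu0 => ->; rewrite rootE eqxx andbF.
  have := split_outer sEu (i := d) (j := d.+1); rewrite Edd => Yd.
  have Ydd : nadj Y (d - u) (d.+1 - u) by rewrite -Yd; lia.
  by case: (no_triangle (sY _ _) Ydd (sY _ _)); lia.
have [||u [sEu|sEu]] := split_root_ex nz; try lia.
  exact: out star_W sEu.
by apply: (out _ _ _ _ _ _ r0 star_Z sEu); lia.
Qed.

End Single.

Lemma is_dissection0 : is_dissection (set0 : {set chord 0}).
Proof.
apply: connected_dissection; rewrite ?cards0 //.
- by move=> c; rewrite inE.
- by move=> c; rewrite inE.
- by move=> u; rewrite (ord1 u) connect0.
Qed.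

Lemma not_same_coef (K : fieldType) (charK0 : [pchar K]%R =i pred0) (x : K) d r s
    (D : dissection d) (O : dissection 0) (Z : dissection r) (W : dissection s) :
  same_coef x D O Z W -> 0 < r -> 0 < s -> False.
Proof.
move=> h r0 s0; have [G [G' [lG lG' [[l1 l2]|[l1 l2]]]]] := same_leaf_splits charK0 h.
  exact: (not_same_single charK0 h r0 s0 lG l1 lG' l2).
exact: (not_same_single charK0 (same_coefr h) s0 r0 lG l1 lG' l2).
Qed.

(** * From coefficients back to the map L *)

Lemma mon_tagged (D : ndiagram) : mon (tagged D) = ucm D.
Proof. by case: D. Qed.

Lemma ndiagram_mon_inj (D E : ndiagram) : mon (tagged D) = mon (tagged E) -> D = E.
Proof. by move/mon_nadj => [[tDE] h]; apply: nadj_ndiagram. Qed.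

Lemma L_prod_same (K : fieldType) (x : K) (D1 D2 G1 G2 : ndiagram) :
  L_prod x D1 D2 = L_prod x G1 G2 ->
  same_coef x (tagged D1) (tagged D2) (tagged G1) (tagged G2).
Proof.
move=> e n E; rewrite !mon_tagged.
pose F : ndiagram := Tagged (fun k => dissection k.+1) E.
have e1 := L_prodE x D1 D2 F; have e2 := L_prodE x G1 G2 F.
rewrite e in e1.
exact: etrans (esym e1) e2.
Qed.

Lemma L_diag_same (K : fieldType) (x : K) (D G1 G2 : ndiagram) (O : dissection 0) :
  L_diag x D = L_prod x G1 G2 -> same_coef x (tagged D) O (tagged G1) (tagged G2).
Proof.
move=> e n E; rewrite !mon_tagged.
pose F : ndiagram := Tagged (fun k => dissection k.+1) E.
have e1 := L_diagE x D F; have e2 := L_prodE x G1 G2 F.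
rewrite e in e1; have e3 := chord_coefE x D E.
exact: etrans (esym e3) (etrans (esym e1) e2).
Qed.

Lemma L_prodC (K : fieldType) (x : K) (D1 D2 : ndiagram) : L_prod x D1 D2 = L_prod x D2 D1.
Proof.
apply/malgP => E; apply: etrans (L_prodE x D1 D2 E) (etrans _ (esym (L_prodE x D2 D1 E))).
exact: split_coefC.
Qed.

Local Open Scope ring_scope.

Theorem proposition47 (K : fieldType) (charK0 : [pchar K] =i pred0) (x : K)
    (D D1 D2 G1 G2 : ndiagram) :
  L_diag x D <> L_prod x G1 G2 /\
  (L_prod x D1 D2 = L_prod x G1 G2 <->
     (D1, D2) = (G1, G2) \/ (D1, D2) = (G2, G1)).
Proof.
split.
  by move/(L_diag_same (Dissection is_dissection0))/(not_same_coef charK0); apply.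
split=> [e|[[e1 e2]|[e1 e2]]].
- have h := L_prod_same e.
  case: (same_coef_eq charK0 h (ltn0Sn _) (ltn0Sn _) (ltn0Sn _) (ltn0Sn _)) => -[h1 h2].
  + by left; exact: f_equal2 (ndiagram_mon_inj h1) (ndiagram_mon_inj h2).
  + by right; exact: f_equal2 (ndiagram_mon_inj h1) (ndiagram_mon_inj h2).
- by rewrite e1 e2.
- by rewrite e1 e2; exact: L_prodC.
Qed.
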